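(* Let $p\geq 1$ be a real number, let $E$ be an infinite-dimensional superreflexive Banach space and let $F$ be an infinite-dimensional Banach space. Suppose that either $E$ contains a complemented infinite-dimensional subspace with unconditional basis, or $F$ contains an infinite unconditional basic sequence. Then $\mathcal{K}(E;F)\setminus \Pi_{p}(E;F)$ is lineable (hence $\mathcal{L}(E;F)\setminus \Pi_{p}(E;F)$ is lineable).
   Context: All Banach spaces are over the real or the complex field. $\mathcal{L}(E;F)$ denotes the space of bounded linear operators from $E$ to $F$, and $\mathcal{K}(E;F)$ the subspace of compact operators. For $1\le p<\infty$, $\Pi_p(E;F)$ denotes the space of absolutely $p$-summing operators, i.e. those $u\in\mathcal{L}(E;F)$ such that $\sum_j \|u(x_j)\|^p<\infty$ whenever $(x_j)_{j=1}^\infty$ is weakly $p$-summable in $E$, meaning $\sum_j |\varphi(x_j)|^p<\infty$ for every $\varphi\in E^*$. A subset $A$ of an infinite-dimensional vector space $X$ is called lineable if $A\cup\{0\}$ contains an infinite-dimensional linear subspace of $X$. *)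

(* Defs.v *)
From HB Require Import structures.
From mathcomp Require Import all_boot all_order all_algebra.
From mathcomp Require Import all_classical all_reals all_analysis.
From mathcomp Require Import complex.

Set Implicit Arguments.
Unset Strict Implicit.
Unset Printing Implicit Defensive.

Import Order.TTheory GRing.Theory Num.Theory.
Import numFieldNormedType.Exports.

Local Open Scope classical_set_scope.
Local Open Scope ring_scope.

(** The norm of a [normedModType K] takes its values in [K].  For complex [K]
    these values are real complex numbers; [rnorm] is the same norm viewed in
    [R], where real powers and suprema are available. *)

Variant scalar_kind := RealScalars | ComplexScalars.

Definition scalars (R : realType) (k : scalar_kind) : numFieldType :=
  match k with RealScalars => R | ComplexScalars => R[i] end.

Definition re_scalar (R : realType) (k : scalar_kind) : scalars R k -> R :=
  match k with RealScalars => id | ComplexScalars => @complex.Re R end.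

Definition of_real (R : realType) (k : scalar_kind) : R -> scalars R k :=
  match k with
  | RealScalars => id
  | ComplexScalars => fun r => (real_complex R r : R[i])
  end.
Arguments of_real {R} k r.

Definition rnorm (R : realType) (k : scalar_kind)
  (V : normedModType (scalars R k)) (x : V) : R := re_scalar `|x|.

Section scalar_theory.
Variables (R : realType) (k : scalar_kind).
Local Notation K := (scalars R k).

Lemma of_realK (r : R) : re_scalar (of_real k r) = r.
Proof. by case: k. Qed.

Lemma of_real0 : of_real k (0 : R) = 0.
Proof. by case: k. Qed.

Lemma of_realD (r s : R) : of_real k (r + s) = of_real k r + of_real k s.
Proof. by case: k => //=; rewrite rmorphD. Qed.

Lemma of_realM (r s : R) : of_real k (r * s) = of_real k r * of_real k s.
Proof. by case: k => //=; rewrite rmorphM. Qed.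

Lemma ler_of_real (r s : R) : (of_real k r <= of_real k s) = (r <= s).
Proof. by case: k => //=; rewrite lecR. Qed.

Lemma ger0_re_scalarK (x : K) : 0 <= x -> of_real k (re_scalar x) = x.
Proof.
by rewrite /of_real /re_scalar; case: k x => //= -[a b]; rewrite lecE /= => /andP[/eqP->].
Qed.

Lemma rnormE (V : normedModType K) (x : V) : of_real k (rnorm x) = `|x|.
Proof. exact: ger0_re_scalarK. Qed.

Lemma rnorm_ge0 (V : normedModType K) (x : V) : 0 <= rnorm x.
Proof. by rewrite -ler_of_real rnormE of_real0. Qed.

Lemma ler_rnormD (V : normedModType K) (x y : V) :
  rnorm (x + y) <= rnorm x + rnorm y.
Proof. by rewrite -ler_of_real of_realD !rnormE ler_normD. Qed.

Lemma rnormZ (V : normedModType K) (a : K) (x : V) :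
  rnorm (a *: x) = re_scalar `|a| * rnorm x.
Proof.
by rewrite -[LHS](of_realK) rnormE normrZ -[`|a| in LHS]ger0_re_scalarK //
  -(rnormE x) -of_realM of_realK.
Qed.

Lemma rnorm_eq0 (V : normedModType K) (x : V) : rnorm x = 0 -> x = 0.
Proof. by move=> x0; apply/normr0_eq0; rewrite -rnormE x0 of_real0. Qed.

Lemma rnorm0 (V : normedModType K) : rnorm (0 : V) = 0.
Proof. by rewrite -[LHS](of_realK) rnormE normr0 -of_real0 of_realK. Qed.

End scalar_theory.

Section bounded_operators.
Variables (K : numFieldType) (E F : normedModType K).

Definition bounded_operator (f : E -> F) : Prop :=
  linear f /\ exists M : K, forall x, `|f x| <= M * `|x|.

Definition bounded_operators : {pred E -> F} :=
  mem [set f : E -> F | bounded_operator f].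

Structure blin := Blin { blin_fun :> E -> F; _ : blin_fun \in bounded_operators }.

HB.instance Definition _ := [isSub for blin_fun].
HB.instance Definition _ := [Choice of blin by <:].

Lemma blinP (u : blin) : bounded_operator u.
Proof. by have := valP u; rewrite inE. Qed.

Lemma blin_linear (u : blin) : linear u.
Proof. by have [] := blinP u. Qed.

HB.instance Definition _ (u : blin) :=
  GRing.isLinear.Build K E F *:%R (blin_fun u) (@blin_linear u).

Lemma bounded_operators_submod_closed : submod_closed bounded_operators.
Proof.
split=> [|a f g]; rewrite !inE /=.
  split=> [b x y|]; first by rewrite -[LHS]/(0 : F) scaler0 addr0.
  by exists 0 => x; rewrite normr0 mul0r.
move=> [fl [M fM]] [gl [N gN]]; split=> [b x y|].
  rewrite -[LHS]/(a *: f _ + g _) fl gl -[(a *: f + g) x]/(a *: f x + g x).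
  rewrite -[(a *: f + g) y]/(a *: f y + g y) !scalerDr !scalerA [b * a]mulrC -!addrA.
  by congr (_ + _); rewrite addrCA.
exists (`|a| * M + N) => x; rewrite -[X in `|X|]/(a *: f x + g x) (le_trans (ler_normD _ _)) //.
by rewrite normrZ mulrDl -mulrA lerD ?gN // ler_wpM2l.
Qed.

HB.instance Definition _ :=
  GRing.isSubmodClosed.Build K (E -> F) bounded_operators
    bounded_operators_submod_closed.
HB.instance Definition _ := [SubChoice_isSubLmodule of blin by <:].

Lemma blin_eqP (u v : blin) : u =1 v -> u = v.
Proof. by move=> uv; apply/val_inj/funext. Qed.

End bounded_operators.

Section operator_norm.
Variables (R : realType) (k : scalar_kind).
Local Notation K := (scalars R k).
Variables (E F : normedModType K).
Implicit Types u v : blin E F.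

Definition opnorm u : R :=
  sup [set rnorm (u x) | x in [set x | rnorm x <= 1]].

Lemma opnorm_has_sup u :
  has_sup [set rnorm (u x) | x in [set x | rnorm x <= 1]].
Proof.
split.
  by exists (rnorm (u 0)); exists 0 => //=; rewrite rnorm0.
have [_ [M uM]] := blinP u.
have M0 (x : E) : x != 0 -> 0 <= M.
  move=> x0; rewrite -(pmulr_lge0 _ (_ : 0 < `|x|)) ?normr_gt0 //.
  exact: le_trans (uM x).
exists (re_scalar `|M|) => _ [x /= x1 <-].
rewrite -(ler_of_real k) rnormE ger0_re_scalarK //.
have [->|x0] := eqVneq x 0; first by rewrite linear0 normr0.
rewrite (le_trans (uM x)) // (ger0_norm (M0 x x0)) ler_piMr ?(M0 x) //.
have -> : 1 = of_real k 1 :> K by case: (k).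
by rewrite -rnormE ler_of_real.
Qed.

Lemma ler_opnorm u x : rnorm x <= 1 -> rnorm (u x) <= opnorm u.
Proof. by move=> x1; apply: sup_upper_bound (opnorm_has_sup u) _ _; exists x. Qed.

Lemma opnorm_le u (M : R) :
  (forall x, rnorm x <= 1 -> rnorm (u x) <= M) -> opnorm u <= M.
Proof.
move=> uM; apply: ge_sup; first by have [] := opnorm_has_sup u.
by move=> _ [x /= x1 <-]; exact: uM.
Qed.

Lemma opnorm_ge0 u : 0 <= opnorm u.
Proof. by rewrite (le_trans (rnorm_ge0 (u 0))) // ler_opnorm // rnorm0 ler01. Qed.

Lemma rnorm_blin u x : rnorm (u x) <= opnorm u * rnorm x.
Proof.
have [->|x0] := eqVneq x 0; first by rewrite linear0 !rnorm0 mulr0.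
have nx0 : 0 < rnorm x.
  rewrite lt_def rnorm_ge0 andbT; apply: contra_neq x0; exact: rnorm_eq0.
have rV (W : normedModType K) (y : W) :
    rnorm (of_real k (rnorm x)^-1 *: y) = (rnorm x)^-1 * rnorm y.
  rewrite rnormZ ger0_norm ?of_realK //.
  by rewrite -of_real0 ler_of_real invr_ge0 ltW.
have := @ler_opnorm u (of_real k (rnorm x)^-1 *: x).
rewrite linearZ /= !rV mulVf ?gt_eqF // => /(_ (lexx _)).
by rewrite ler_pdivrMl // mulrC.
Qed.

Let opnormK u : K := of_real k (opnorm u).

Let opnormKD u v : opnormK (u + v) <= opnormK u + opnormK v.
Proof.
rewrite /opnormK -of_realD ler_of_real; apply: opnorm_le => x x1.
by rewrite (le_trans (ler_rnormD _ _)) // lerD // ler_opnorm.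
Qed.

Let opnormZ_le (a : K) u : opnorm (a *: u) <= re_scalar `|a| * opnorm u.
Proof.
apply: opnorm_le => x x1.
rewrite (_ : (a *: u) x = a *: u x) // rnormZ ler_wpM2l ?ler_opnorm //.
by rewrite -(ler_of_real k) of_real0 ger0_re_scalarK.
Qed.

Let opnormKZ (a : K) u : opnormK (a *: u) = `|a| * opnormK u.
Proof.
rewrite /opnormK -[`|a|]ger0_re_scalarK // -of_realM; congr of_real.
apply/eqP; rewrite eq_le opnormZ_le /=.
have [->|a0] := eqVneq a 0.
  have -> : re_scalar `|0 : K| = 0 by rewrite normr0 -of_real0 of_realK.
  by rewrite mul0r opnorm_ge0.
have na0 : 0 < re_scalar `|a|.
  rewrite lt_def -(ler_of_real k) of_real0 ger0_re_scalarK // normr_ge0 andbT.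
  apply: contra_neq a0 => a0; apply/normr0_eq0.
  by rewrite -[LHS]ger0_re_scalarK // a0 of_real0.
rewrite -ler_pdivlMl //.
have := opnormZ_le a^-1 (a *: u); rewrite scalerA mulVf // scale1r.
suff -> : re_scalar `|a^-1| = (re_scalar `|a|)^-1 by [].
apply: (mulIf (lt0r_neq0 na0)); rewrite mulVf ?gt_eqF //.
rewrite -[LHS](of_realK k) of_realM !ger0_re_scalarK // -normrM mulVf // normr1.
by case: (k).
Qed.

Let opnormK_eq0 u : opnormK u = 0 -> u = 0.
Proof.
rewrite /opnormK -(of_real0 R k) => /(congr1 (@re_scalar R k)).
rewrite !of_realK => u0; apply: blin_eqP => x.
apply: rnorm_eq0; apply: le_anti; rewrite rnorm_ge0 andbT.
by rewrite (le_trans (rnorm_blin u x)) // u0 mul0r.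
Qed.

HB.instance Definition _ :=
  @Lmodule_isNormed.Build K (blin E F) opnormK opnormKD opnormKZ opnormK_eq0.

Lemma rnorm_opnorm u : rnorm u = opnorm u.
Proof. exact: of_realK. Qed.

End operator_norm.

Section linear_notions.
Variables (K : numFieldType) (V : lmodType K).

Definition linear_subspace (S : set V) : Prop :=
  S 0 /\ forall (a : K) x y, S x -> S y -> S (a *: x + y).

Definition finite_dimensional (S : set V) : Prop :=
  exists (n : nat) (v : 'I_n -> V), (forall i, S (v i)) /\
    forall x, S x -> exists c : 'I_n -> K, x = \sum_(i < n) c i *: v i.

Definition infinite_dimensional (S : set V) : Prop := ~ finite_dimensional S.

Definition linear_span (v : nat -> V) : set V :=
  [set x | exists (n : nat) (c : nat -> K), x = \sum_(i < n) c i *: v i].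

Definition lineable (A : set V) : Prop :=
  exists S : set V, [/\ linear_subspace S, infinite_dimensional S & S `<=` A `|` [set 0]].

End linear_notions.

Section bases.
Variables (K : numFieldType) (E : normedModType K).

Definition schauder_basis (S : set E) (e : nat -> E) : Prop :=
  (forall n, S (e n)) /\
  forall x, S x ->
    exists! a : nat -> K, series (fun n => a n *: e n) @ \oo --> x.

Definition unconditionally_convergent (x : nat -> E) : Prop :=
  forall s : nat -> nat, bijective s -> cvgn (series (x \o s)).

Definition unconditional_basis (S : set E) (e : nat -> E) : Prop :=
  schauder_basis S e /\
  forall a : nat -> K, cvgn (series (fun n => a n *: e n)) ->
    unconditionally_convergent (fun n => a n *: e n).

(** A basic sequence is a Schauder basis of its closed linear span; being
    indexed by [nat], it is infinite. *)
Definition unconditional_basic_sequence (e : nat -> E) : Prop :=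
  unconditional_basis (closure (linear_span e)) e.

Definition complemented (S : set E) : Prop :=
  [/\ linear_subspace S, closed S &
    exists P : blin E E, (forall x, S (P x)) /\ (forall x, S x -> P x = x)].

End bases.

Section superreflexivity.
Variables (R : realType) (k : scalar_kind).
Local Notation K := (scalars R k).

Definition dual_space (E : normedModType K) : normedModType K := blin E K^o.

(** The canonical embedding of [E] into its bidual is onto. *)
Definition reflexive (E : normedModType K) : Prop :=
  forall Phi : dual_space (dual_space E), exists x : E, forall phi : dual_space E, Phi phi = phi x.

(** [X] is finitely representable in [E] (James).  Only the restriction of [T]
    to [G] matters; [T] is an arbitrary function off [G]. *)
Definition finitely_representable (X E : normedModType K) : Prop :=
  forall (G : set X) (eps : R),
    linear_subspace G -> finite_dimensional G -> 0 < eps ->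
    exists T : X -> E,
      (forall (a : K) x y, G x -> G y -> T (a *: x + y) = a *: T x + T y) /\
      (forall x, G x ->
         (1 - eps) * rnorm x <= rnorm (T x) <= (1 + eps) * rnorm x).

Definition superreflexive (E : completeNormedModType K) : Prop :=
  forall X : completeNormedModType K, finitely_representable X E -> reflexive X.

End superreflexivity.

Section operator_classes.
Variables (R : realType) (k : scalar_kind).
Local Notation K := (scalars R k).

Definition weakly_summable (p : R) (E : normedModType K) (x : nat -> E) : Prop :=
  forall phi : dual_space E, (\sum_(j <oo) (rnorm (phi (x j)) `^ p)%:E < +oo)%E.

Variables (E F : normedModType K).

Definition compact_operators : set (blin E F) :=
  [set u | precompact (u @` [set x | `|x| <= 1])].

Definition absolutely_summing_operators (p : R) : set (blin E F) :=
  [set u | forall x : nat -> E, weakly_summable p x ->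
     (\sum_(j <oo) (rnorm (u (x j)) `^ p)%:E < +oo)%E].

End operator_classes.
Arguments compact_operators {R k} E F.
Arguments absolutely_summing_operators {R k} E F p.

(* Main.v *)
(** Superreflexivity enters through a form of James' criterion. If the unit ball of
    [E] contained arbitrarily long, almost monotone basic sequences on which a
    functional of norm one stays bounded away from [0], then the space of scalar
    sequences normed by the ultralimit of these bases would be finitely
    representable in [E] without being reflexive. Hence, along a long almost monotone
    basic sequence [w], a functional of norm one is small at all but boundedly many
    [w_i], so that the weak [p]-norm of [w_1, ..., w_N] is [o(N^(1/p))].

    The Dvoretzky-Rogers lemma in the dual of [E] and in [F] gives functionals [g_i] and
    vectors [y_i] with upper [2]-estimates, which bounds the norm of
    [u = sum_i g_i (x) y_i]; Mazur's construction, made uniform by a pigeonhole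
    argument, gives a basic sequence [w] almost biorthogonal to the [g_i], so that
    [||u w_i||] is bounded below. Finite-rank operators of norm one therefore have
    arbitrarily large [p]-summing norms.

    A gliding hump turns such operators [v_j] into compact operators
    [sum_j t_j c_j v_j]. Letting [t] be constant on the fibres of the [2]-adic
    valuation of [j + 1] gives an infinite-dimensional space of compact operators
    whose only [p]-summing element is [0]. *)
From HB Require Import structures.
Require Import Defs.
From mathcomp Require Import all_boot all_order all_algebra.
From mathcomp Require Import all_classical all_reals all_analysis.
From mathcomp Require Import complex ring lra perm.

Set Implicit Arguments.
Unset Strict Implicit.
Unset Printing Implicit Defensive.

Import Order.TTheory GRing.Theory Num.Theory.
Import numFieldNormedType.Exports.

Local Open Scope classical_set_scope.
Local Open Scope ring_scope.

(** * Scalars, ultralimits, finite dimension *)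

(** The order of the quantifiers shapes the construction. The bound [M] on the number of large
    values depends on the threshold [eps] alone; the length [N] must then be large against
    [M / eps ^ p], and the basis defect below [1 / (M + 1)]. Hence almost biorthogonal systems of
    every finite length and of prescribed defect are required. Given them, the norms of the [u w_i]
    stay above a fixed [delta], so that [N * delta ^ p] is compared with [2 * N * eps ^ p], and
    [eps] is free. The obstacle is that Mazur's argument wants a vector almost annihilated by
    finitely many norming functionals, whereas the vectors that come with the [g_i] have no such
    property. The difference of two of them that fall into the same cell has it. The number of cells
    must then be known before any vector is chosen: the norming functionals are therefore indexed by
    nets of coefficients, not of vectors, and the number of pairs to start from is computed
    backwards. Norms, limits and moduli are all taken in [R], so that real and complex scalars share
    one argument. *)

Section scalar_modulus.
Variables (R : realType) (k : scalar_kind).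
Local Notation K := (scalars R k).
Implicit Types (z w : K) (r s : R).

Definition modulus z : R := re_scalar `|z|.

Lemma of_real_inj : injective (@of_real R k).
Proof. exact: can_inj (@of_realK R k). Qed.

Lemma modulusE z : of_real k (modulus z) = `|z|.
Proof. exact: ger0_re_scalarK. Qed.

Lemma of_real1 : of_real k (1 : R) = 1.
Proof. by case: (k). Qed.

Lemma of_realN r : of_real k (- r) = - of_real k r.
Proof. by apply/eqP; rewrite -addr_eq0 -of_realD addNr of_real0. Qed.

Lemma of_real_eq0 r : (of_real k r == 0) = (r == 0).
Proof. by rewrite -(of_real0 R k) (inj_eq of_real_inj). Qed.

Lemma modulus_ge0 z : 0 <= modulus z.
Proof. by rewrite -(ler_of_real k) of_real0 modulusE. Qed.

Lemma modulusM z w : modulus (z * w) = modulus z * modulus w.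
Proof. by apply: of_real_inj; rewrite of_realM !modulusE normrM. Qed.

Lemma modulusD z w : modulus (z + w) <= modulus z + modulus w.
Proof. by rewrite -(ler_of_real k) of_realD !modulusE ler_normD. Qed.

Lemma modulusN z : modulus (- z) = modulus z.
Proof. by rewrite /modulus normrN. Qed.

Lemma modulus0 : modulus 0 = 0.
Proof. by apply: of_real_inj; rewrite modulusE normr0 of_real0. Qed.

Lemma modulus1 : modulus 1 = 1.
Proof. by apply: of_real_inj; rewrite modulusE normr1 of_real1. Qed.

Lemma modulus_eq0 z : (modulus z == 0) = (z == 0).
Proof. by rewrite -of_real_eq0 modulusE normr_eq0. Qed.

Lemma modulus_gt0 z : (0 < modulus z) = (z != 0).
Proof. by rewrite lt_def modulus_ge0 andbT modulus_eq0. Qed.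

Lemma modulus_of_real r : modulus (of_real k r) = `|r|.
Proof.
have pos s : 0 <= s -> modulus (of_real k s) = s.
  move=> s0; apply: of_real_inj; rewrite modulusE ger0_norm //.
  by rewrite -(of_real0 R k) ler_of_real.
have [r0|r0] := leP 0 r; first by rewrite ger0_norm // pos.
by rewrite ltr0_norm // -modulusN -of_realN; apply: pos; rewrite oppr_ge0 ltW.
Qed.

Lemma modulusV z : modulus z^-1 = (modulus z)^-1.
Proof.
have [->|z0] := eqVneq z 0; first by rewrite invr0 modulus0 invr0.
have m0 : modulus z != 0 by rewrite modulus_eq0.
by apply: (mulfI m0); rewrite mulfV // -modulusM mulfV // modulus1.
Qed.

Lemma rnormZm (V : normedModType K) z (x : V) :
  rnorm (z *: x) = modulus z * rnorm x.
Proof. exact: rnormZ. Qed.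

Lemma rnorm_modulus z : rnorm (z : K^o) = modulus z.
Proof. by []. Qed.

Lemma modulus_dist z w : `|modulus z - modulus w| <= modulus (z - w).
Proof.
have h a b : modulus a - modulus b <= modulus (a - b).
  by rewrite lerBlDr -{1}(subrK b a) modulusD.
by rewrite ler_norml h andbT lerNl opprB -(modulusN (z - w)) opprB h.
Qed.

End scalar_modulus.

Section rnorm_theory.
Variables (R : realType) (k : scalar_kind).
Local Notation K := (scalars R k).
Variables (V : normedModType K).
Implicit Types x y : V.

Lemma rnormN x : rnorm (- x) = rnorm x.
Proof. by rewrite /rnorm normrN. Qed.

Lemma rnormB x y : rnorm (x - y) = rnorm (y - x).
Proof. by rewrite -rnormN opprB. Qed.

Lemma rnorm_gt0 x : (0 < rnorm x) = (x != 0).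
Proof.
rewrite lt_def rnorm_ge0 andbT; congr negb; apply/eqP/eqP => [|->].
  exact: rnorm_eq0.
exact: rnorm0.
Qed.

Lemma ler_rnormB x y : rnorm (x - y) <= rnorm x + rnorm y.
Proof. by rewrite (le_trans (ler_rnormD _ _)) // rnormN. Qed.

Lemma lerB_rnorm x y : rnorm x - rnorm y <= rnorm (x - y).
Proof. by rewrite lerBlDr -{1}(subrK y x) ler_rnormD. Qed.

Lemma lerB_rnormD x y : rnorm x - rnorm y <= rnorm (x + y).
Proof. by rewrite -[in X in _ <= X](opprK y) -{1}(rnormN y) lerB_rnorm. Qed.

Lemma rnorm_dist x y : `|rnorm x - rnorm y| <= rnorm (x - y).
Proof. by rewrite ler_norml lerB_rnorm andbT lerNl opprB rnormB lerB_rnorm. Qed.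

Lemma rnorm_sum I (l : seq I) (P : pred I) (f : I -> V) :
  rnorm (\sum_(i <- l | P i) f i) <= \sum_(i <- l | P i) rnorm (f i).
Proof.
elim/big_ind2 : _ => [|x a y b xa yb|//]; first by rewrite rnorm0.
by rewrite (le_trans (ler_rnormD _ _)) // lerD.
Qed.

End rnorm_theory.

Section ultralimits.
Variables (R : realType) (k : scalar_kind).
Local Notation K := (scalars R k).

(** The image of an ultrafilter is an ultrafilter, and here it lives on a compact segment. *)
Lemma ultra_bounded_cvg (T : Type) (U : set_system T) (UF : UltraFilter U)
    (s : T -> R) (B : R) : (\forall n \near U, `|s n| <= B) ->
  exists l : R, s n @[n --> U] --> l.
Proof.
move=> sB; have := @segment_compact R (- B) B; rewrite compact_ultra => cp.
have UI : UltraFilter (fmap s U).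
  split; first exact: fmap_proper_filter.
  move=> G GF sG; apply/seteqP; split; last exact: sG.
  move=> A GA; have [//|] := in_ultra_setVsetC (s @^-1` A) UF.
  move=> UcA; have /filterI/(_ GA) : G (~` A) by apply: sG.
  by rewrite setICl => /filter_ex[].
have [|l [_ /= sl]] := cp _ UI; last by exists l.
by apply: filterS sB => n /=; rewrite in_itv /= ler_norml.
Qed.

(** The limit is expressed by a modulus in [R], so that later arguments need not distinguish the
    scalar fields. Over the complex field, real and imaginary parts converge separately. *)
Lemma ultra_bounded_modulus (T : Type) (U : set_system T) (UF : UltraFilter U)
    (s : T -> K) (B : R) : (\forall n \near U, modulus (s n) <= B) ->
  exists l : K, modulus (s n - l) @[n --> U] --> (0 : R).
Proof.
case: (k) s => /= s sB.
  have [l sl] := ultra_bounded_cvg UF sB; exists l.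
  rewrite /modulus /=; move/cvgrPdist_lt : sl => sl.
  apply/cvgrPdist_lt => e e0; apply: filterS (sl e e0) => n.
  by rewrite sub0r normrN normr_id distrC.
have mle (z : R[i]) :
    modulus (k := ComplexScalars) z <= `|complex.Re z| + `|complex.Im z|.
  rewrite /modulus normc_def /= -(@ler_pXn2r _ 2) ?nnegrE ?sqrtr_ge0 ?addr_ge0 //.
  rewrite sqr_sqrtr ?addr_ge0 ?sqr_ge0 // sqrrD !real_normK ?num_real // -addrA lerD2l.
  by rewrite lerDr mulrn_wge0 ?mulr_ge0.
have mge (z : R[i]) : `|complex.Re z| <= modulus (k := ComplexScalars) z
    /\ `|complex.Im z| <= modulus (k := ComplexScalars) z.
  rewrite /modulus normc_def /= -!sqrtr_sqr; split; apply: ler_wsqrtr.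
    by rewrite lerDl sqr_ge0.
  by rewrite lerDr sqr_ge0.
have [a sa] : exists a : R, complex.Re (s n) @[n --> U] --> a.
  by apply: (ultra_bounded_cvg UF (B := B)); apply: filterS sB => n; apply: le_trans; exact: (mge _).1.
have [b sb] : exists b : R, complex.Im (s n) @[n --> U] --> b.
  by apply: (ultra_bounded_cvg UF (B := B)); apply: filterS sB => n; apply: le_trans; exact: (mge _).2.
exists (Complex a b).
move/cvgrPdist_lt : sa => sa; move/cvgrPdist_lt : sb => sb.
apply/cvgrPdist_lt => e e0; have e2 : 0 < e / 2 by rewrite divr_gt0.
apply: filterS2 (sa _ e2) (sb _ e2) => n an bn.
rewrite sub0r normrN ger0_norm; last exact: (@modulus_ge0 R ComplexScalars).
apply: le_lt_trans (mle _) _.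
case: (s n) an bn => x y /= an bn.
by rewrite (splitr e) ltrD // distrC.
Qed.

End ultralimits.

Lemma free_ultrafilter :
  exists U : set_system nat, UltraFilter U /\ forall n, U [set m | (n <= m)%N].
Proof.
have [U [UF oU]] := ultraFilterLemma eventually_filter.
by exists U; split=> // n; apply: oU; exists n.
Qed.

Section linear_independence.
Variables (K : numFieldType) (V : lmodType K).

(** Only the first [n] values of [v] matter; indexing by [nat] lets a family be lengthened or
    truncated without a change of type. *)
Definition independent (n : nat) (v : nat -> V) : Prop :=
  forall c : nat -> K, \sum_(i < n) c i *: v i = 0 ->
  forall i, (i < n)%N -> c i = 0.

(** The coefficient matrix has [n + 1] rows and [n] columns, so its left kernel contains a nonzero
    row, which is a relation between the [w j]. *)
Lemma dependent_of_span n (v w : nat -> V) :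
  (forall j, (j <= n)%N -> exists c : nat -> K, w j = \sum_(i < n) c i *: v i) ->
  ~ independent n.+1 w.
Proof.
move=> h; have {}h (j : 'I_n.+1) : exists c : nat -> K, w j = \sum_(i < n) c i *: v i.
  by apply: h; rewrite -ltnS.
have [c wE] := choice h.
pose A : 'M[K]_(n.+1, n) := \matrix_(j, i) c j i.
have : kermx A != 0.
  rewrite kermx_eq0 /row_free neq_ltn; apply/orP; left.
  by rewrite ltnS rank_leq_col.
case/rowV0Pn => d /sub_kermxP dA d0 ind.
have dE (i : 'I_n.+1) : d 0 i = 0.
  have := ind (fun j => d 0 (inord j)) _ i (ltn_ord i).
  rewrite inord_val; apply.
  under eq_bigr => j _ do rewrite inord_val wE scaler_sumr.
  rewrite exchange_big big1 //= => l _.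
  under eq_bigr => j _ do rewrite scalerA.
  rewrite -scaler_suml.
  have /matrixP/(_ 0 l) := dA; rewrite !mxE => dl.
  rewrite (_ : \sum_(_ < _) _ = 0) ?scale0r // -[RHS]dl.
  by apply: eq_bigr => j _; rewrite !mxE.
by move/eqP: d0; apply; apply/rowP => i; rewrite dE mxE.
Qed.

Lemma independent_extend n (v : nat -> V) x : independent n v ->
  (forall c : nat -> K, x <> \sum_(i < n) c i *: v i) ->
  independent n.+1 (fun i => if i == n then x else v i).
Proof.
move=> ind xv c; rewrite big_ord_recr /= eqxx => c0.
have vE : \sum_(i < n) c i *: (if i == n :> nat then x else v i) =
    \sum_(i < n) c i *: v i.
  by apply: eq_bigr => i _; rewrite ltn_eqF.
rewrite vE in c0.
have cn : c n = 0.
  apply: contrapT => /eqP cn; apply: (xv (fun i => - (c n)^-1 * c i)).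
  under eq_bigr => i _ do rewrite -scalerA.
  rewrite -scaler_sumr; move/eqP: c0; rewrite addr_eq0 => /eqP ->.
  by rewrite scalerN scaleNr opprK scalerA mulVf // scale1r.
move=> i; rewrite ltnS leq_eqVlt => /orP[/eqP -> //|]; apply: ind.
by move: c0; rewrite cn scale0r addr0.
Qed.

(** Greedy construction: a family that does not span can be lengthened by a vector outside its
    span. *)
Lemma independent_or_span (S : set V) m : linear_subspace S ->
  (exists n (v : nat -> V), [/\ independent n v, forall i, S (v i) &
     forall x, S x -> exists c : nat -> K, x = \sum_(i < n) c i *: v i]) \/
  (exists v : nat -> V, independent m v /\ forall i, S (v i)).
Proof.
move=> [S0 _]; elim: m => [|m [|[v [ind Sv]]]]; [|by left|].
  by right; exists (fun=> 0); split.
have [h|] := pselect (forall x, S x -> exists c : nat -> K, x = \sum_(i < m) c i *: v i).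
  by left; exists m, v.
move/existsNP => [x /not_implyP[Sx /forallNP xv]].
right; exists (fun i => if i == m then x else v i); split.
  exact: independent_extend.
by move=> i; case: ifP.
Qed.

End linear_independence.

Section finite_dimension.
Variables (K : numFieldType) (V : lmodType K).
Implicit Types S : set V.

Lemma infinite_dimensional_independent S m : linear_subspace S ->
  infinite_dimensional S -> exists v : nat -> V, independent m v /\ forall i, S (v i).
Proof.
move=> linS infS; have [[n [v [_ Sv spanv]]]|//] := independent_or_span m linS.
case: infS; exists n, (fun i : 'I_n => v i); split=> // x /spanv[c ->].
by exists (fun i : 'I_n => c i).
Qed.

Lemma finite_dimensional_basis S : linear_subspace S -> finite_dimensional S ->
  exists n (v : nat -> V), [/\ independent n v, forall i, S (v i) &
     forall x, S x -> exists c : nat -> K, x = \sum_(i < n) c i *: v i].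
Proof.
move=> linS [n [w [Sw spanw]]].
have [//|[v [ind Sv]]] := independent_or_span n.+1 linS.
case: (@dependent_of_span K V n (fun i => if insub i is Some j then w j else 0) v) => //.
move=> j _; have [c ->] := spanw _ (Sv j).
exists (fun i => if insub i is Some j then c j else 0).
by apply: eq_bigr => i _; rewrite valK.
Qed.

Lemma infinite_dimensional_of_independent S :
  (forall m, exists v : nat -> V, independent m v /\ forall i, S (v i)) ->
  infinite_dimensional S.
Proof.
move=> h [n [w [Sw spanw]]]; have [v [ind Sv]] := h n.+1.
case: (@dependent_of_span K V n (fun i => if insub i is Some j then w j else 0) v) => //.
move=> j _; have [c ->] := spanw _ (Sv j).
exists (fun i => if insub i is Some j then c j else 0).
by apply: eq_bigr => i _; rewrite valK.
Qed.

End finite_dimension.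

Section finite_dimensional_norm.
Variables (R : realType) (k : scalar_kind).
Local Notation K := (scalars R k).

Lemma cvg0D (T : Type) (U : set_system T) {UF : ProperFilter U} (f g : T -> R) :
  f t @[t --> U] --> (0 : R) -> g t @[t --> U] --> (0 : R) ->
  f t + g t @[t --> U] --> (0 : R).
Proof. by move=> f0 g0; have := cvgD f0 g0; rewrite addr0; apply. Qed.

Lemma cvg0Mr (T : Type) (U : set_system T) {UF : ProperFilter U} (f : T -> R) r :
  f t @[t --> U] --> (0 : R) -> f t * r @[t --> U] --> (0 : R).
Proof. by move=> f0; have := cvgM f0 (cvg_cst r); rewrite mul0r; apply. Qed.

Lemma cvg_sum0 (T : Type) (U : set_system T) {UF : ProperFilter U} n
    (f : nat -> T -> R) :
  (forall i, (i < n)%N -> f i t @[t --> U] --> (0 : R)) ->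
  \sum_(i < n) f i t @[t --> U] --> (0 : R).
Proof.
elim: n => [_|n ih h].
  by under eq_fun do rewrite big_ord0; exact: cvg_cst.
under eq_fun do rewrite big_ord_recr /=.
apply: cvg0D; last exact: h.
by apply: ih => i ni; apply: h; exact: ltnW.
Qed.

(* Normalised coefficient vectors with [||sum c_i v_i||] tending to 0 would have
   an ultralimit [l <> 0] with [sum l_i v_i = 0]. *)
Lemma independent_coef_bound (V : normedModType K) n (v : nat -> V) :
  independent n v -> exists B : R, 0 < B /\
  forall (c : nat -> K) i, (i < n)%N ->
    modulus (c i) <= B * rnorm (\sum_(j < n) c j *: v j).
Proof.
move=> ind; apply: contrapT => nB.
have bad (m : nat) : exists d : nat -> K,
    [/\ forall i, (i < n)%N -> modulus (d i) <= 1, 1 <= \sum_(i < n) modulus (d i) &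
      rnorm (\sum_(j < n) d j *: v j) <= (m.+1%:R)^-1].
  apply: contrapT => nd; apply: nB; exists m.+1%:R; split=> // c i ni.
  (* Dividing by a coefficient of maximal modulus brings all moduli below 1 and one of them to 1. *)
  have [j _ jmax] := @arg_maxP _ R 'I_n (Ordinal ni) xpredT (fun i => modulus (c i)) isT.
  have [cj0|cj0] := eqVneq (c j) 0.
    apply: le_trans (jmax (Ordinal ni) isT) _; rewrite cj0 modulus0.
    by rewrite mulr_ge0 ?rnorm_ge0.
  have mj : 0 < modulus (c j) by rewrite modulus_gt0.
  rewrite leNgt; apply/negP => big; apply: nd.
  exists (fun i => (c j)^-1 * c i); split.
  - move=> l nl; rewrite modulusM modulusV mulrC ler_pdivrMr // mul1r.
    exact: (jmax (Ordinal nl) isT).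
  - rewrite (bigD1 j) //= mulVf // modulus1 lerDl sumr_ge0 // => l _.
    exact: modulus_ge0.
  - under eq_bigr => l _ do rewrite -scalerA.
    rewrite -scaler_sumr rnormZm modulusV mulrC ler_pdivrMr // ler_pdivlMl //.
    by apply: le_trans (ltW big) _; exact: (jmax (Ordinal ni) isT).
have {bad} [d dP] := choice bad.
have [U [UF Uoo]] := free_ultrafilter.
have lim_ex (i : nat) : exists l : K, (i < n)%N -> modulus (d m i - l) @[m --> U] --> (0 : R).
  have [ni|ni] := ltnP i n; last by exists 0.
  have [|l dl] := @ultra_bounded_modulus R k nat U UF (d^~ i) 1; last by exists l.
  by apply: nearW => m; have [+ _ _] := dP m; apply.
have [l dl] := choice lim_ex.
have l0 : \sum_(j < n) l j *: v j = 0.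
  apply: rnorm_eq0; apply/eqP; rewrite eq_le rnorm_ge0 andbT.
  have cv : (m.+1%:R)^-1 + \sum_(j < n) modulus (d m j - l j) * rnorm (v j)
      @[m --> U] --> (0 : R).
    apply: cvg0D.
      have := @cvg_harmonic R; apply: cvg_trans; apply: cvg_app.
      by move=> A [N _ NA]; apply: filterS (Uoo N) => m; apply: NA.
    apply: (@cvg_sum0 _ U _ n (fun i m => modulus (d m i - l i) * rnorm (v i))) => i ni.
    apply: cvg0Mr; exact: dl.
  apply: (cvgr_to_ge cv); apply: nearW => m.
  have -> : \sum_(j < n) l j *: v j =
      \sum_(j < n) d m j *: v j - \sum_(j < n) (d m j - l j) *: v j.
    by rewrite -sumrB; apply: eq_bigr => i _; rewrite -scalerBl opprB addrC subrK.
  rewrite (le_trans (ler_rnormB _ _)) // lerD //; first by have [] := dP m.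
  rewrite (le_trans (rnorm_sum _ _ _)) //; apply: ler_sum => i _.
  by rewrite rnormZm.
have l1 : 1 <= \sum_(i < n) modulus (l i).
  have cv : \sum_(i < n) modulus (d m i - l i) @[m --> U] --> (0 : R).
    exact: (@cvg_sum0 _ U _ n (fun i m => modulus (d m i - l i))).
  rewrite -subr_le0; apply: (cvgr_to_ge cv); apply: nearW => m.
  rewrite lerBlDr; have [_ d1 _] := dP m; rewrite (le_trans d1) // -big_split /=.
  by apply: ler_sum => i _; rewrite -{1}(subrK (l i) (d m i)) modulusD.
have := l1; rewrite big1 ?ler10 // => i _.
by rewrite (ind _ l0 i) ?modulus0.
Qed.

End finite_dimensional_norm.

(** * Norming functionals *)

Lemma blin_of_bound (R : realType) (k : scalar_kind)
    (E F : normedModType (scalars R k)) (f : E -> F) (C : R) :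
  linear f -> 0 <= C -> (forall x, rnorm (f x) <= C * rnorm x) ->
  exists u : blin E F, u =1 f /\ opnorm u <= C.
Proof.
move=> flin C0 fC; have fb : f \in @bounded_operators _ E F.
  rewrite inE; split=> //; exists (of_real k C) => x.
  by rewrite -!rnormE -of_realM ler_of_real.
exists (Blin fb); split=> //; apply: opnorm_le => x x1.
by rewrite (le_trans (fC x)) // ler_piMr.
Qed.

Section Hahn_Banach.
Variables (R : realType) (k : scalar_kind).
Local Notation K := (scalars R k).
Variable V : normedModType K.
Local Notation "r ** x" := (of_real k r *: (x : V)) (at level 40).

(** Domination by the norm is included because it bounds every chain from below by [- rnorm], so
    that infima exist in Zorn's lemma. *)
Definition sublinear (p : V -> R) : Prop :=
  [/\ forall x y, p (x + y) <= p x + p y,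
      forall r x, 0 < r -> p (r ** x) <= r * p x &
      forall x, p x <= rnorm x].

Lemma rscaleA (r s : R) (x : V) : r ** (s ** x) = (r * s) ** x.
Proof. by rewrite scalerA -of_realM. Qed.

Lemma rscale1 (x : V) : 1 ** x = x.
Proof. by rewrite of_real1 scale1r. Qed.

Lemma rnorm_rscale (r : R) (x : V) : rnorm (r ** x) = `|r| * rnorm x.
Proof. by rewrite rnormZm modulus_of_real. Qed.

Lemma sublinearZ p r x : sublinear p -> 0 < r -> p (r ** x) = r * p x.
Proof.
move=> [_ pZ _] r0; apply/eqP; rewrite eq_le pZ //= -ler_pdivlMl //.
have := pZ r^-1 (r ** x); rewrite rscaleA mulVf ?gt_eqF // rscale1; apply.
by rewrite invr_gt0.
Qed.

Lemma sublinear0 p : sublinear p -> p 0 = 0.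
Proof.
move=> sp; have := @sublinearZ p 2 0 sp (ltr0Sn _ _).
by rewrite scaler0; lra.
Qed.

Lemma sublinear_oppr p x : sublinear p -> - p (- x) <= p x.
Proof.
move=> sp; have [pD _ _] := sp; have := pD x (- x).
by rewrite subrr sublinear0 //; lra.
Qed.

(** Taking [t = 0] shows that it lies below [p]; taking [t = 1] shows that its value at [- x] is at
    most [- p x]. *)
Definition slope_inf (p : V -> R) (x y : V) : R :=
  inf [set p (y + t ** x) - t * p x | t in [set t | 0 <= t]].

Lemma slope_inf_le p x y t : sublinear p -> 0 <= t ->
  slope_inf p x y <= p (y + t ** x) - t * p x.
Proof.
move=> sp t0; apply: ge_inf; last by exists t.
exists (- p (- y)) => _ [s /= s0 <-].
have -> : s * p x = p (s ** x).
  move: s0; rewrite le_eqVlt => /orP[/eqP<-|s0]; last by rewrite sublinearZ.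
  by rewrite mul0r of_real0 scale0r sublinear0.
have [pD _ _] := sp; have := pD (y + s ** x) (- y).
by rewrite addrAC subrr add0r; lra.
Qed.

Lemma slope_inf_ge p x y b :
  (forall t, 0 <= t -> b <= p (y + t ** x) - t * p x) -> b <= slope_inf p x y.
Proof.
move=> h; apply: lb_le_inf; first by exists (p (y + 0 ** x) - 0 * p x), 0 => /=.
by move=> _ [t /= t0 <-]; exact: h.
Qed.

Lemma slope_inf_sublinear p x : sublinear p -> sublinear (slope_inf p x).
Proof.
move=> sp; have [pD pZ pn] := sp; split=> [y z|r y r0|y].
- rewrite -lerBlDr; apply: slope_inf_ge => t t0; rewrite lerBlDr -lerBlDl.
  apply: slope_inf_ge => s s0; rewrite lerBlDl.
  apply: le_trans (slope_inf_le _ _ sp (addr_ge0 t0 s0)) _.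
  rewrite of_realD scalerDl addrACA.
  have := pD (y + t ** x) (z + s ** x); lra.
- rewrite -ler_pdivrMl //; apply: slope_inf_ge => t t0.
  rewrite ler_pdivrMl //.
  apply: le_trans (slope_inf_le _ _ sp (mulr_ge0 (ltW r0) t0)) _.
  by rewrite -rscaleA -scalerDr mulrBr mulrA lerB // pZ.
- apply: le_trans (slope_inf_le _ _ sp (lexx 0)) _.
  by rewrite of_real0 scale0r addr0 mul0r subr0.
Qed.

(* A minimal sublinear functional [p] is linear: [slope_inf p x <= p] is
   sublinear, so it equals [p], which gives [p y <= p (y + x) - p x]. *)
Lemma real_norming_functional (x0 : V) : exists f : V -> R,
  [/\ forall x y, f (x + y) = f x + f y, forall r x, f (r ** x) = r * f x,
      forall x, f x <= rnorm x & f x0 = rnorm x0].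
Proof.
have sn : sublinear (@rnorm R k V).
  split=> // [x y|r x r0]; first exact: ler_rnormD.
  by rewrite rnorm_rscale gtr0_norm.
(* The minimal functional is sought below [q0] rather than below the norm: [q0 (- x0) <= - rnorm x0]
   forces its value at [x0]. *)
pose q0 := slope_inf (@rnorm R k V) x0.
have sq : sublinear q0 by exact: slope_inf_sublinear.
pose T := {p : V -> R | sublinear p /\ forall x, p x <= q0 x}.
(* The order is reversed, since [Zorn] yields maximal elements. *)
pose Rel (p q : T) := `[< forall x, sval q x <= sval p x >].
have [| | |A Atot|p pmin] := @Zorn T Rel.
- by move=> p; apply/asboolP.
- by move=> p q r /asboolP pq /asboolP qr; apply/asboolP => x; exact: le_trans (qr x) (pq x).
- move=> [p pP] [q qP] /asboolP /= pq /asboolP /= qp; apply: eq_exist.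
  by apply/funext => x; apply/eqP; rewrite eq_le pq qp.
- have [[a Aa]|A0] := pselect (A !=set0); last first.
    have hq : sublinear q0 /\ forall x, q0 x <= q0 x by [].
    by exists (exist _ q0 hq) => s As; case: A0; exists s.
  pose g x := inf [set sval s x | s in A].
  have gle s x : A s -> g x <= sval s x.
    move=> As; apply: ge_inf; last by exists s.
    exists (- rnorm x) => _ [t At <-]; have [st _] := svalP t.
    apply: le_trans (sublinear_oppr x st); rewrite lerN2 -rnormN.
    by have [_ _] := st.
  have gge x b : (forall s, A s -> b <= sval s x) -> b <= g x.
    move=> h; apply: lb_le_inf; first by exists (sval a x), a.
    by move=> _ [s As <-]; exact: h.
  have gP : sublinear g /\ forall x, g x <= q0 x.
    split; last by move=> x; apply: le_trans (gle a x Aa) _; have [_ +] := svalP a.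
    split=> [x y|r x r0|x].
    + rewrite -lerBlDr; apply: (gge) => s As; rewrite lerBlDr -lerBlDl.
      apply: (gge) => t At; rewrite lerBlDl.
      have [/asboolP ts|/asboolP st] := Atot _ _ As At.
        apply: le_trans (gle t _ At) _; have [[tD _ _] _] := svalP t.
        by apply: le_trans (tD _ _) _; rewrite lerD2r.
      apply: le_trans (gle s _ As) _; have [[sD _ _] _] := svalP s.
      by apply: le_trans (sD _ _) _; rewrite lerD2l.
    + rewrite -ler_pdivrMl //; apply: (gge) => s As; rewrite ler_pdivrMl //.
      by apply: le_trans (gle s _ As) _; have [[_ + _] _] := svalP s; apply.
    + by apply: le_trans (gle a x Aa) _; have [[]] := svalP a.
  exists (exist _ g gP) => s As; apply/asboolP => x /=; exact: gle.
have [sp pq0] := svalP p.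
have pE x : slope_inf (sval p) x = sval p.
  have hP : sublinear (slope_inf (sval p) x) /\ forall y, slope_inf (sval p) x y <= q0 y.
    split; first exact: slope_inf_sublinear.
    move=> y; apply: le_trans (pq0 y); apply: le_trans (slope_inf_le _ _ sp (lexx 0)) _.
    by rewrite of_real0 scale0r addr0 mul0r subr0.
  suff h : Rel p (exist _ _ hP) by exact: (congr1 (@sval _ _) (pmin _ h)).
  apply/asboolP => y /=.
  apply: le_trans (slope_inf_le _ _ sp (lexx 0)) _.
  by rewrite of_real0 scale0r addr0 mul0r subr0.
have pD x y : sval p (x + y) = sval p x + sval p y.
  apply/eqP; rewrite eq_le; have [-> //= _ _] := sp.
  have := slope_inf_le x y sp ler01; rewrite pE rscale1 mul1r addrC [y + x]addrC; lra.
have pN x : sval p (- x) = - sval p x.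
  by apply/eqP; rewrite -addr_eq0 -pD addNr sublinear0.
exists (sval p); split=> //.
- move=> r x; have [r0|r0|->] := ltgtP r 0.
  + rewrite -{1}(opprK r) of_realN scaleNr pN sublinearZ ?oppr_gt0 // mulNr opprK //.
  + exact: sublinearZ.
  + by rewrite of_real0 scale0r mul0r sublinear0.
- by have [] := sp.
- apply/eqP; rewrite eq_le; have [_ _ -> /=] := sp.
  rewrite -[X in _ <= X]opprK -pN lerNr; apply: le_trans (pq0 _) _.
  apply: le_trans (slope_inf_le _ _ sn ler01) _.
  by rewrite rscale1 addNr rnorm0 sub0r mul1r.
Qed.

End Hahn_Banach.

(** Over the complex field the functional is [f x - i f (i x)], with [f] real linear; multiplying
    [x] by a unimodular scalar that makes its value real and nonnegative reduces the bound to that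
    of [f]. *)
Lemma norming_functional (R : realType) (k : scalar_kind)
    (V : normedModType (scalars R k)) (x0 : V) :
  exists psi : dual_space V, opnorm psi <= 1 /\ rnorm x0 <= modulus (psi x0).
Proof.
case: k V x0 => V x0; have [f [fD fZ fn fx0]] := real_norming_functional x0.
  have flin : linear (f : V -> R^o) by move=> a x y; rewrite fD (fZ a x).
  have [|u [uf u1]] := @blin_of_bound R RealScalars V R^o f 1 flin ler01.
    move=> x; rewrite mul1r /rnorm /= ler_norml fn andbT lerNl.
    have := fZ (-1) x; rewrite /= scaleN1r mulN1r => <-.
    by apply: le_trans (fn _) _; rewrite rnormN.
  by exists u; split=> //; rewrite uf -fx0 /modulus /= ler_norm.
pose i : R[i] := 'i%C.
pose g (x : V) : R[i] := Complex (f x) (- f (i *: x)).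
have gRe x : complex.Re (g x) = f x by [].
have gD x y : g (x + y) = g x + g y.
  by rewrite /g scalerDr !fD opprD.
have gr (r : R) x : g (r%:C%C *: x) = r%:C%C * g x.
  rewrite /g scalerA [i * _]mulrC -scalerA !(fZ r) /=.
  by apply/eqP; rewrite eq_complex /= !mul0r subr0 addr0 mulrN !eqxx.
have gi x : g (i *: x) = i * g x.
  rewrite /g scalerA.
  have -> : i * i = -1 by rewrite -expr2 sqr_i.
  have fN y : f (- y) = - f y.
    by have := fZ (-1) y; rewrite /= rmorphN1 scaleN1r mulN1r.
  rewrite scaleN1r fN opprK.
  by apply/eqP; rewrite eq_complex /= !mul0r !mul1r sub0r opprK add0r !eqxx.
have glin : linear (g : V -> R[i]^o).
  move=> [a b] x y.
  have -> : Complex a b = a%:C%C + i * b%:C%C.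
    by apply/eqP; rewrite eq_complex /=; apply/andP; split; apply/eqP; ring.
  rewrite gD; congr (_ + _).
  by rewrite scalerDl gD gr -scalerA gi gr [RHS]mulrDl mulrA.
have [|u [ug u1]] := @blin_of_bound R ComplexScalars V R[i]^o g 1 glin ler01.
  move=> x; rewrite mul1r.
  have [->|z0] := eqVneq (g x) 0; first by rewrite rnorm0 rnorm_ge0.
  pose z : scalars R ComplexScalars := g x; pose m := modulus z.
  have uz : (of_real ComplexScalars m * z^-1) * z = of_real ComplexScalars m.
    by rewrite mulfVK.
  have gu : g ((of_real ComplexScalars m * z^-1) *: x) = of_real ComplexScalars m.
    have := glin (of_real ComplexScalars m * z^-1) x 0.
    by rewrite !addr0 => ->; rewrite -[LHS]/(_ * _ + _) (_ : g 0 = 0) ?addr0 //; have := gr 0 0; rewrite scaler0 mul0r.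
  rewrite -[X in X <= _]/m.
  have := fn ((of_real ComplexScalars m * z^-1) *: x).
  rewrite (@rnormZm R ComplexScalars) -gRe gu => /le_trans; apply.
  rewrite modulusM modulusV modulus_of_real ger0_norm ?modulus_ge0 //.
  by rewrite mulfV ?modulus_eq0 // mul1r.
exists u; split=> //; rewrite ug -fx0 -gRe -(ler_of_real ComplexScalars) modulusE.
by rewrite (le_trans _ (normc_ge_Re _)) //= lecR ler_norm.
Qed.

(** * The Dvoretzky-Rogers lemma *)

Section euclidean_norm.
Variable R : realType.

Definition sqn n (a : 'cV[R]_n) : R := \sum_i a i 0 ^+ 2.

Definition enorm n (a : 'cV[R]_n) : R := Num.sqrt (sqn a).

Lemma sqn_ge0 n (a : 'cV[R]_n) : 0 <= sqn a.
Proof. by apply: sumr_ge0 => i _; rewrite sqr_ge0. Qed.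

Lemma sqnE n (a : 'cV[R]_n) : sqn a = (a^T *m a) 0 0.
Proof. by rewrite mxE; apply: eq_bigr => i _; rewrite mxE. Qed.

Lemma enorm_ge0 n (a : 'cV[R]_n) : 0 <= enorm a.
Proof. exact: sqrtr_ge0. Qed.

Lemma enormZ n r (a : 'cV[R]_n) : enorm (r *: a) = `|r| * enorm a.
Proof.
rewrite /enorm -sqrtr_sqr -sqrtrM ?sqr_ge0 //; congr Num.sqrt.
by rewrite /sqn mulr_sumr; apply: eq_bigr => i _; rewrite !mxE exprMn.
Qed.

Lemma coef_le_enorm n (a : 'cV[R]_n) i : `|a i 0| <= enorm a.
Proof.
rewrite -sqrtr_sqr ler_wsqrtr // /sqn (bigD1 i) //= lerDl.
by apply: sumr_ge0 => j _; rewrite sqr_ge0.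
Qed.

Lemma enorm_isometry n j (A : 'M[R]_(n, j)) (a : 'cV[R]_j) :
  A^T *m A = 1%:M -> enorm (A *m a) = enorm a.
Proof.
by move=> A1; rewrite /enorm !sqnE trmx_mul mulmxA -(mulmxA a^T) A1 mulmx1.
Qed.

(** Pythagoras: [A A^T] is the orthogonal projection onto the range of [A]. *)
Lemma enorm_orthogonal_proj n j (A : 'M[R]_(n, j)) (a : 'cV[R]_n) :
  A^T *m A = 1%:M -> enorm (a - A *m (A^T *m a)) <= enorm a.
Proof.
move=> A1; rewrite /enorm ler_wsqrtr // !sqnE.
set b := A^T *m a.
have -> : (a - A *m b)^T *m (a - A *m b) = a^T *m a - b^T *m b.
  have ab : a^T *m (A *m b) = b^T *m b by rewrite mulmxA /b trmx_mul trmxK.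
  have ba : (A *m b)^T *m a = b^T *m b by rewrite trmx_mul -mulmxA.
  have bb : (A *m b)^T *m (A *m b) = b^T *m b.
    by rewrite trmx_mul mulmxA -(mulmxA b^T) A1 mulmx1.
  have -> : (a - A *m b)^T = a^T - (A *m b)^T by rewrite raddfB.
  by rewrite mulmxBl !mulmxBr ab ba bb subrr subr0.
by rewrite mxE [X in _ + X]mxE -[X in _ - X]sqnE lerBlDr lerDl sqn_ge0.
Qed.

(** The matrix acts as 1 on the range of [A] and as 2 on its orthogonal complement, of dimension
    [n - j]. Two triangular factorisations of one block matrix give the determinant without a basis
    of the complement. *)
Lemma det_reflection n j (A : 'M[R]_(n, j)) : A^T *m A = 1%:M ->
  \det (2%:M - A *m A^T) = 2 ^+ n / 2 ^+ j.
Proof.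
move=> A1; transitivity (\det (block_mx 1%:M A^T A 2%:M)).
  have -> : block_mx 1%:M A^T A 2%:M =
      block_mx 1%:M 0 A 1%:M *m block_mx 1%:M A^T 0 (2%:M - A *m A^T).
    by rewrite mulmx_block !mul1mx !mul0mx !mulmx1 !addr0 addrC subrK.
  by rewrite det_mulmx det_lblock det_ublock !det1 !mul1r.
have -> : block_mx 1%:M A^T A 2%:M =
    block_mx 1%:M (2^-1 *: A^T) 0 1%:M *m block_mx (2^-1)%:M 0 A 2%:M.
  rewrite mulmx_block !mul1mx !mul0mx !add0r -scalemxAl A1 mul_mx_scalar.
  rewrite scalerA divff // scale1r; congr (block_mx _ _ _ _).
  by apply/matrixP => u w; rewrite !mxE; case: eqP => _; rewrite ?mulr1n ?mulr0n; lra.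
by rewrite det_mulmx det_lblock det_ublock !det1 !mul1r !det_scalar mulrC exprVn.
Qed.

End euclidean_norm.

Section Dvoretzky_Rogers.
Variables (R : realType) (k : scalar_kind).
Local Notation K := (scalars R k).
Variables (F : normedModType K) (n : nat) (y : nat -> F).
Implicit Types (M : 'M[R]_n) (a : 'cV[R]_n).

(** The coefficients are real even over the complex field, so that determinants and orthogonality
    are those of real matrices. *)
Definition real_comb a : F := \sum_i of_real k (a i 0) *: y i.

Lemma real_combD a b : real_comb (a + b) = real_comb a + real_comb b.
Proof.
rewrite /real_comb -big_split; apply: eq_bigr => i _.
by rewrite !mxE of_realD scalerDl.
Qed.

Lemma real_combZ r a : real_comb (r *: a) = of_real k r *: real_comb a.
Proof.
rewrite /real_comb scaler_sumr; apply: eq_bigr => i _.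
by rewrite !mxE of_realM scalerA.
Qed.

(** [M] maps the Euclidean ball to an ellipsoid inside the unit ball of the span of [y], of volume
    proportional to the modulus of its determinant. A determinant within a factor 2 of the largest
    replaces the ellipsoid of maximal volume. *)
Definition contraction M : Prop := forall a, rnorm (real_comb (M *m a)) <= enorm a.

(** Independence bounds the coefficients of a vector by its norm, hence the entries of [M]; the
    Leibniz formula does the rest. *)
Lemma det_contraction_bounded : independent n y ->
  exists C : R, forall M, contraction M -> `|\det M| <= C.
Proof.
move=> /independent_coef_bound[B [B0 yB]].
exists (\sum_(s : 'S_n) B ^+ n) => M cM.
have MB i j : `|M i j| <= B.
  have := yB (fun l => if insub l is Some l' then of_real k (M l' j) else 0) i (ltn_ord i).
  rewrite valK modulus_of_real => /le_trans; apply.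
  have -> : \sum_(l < n) (if insub (val l) is Some l' then of_real k (M l' j) else 0) *: y l
      = real_comb (M *m delta_mx j 0).
    by apply: eq_bigr => l _; rewrite valK -colE mxE.
  rewrite ler_piMr ?(ltW B0) // (le_trans (cM _)) //.
  rewrite /enorm /sqn (bigD1 j) //= mxE !eqxx expr1n big1 ?addr0 ?sqrtr1 // => l lj.
  by rewrite mxE (negbTE lj) expr0n.
rewrite /determinant; apply: le_trans (ler_norm_sum _ _ _) _; apply: ler_sum => s _.
rewrite normrM normr_sign mul1r normr_prod.
have -> : B ^+ n = \prod_(i < n) B by rewrite prodr_const card_ord.
by apply: ler_prod => i _; rewrite normr_ge0 MB.
Qed.

(** Ensures that the supremum of the determinants of contractions is positive. *)
Lemma contraction_scalar : exists2 c : R, 0 < c & contraction c%:M.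
Proof.
pose S := \sum_(i < n) rnorm (y i).
have S0 : 0 <= S by apply: sumr_ge0 => i _; exact: rnorm_ge0.
exists (1 + S)^-1; first by rewrite invr_gt0 ltr_pwDl.
move=> a; rewrite mul_scalar_mx real_combZ rnormZm modulus_of_real ger0_norm.
  rewrite ler_pdivrMl ?ltr_pwDl //; apply: le_trans (rnorm_sum _ _ _) _.
  apply: (@le_trans _ _ (S * enorm a)).
    rewrite mulr_suml; apply: ler_sum => i _.
    by rewrite rnormZm modulus_of_real mulrC ler_wpM2l ?rnorm_ge0 ?coef_le_enorm.
  by rewrite ler_wpM2r ?enorm_ge0 // lerDr.
by rewrite invr_ge0 addr_ge0.
Qed.

(* If [T M] were small on the orthogonal complement of the range of [A], the matrix
   [4/5 M (1 + Q)], with [Q] the projection on that complement, would be a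
   contraction of larger determinant. *)
Lemma large_on_complement M j (A : 'M[R]_(n, j)) : contraction M -> \det M != 0 ->
  (forall M', contraction M' -> `|\det M'| <= 2 * `|\det M|) ->
  A^T *m A = 1%:M -> 2 < (4 / 5) ^+ n * (2 ^+ n / 2 ^+ j) :> R ->
  exists h : 'cV[R]_n, [/\ A^T *m h = 0, enorm h = 1 & 4^-1 <= rnorm (real_comb (M *m h))].
Proof.
move=> cM dM Mmax A1 big; apply: contrapT => nh.
have small h : A^T *m h = 0 -> rnorm (real_comb (M *m h)) <= 4^-1 * enorm h.
  move=> Ah; have [h0|h0] := eqVneq (enorm h) 0.
    by rewrite h0 mulr0 -h0 cM.
  have hpos : 0 < enorm h by rewrite lt_def h0 enorm_ge0.
  rewrite leNgt; apply/negP => hbig; apply: nh; exists ((enorm h)^-1 *: h); split.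
  - by rewrite -scalemxAr Ah scaler0.
  - by rewrite enormZ ger0_norm ?invr_ge0 ?enorm_ge0 // mulVf.
  - rewrite -scalemxAr real_combZ rnormZm modulus_of_real ger0_norm ?invr_ge0 ?enorm_ge0 //.
    by rewrite ler_pdivlMl // mulrC ltW.
(* [4 / 5] is the inverse of [1 + 1 / 4]: a contraction plus a part of norm at most a quarter. *)
pose M' := (4 / 5) *: (M *m (2%:M - A *m A^T)).
have cM' : contraction M'.
  move=> a; rewrite /M' -scalemxAl real_combZ rnormZm modulus_of_real ger0_norm //.
  have Aa : A^T *m (a - A *m (A^T *m a)) = 0.
    by rewrite mulmxBr !mulmxA A1 mul1mx subrr.
  have -> : M *m (2%:M - A *m A^T) *m a = M *m a + M *m (a - A *m (A^T *m a)).
    rewrite -mulmxA -mulmxDr; congr (M *m _).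
    by rewrite mulmxBl mul_scalar_mx scaler_nat mulr2n -mulmxA addrA.
  rewrite real_combD.
  have h1 := ler_rnormD (real_comb (M *m a)) (real_comb (M *m (a - A *m (A^T *m a)))).
  have h2 := cM a; have h3 := small _ Aa; have h4 := enorm_orthogonal_proj a A1.
  lra.
have := Mmax _ cM'; rewrite /M' detZ det_mulmx det_reflection // !normrM.
rewrite (ger0_norm (_ : 0 <= (4 / 5) ^+ n)) ?exprn_ge0 //.
rewrite (ger0_norm (_ : 0 <= 2 ^+ n)) ?exprn_ge0 //.
rewrite (ger0_norm (_ : 0 <= (2 ^+ j)^-1)) ?invr_ge0 ?exprn_ge0 //.
rewrite mulrCA [X in _ <= X]mulrC ler_pM2l ?normr_gt0 //.
by rewrite leNgt big.
Qed.

(** Columns are added one at a time in the orthogonal complement of the earlier ones; the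
    determinant condition for [m] columns implies it for fewer. *)
Lemma orthonormal_large M m : contraction M -> \det M != 0 ->
  (forall M', contraction M' -> `|\det M'| <= 2 * `|\det M|) ->
  2 < (4 / 5) ^+ n * (2 ^+ n / 2 ^+ m) :> R ->
  exists A : 'M[R]_(n, m), A^T *m A = 1%:M /\
    forall l, 4^-1 <= rnorm (real_comb (col l (M *m A))).
Proof.
move=> cM dM Mmax; elim: m => [_|m ih big].
  by exists 0; split=> [|[]//]; apply/matrixP => -[].
have [|A [A1 Al]] := ih.
  apply: lt_le_trans big _; rewrite ler_wpM2l ?exprn_ge0 //.
  rewrite ler_wpM2l ?exprn_ge0 // lef_pV2 ?posrE ?exprn_gt0 //.
  by rewrite ler_weXn2l // ler1n.
have [|h [Ah h1 hl]] := large_on_complement cM dM Mmax A1.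
  apply: lt_le_trans big _; rewrite ler_wpM2l ?exprn_ge0 //.
  rewrite ler_wpM2l ?exprn_ge0 // lef_pV2 ?posrE ?exprn_gt0 //.
  by rewrite ler_weXn2l // ler1n.
rewrite -addn1; exists (row_mx A h); split.
  rewrite tr_row_mx mul_col_row A1 Ah scalar_mx_block; congr (block_mx _ _ _ _).
    by apply: trmx_inj; rewrite trmx_mul trmxK Ah trmx0.
  apply/matrixP => i j; rewrite !ord1 -sqnE mxE eqxx.
  by rewrite -(sqr_sqrtr (sqn_ge0 h)) -/(enorm h) h1 expr1n.
move=> l; rewrite mul_mx_row; case: (split_ordP l) => i ->.
  by rewrite colKl.
by rewrite colKr ord1 (_ : col 0 _ = M *m h) //; apply/matrixP => u v; rewrite mxE ord1.
Qed.

End Dvoretzky_Rogers.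

Lemma scalar_decomposition (R : realType) (k : scalar_kind) :
  exists iota : scalars R k, modulus iota <= 1 /\
  forall c : scalars R k, exists a b : R,
    [/\ c = of_real k a + iota * of_real k b, `|a| <= modulus c & `|b| <= modulus c].
Proof.
case: k.
  exists 0; split; first by rewrite modulus0.
  by move=> c; exists c, 0; rewrite mul0r addr0 normr0 modulus_ge0.
exists ('i%C : R[i]); split; first by rewrite /modulus normc_def /= expr0n expr1n add0r sqrtr1.
move=> [a b]; exists a, b; rewrite /modulus normc_def /=; split.
- by apply/eqP; rewrite eq_complex /=; apply/andP; split; apply/eqP; ring.
- by rewrite -sqrtr_sqr ler_wsqrtr // lerDl sqr_ge0.
- by rewrite -sqrtr_sqr ler_wsqrtr // lerDr sqr_ge0.
Qed.

(** The vectors are images of an orthonormal system under a contraction, whence the upper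
    2-estimate. Its factor 2 comes from treating real and imaginary coefficients separately. *)
Theorem Dvoretzky_Rogers (R : realType) (k : scalar_kind)
    (F : normedModType (scalars R k)) (m : nat) : infinite_dimensional [set: F] ->
  exists y : nat -> F, (forall i, (i < m)%N -> 4^-1 <= rnorm (y i)) /\
    forall c : nat -> scalars R k, rnorm (\sum_(i < m) c i *: y i) <=
      2 * Num.sqrt (\sum_(i < m) modulus (c i) ^+ 2).
Proof.
(* With this [n] the quantity that must exceed 2 is [8 * (32 / 25) ^ (m + 3)]. *)
move=> infF; pose n := (m + 3).*2.
have [v [ind _]] := @infinite_dimensional_independent _ F setT n (conj I (fun _ _ _ _ _ => I)) infF.
have [C detC] := det_contraction_bounded ind.
have [c c0 cc] := contraction_scalar n v.
pose D := [set `|\det M| | M in [set M : 'M[R]_n | contraction v M]].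
have hD : has_sup D.
  split; first by exists `|\det (c%:M : 'M[R]_n)|, c%:M.
  by exists C => _ [M /= cM <-]; exact: detC.
have supD : 0 < sup D.
  have : `|\det (c%:M : 'M[R]_n)| <= sup D by apply: sup_upper_bound => //; exists c%:M.
  apply: lt_le_trans.
  by rewrite normr_gt0 det_scalar expf_neq0 // gt_eqF.
have [|_ [M /= cM <-] Ms] := @sup_adherent _ D (sup D / 2) _ hD; first by rewrite divr_gt0.
have Mbig : sup D / 2 < `|\det M| by lra.
have [|||A [A1 Al]] := @orthonormal_large R k F n v M m cM.
- by rewrite -normr_gt0; apply: lt_trans Mbig; rewrite divr_gt0.
- move=> M' cM'; have : `|\det M'| <= sup D by apply: sup_upper_bound => //; exists M'.
  lra.
- have -> : 2 ^+ n / 2 ^+ m = 2 ^+ 3 * 2 ^+ (m + 3) :> R.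
    rewrite /n -addnn exprD mulrAC; congr (_ * _).
    by rewrite addnC exprD mulfK // expf_neq0.
  have -> : (4 / 5) ^+ n = (16 / 25) ^+ (m + 3) :> R.
    by rewrite /n -mul2n exprM; congr (_ ^+ _); rewrite expr2; field.
  rewrite mulrCA -exprMn.
  have : 1 <= (16 / 25 * 2) ^+ (m + 3) :> R by apply: exprn_ege1; lra.
  by rewrite -natrX; lra.
pose y i := if insub i is Some l then real_comb v (col l (M *m A)) else 0.
exists y; split=> [i im|d].
  by rewrite /y (insubT (fun i => i < m)%N im).
have [iota [i1 dec]] := scalar_decomposition R k.
have [a /choice[b ab]] := choice (fun c => dec c).
have realE (r : nat -> R) : rnorm (\sum_(i < m) of_real k (r i) *: y i) <=
    Num.sqrt (\sum_(i < m) r i ^+ 2).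
  have -> : \sum_(i < m) of_real k (r i) *: y i =
      real_comb v (M *m (A *m \col_(i < m) r i)).
    rewrite mulmxA /y; under eq_bigr => i _ do rewrite valK.
    rewrite /real_comb; under eq_bigr => i _ do rewrite scaler_sumr.
    rewrite exchange_big /=; apply: eq_bigr => j _.
    rewrite mxE (big_morph _ (@of_realD R k) (@of_real0 R k)) scaler_suml.
    by apply: eq_bigr => i _; rewrite !mxE mulrC of_realM scalerA.
  apply: le_trans (cM _) _; rewrite enorm_isometry // /enorm /sqn.
  by under eq_bigr => i _ do rewrite mxE.
have -> : \sum_(i < m) d i *: y i = \sum_(i < m) of_real k (a (d i)) *: y i +
    iota *: \sum_(i < m) of_real k (b (d i)) *: y i.
  rewrite scaler_sumr -big_split; apply: eq_bigr => i _ /=.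
  have [e _ _] := ab (d i).
  by rewrite [LHS](congr1 (fun z => z *: y i) e) scalerDl scalerA.
apply: le_trans (ler_rnormD _ _) _; rewrite rnormZm mulr_natl mulr2n lerD //.
  apply: le_trans (realE (a \o d)) _; apply: ler_wsqrtr; apply: ler_sum => i _.
  by rewrite -real_normK ?num_real // ler_pXn2r ?nnegrE ?modulus_ge0 //; have [] := ab (d i).
apply: le_trans (ler_piMl (rnorm_ge0 _) i1) _.
apply: le_trans (realE (b \o d)) _; apply: ler_wsqrtr; apply: ler_sum => i _.
by rewrite -real_normK ?num_real // ler_pXn2r ?nnegrE ?modulus_ge0 //; have [] := ab (d i).
Qed.

(** * James' criterion *)

(** [sn m a] is meant to be the norm of the [m]-th partial sum of the sequence [a]. *)
Structure seq_norms (R : realType) (k : scalar_kind) := SeqNorms {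
  sn :> nat -> (nat -> scalars R k) -> R;
  sn_coef : R;
  snD : forall m a b, sn m (fun i => a i + b i) <= sn m a + sn m b;
  snZ : forall m c a, sn m (fun i => c * a i) = modulus c * sn m a;
  sn_mono : forall m n a, (m <= n)%N -> sn m a <= sn n a;
  sn_coef_ge0 : 0 <= sn_coef;
  sn_coord : forall m i a, (i < m)%N -> modulus (a i) <= sn_coef * sn m a;
  sn_le_sum : forall m a, sn m a <= \sum_(i < m) modulus (a i)
}.

Section sequence_space.
Variables (R : realType) (k : scalar_kind) (P : seq_norms R k).
Local Notation K := (scalars R k).

Lemma sn0 m : P m (fun=> 0) = 0.
Proof.
by have := snZ P m 0 (fun=> 0); rewrite modulus0 mul0r mul0r.
Qed.

Lemma sn_ge0 m a : 0 <= P m a.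
Proof.
have h1 : P m (fun i => a i + -1 * a i) = 0.
  by rewrite -[RHS](sn0 m); congr (P m); apply/funext => i; rewrite mulN1r subrr.
have := snD P m a (fun i => -1 * a i); rewrite h1 snZ modulusN modulus1 mul1r; lra.
Qed.

Definition bounded_seqs : {pred nat -> K^o} :=
  mem [set a : nat -> K^o | exists C, forall m, P m a <= C].

Structure bseq := BSeq { bseq_fun :> nat -> K^o; _ : bseq_fun \in bounded_seqs }.

HB.instance Definition _ := [isSub for bseq_fun].
HB.instance Definition _ := [Choice of bseq by <:].

Lemma bseqP (a : bseq) : exists C, forall m, P m a <= C.
Proof. by have := valP a; rewrite inE. Qed.

Lemma bounded_seqs_submod_closed : submod_closed bounded_seqs.
Proof.
split=> [|c a b]; rewrite !inE /=.
  by exists 0 => m; rewrite (_ : (0 : nat -> K^o) = fun=> 0) // sn0.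
move=> [A aA] [B bB]; exists (modulus c * A + B) => m.
apply: le_trans (snD P m (fun i => c * a i) b) _.
by rewrite lerD // snZ ler_wpM2l ?modulus_ge0.
Qed.

HB.instance Definition _ :=
  GRing.isSubmodClosed.Build K (nat -> K^o) bounded_seqs bounded_seqs_submod_closed.
HB.instance Definition _ := [SubChoice_isSubLmodule of bseq by <:].

Lemma bseqB (a b : bseq) i : (a - b) i = a i - b i. Proof. by []. Qed.

Lemma bseq_eq (a b : bseq) : a =1 b -> a = b.
Proof. by move=> ab; apply/val_inj/funext. Qed.

Definition bseq_norm (a : bseq) : R := sup (range (fun m => P m a)).

Lemma bseq_has_sup (a : bseq) : has_sup (range (fun m => P m a)).
Proof.
split; first by exists (P 0%N a), 0%N.
by have [C aC] := bseqP a; exists C => _ [m _ <-].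
Qed.

Lemma sn_le_norm m (a : bseq) : P m a <= bseq_norm a.
Proof. by apply: sup_upper_bound (bseq_has_sup a) _ _; exists m. Qed.

Lemma bseq_norm_le (a : bseq) C : (forall m, P m a <= C) -> bseq_norm a <= C.
Proof.
move=> h; apply: ge_sup; first by have [] := bseq_has_sup a.
by move=> _ [m _ <-].
Qed.

Lemma bseq_normD a b : bseq_norm (a + b) <= bseq_norm a + bseq_norm b.
Proof.
apply: bseq_norm_le => m; apply: le_trans (snD P m a b) _.
by rewrite lerD // sn_le_norm.
Qed.

Lemma bseq_norm_ge0 a : 0 <= bseq_norm a.
Proof. exact: le_trans (sn_ge0 0 a) (sn_le_norm 0 a). Qed.

Lemma bseq_normZ c a : bseq_norm (c *: a) = modulus c * bseq_norm a.
Proof.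
have le c' a' : bseq_norm (c' *: a') <= modulus c' * bseq_norm a'.
  apply: bseq_norm_le => m.
  by rewrite -[X in X <= _]/(P m (fun i => c' * a' i)) snZ ler_wpM2l ?modulus_ge0 ?sn_le_norm.
apply/eqP; rewrite eq_le le /=; have [->|c0] := eqVneq c 0.
  by rewrite modulus0 mul0r bseq_norm_ge0.
rewrite -ler_pdivlMl ?modulus_gt0 //.
by have := le c^-1 (c *: a); rewrite scalerA mulVf // scale1r modulusV.
Qed.

Lemma bseq_coord (a : bseq) i : modulus (a i) <= sn_coef P * bseq_norm a.
Proof.
apply: le_trans (sn_coord P a (ltnSn i)) _.
by rewrite ler_wpM2l ?sn_coef_ge0 ?sn_le_norm.
Qed.

Lemma bseq_norm_eq0 a : bseq_norm a = 0 -> a = 0.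
Proof.
move=> a0; apply: bseq_eq => i; apply/eqP; rewrite -modulus_eq0 eq_le modulus_ge0.
by rewrite andbT; have := bseq_coord a i; rewrite a0 mulr0.
Qed.

Let norm (a : bseq) : K := of_real k (bseq_norm a).

Let normD a b : norm (a + b) <= norm a + norm b.
Proof. by rewrite /norm -of_realD ler_of_real bseq_normD. Qed.

Let normZ (c : K) a : norm (c *: a) = `|c| * norm a.
Proof. by rewrite /norm bseq_normZ of_realM modulusE. Qed.

Let norm_eq0 a : norm a = 0 -> a = 0.
Proof.
by move=> a0; apply: bseq_norm_eq0; apply: (@of_real_inj R k); rewrite of_real0.
Qed.

HB.instance Definition _ := @Lmodule_isNormed.Build K bseq norm normD normZ norm_eq0.

Lemma rnorm_bseq (a : bseq) : rnorm a = bseq_norm a.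
Proof. exact: of_realK. Qed.

(** The limit is taken coordinatewise along an ultrafilter refining [F]. For fixed [m] the [m]-th
    norm is controlled by finitely many coordinates, so the Cauchy estimate survives the limit; the
    supremum over [m] is taken afterwards. *)
Lemma bseq_complete (F : set_system bseq) : ProperFilter F -> cauchy F -> cvg F.
Proof.
move=> PF /cauchyP cF.
have {}cF (e : R) : 0 < e -> exists x, F [set y | rnorm (x - y) < e].
  move=> e0; have [|x Fx] := cF (of_real k e).
    by rewrite lt_def of_real_eq0 gt_eqF // -(of_real0 R k) ler_of_real ltW.
  exists x; apply: filterS Fx => y; rewrite -ball_normE /=.
  by rewrite -rnormE !lt_def ler_of_real (inj_eq (@of_real_inj R k)).
have [G [UG FG]] := ultraFilterLemma PF.
have [x1 Fx1] := cF 1 ltr01.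
have lim_ex i : exists l : K, modulus ((y : bseq) i - l) @[y --> G] --> (0 : R).
  apply: (@ultra_bounded_modulus R k _ G UG (fun y : bseq => y i)
    (sn_coef P * (1 + rnorm x1))).
  apply: filterS (FG _ Fx1) => y /= x1y.
  apply: le_trans (bseq_coord y i) _; rewrite ler_wpM2l ?sn_coef_ge0 // -rnorm_bseq.
  have := ler_rnormD (y - x1) x1; rewrite subrK rnormB => /le_trans; apply.
  by rewrite lerD2r ltW.
have [l yl] := choice lim_ex.
have close e x : 0 < e -> F [set y | rnorm (x - y) < e] ->
    forall m, P m (fun i => x i - l i) <= e.
  move=> e0 Fx m.
  have cv : e + \sum_(i < m) modulus ((y : bseq) i - l i) @[y --> G] --> e + 0.
    apply: cvgD; first exact: cvg_cst.
    exact: (@cvg_sum0 _ _ G _ m (fun i (y : bseq) => modulus (y i - l i))).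
  rewrite addr0 in cv; apply: (cvgr_to_ge cv).
  apply: filterS (FG _ Fx) => y /= xy.
  have -> : (fun i => x i - l i) = (fun i => (x - y : bseq) i + (y i - l i)).
    by apply/funext => i; rewrite bseqB addrA subrK.
  apply: le_trans (snD P m _ _) _; rewrite lerD ?sn_le_sum //.
  by apply: le_trans (sn_le_norm m _) _; rewrite -rnorm_bseq ltW.
have lP : (l : nat -> K^o) \in bounded_seqs.
  rewrite inE /=; exists (rnorm x1 + 1) => m.
  have -> : (l : nat -> K) = (fun i => x1 i + -1 * (x1 i - l i)).
    by apply/funext => i; rewrite mulN1r opprB addrC subrK.
  apply: le_trans (snD P m _ _) _.
  rewrite (snZ P m (-1) (fun i => x1 i - l i)) modulusN modulus1 mul1r.
  by rewrite lerD // ?(close _ _ ltr01 Fx1) // rnorm_bseq sn_le_norm.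
apply/cvg_ex; exists (BSeq lP); apply/fcvgrPdist_lt => e e0.
have [r r0 er] : exists2 r : R, 0 < r & of_real k r <= e.
  exists (modulus e); first by rewrite modulus_gt0 gt_eqF.
  by rewrite modulusE ger0_norm // ltW.
have r2 : 0 < r / 2 by rewrite divr_gt0.
have [x Fx] := cF _ r2.
apply: filterS (Fx) => y /= xy; apply: lt_le_trans er.
rewrite -rnormE lt_def ler_of_real (inj_eq (@of_real_inj R k)) -lt_def.
have lx : rnorm (x - BSeq lP) <= r / 2.
  by rewrite rnorm_bseq; apply: bseq_norm_le => m; exact: close.
have tri : rnorm (BSeq lP - y) <= rnorm (BSeq lP - x) + rnorm (x - y).
  by have := ler_rnormD (BSeq lP - x) (x - y); rewrite addrA subrK.
by apply: le_lt_trans tri _; rewrite rnormB (splitr r) ler_ltD.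
Qed.

HB.instance Definition _ := Uniform_isComplete.Build bseq bseq_complete.

End sequence_space.

Section scalar_ultralimits.
Variables (R : realType) (k : scalar_kind).
Local Notation K := (scalars R k).
Variables (T : Type) (U : set_system T).
Context {UF : ProperFilter U}.

Definition klim (s : T -> K) (l : K) : Prop :=
  modulus (s t - l) @[t --> U] --> (0 : R).

Lemma cvg0_le (f g : T -> R) : (forall t, 0 <= f t <= g t) ->
  g t @[t --> U] --> (0 : R) -> f t @[t --> U] --> (0 : R).
Proof.
move=> fg; apply: (@squeeze_cvgr _ _ _ _ (fun=> 0)); first exact: nearW.
exact: cvg_cst.
Qed.

Lemma cvgMcst (c : R) (f : T -> R) (l : R) : f t @[t --> U] --> l ->
  c * f t @[t --> U] --> c * l.
Proof. by move=> fl; apply: cvgM fl; exact: cvg_cst. Qed.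

Lemma cvg_ler (f g : T -> R) (l l' : R) : f t @[t --> U] --> l ->
  g t @[t --> U] --> l' -> (\forall t \near U, f t <= g t) -> l <= l'.
Proof.
move=> fl gl fg; rewrite -subr_ge0; apply: (cvgr_to_ge (cvgB gl fl)).
by apply: filterS fg => t; rewrite subr_ge0.
Qed.

Lemma klim_unique s l l' : klim s l -> klim s l' -> l = l'.
Proof.
move=> sl sl'; apply/eqP; rewrite -subr_eq0 -modulus_eq0 eq_le modulus_ge0 andbT.
apply: (cvgr_to_ge (cvg0D sl' sl)); apply: nearW => t.
have := modulusD (s t - l') (- (s t - l)); rewrite modulusN.
by rewrite opprB addrC addrA subrK.
Qed.

Lemma klimD s s' l l' : klim s l -> klim s' l' -> klim (fun t => s t + s' t) (l + l').
Proof.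
move=> sl sl'; apply: cvg0_le (cvg0D sl sl') => t.
by rewrite modulus_ge0 opprD addrACA modulusD.
Qed.

Lemma klimZ c s l : klim s l -> klim (fun t => c * s t) (c * l).
Proof.
move=> sl; apply: cvg0_le (cvg0Mr (modulus c) sl) => t.
by rewrite modulus_ge0 -mulrBr modulusM mulrC lexx.
Qed.

Lemma klim_modulus s l : klim s l -> modulus (s t) @[t --> U] --> modulus l.
Proof.
move/cvgrPdist_le => sl; apply/cvgrPdist_le => e /sl; apply: filterS => t.
rewrite sub0r normrN ger0_norm ?modulus_ge0 // => /(le_trans _); apply.
by rewrite distrC modulus_dist.
Qed.

Lemma klim_near_cst s l : (\forall t \near U, s t = l) -> klim s l.
Proof.
move=> sl; apply: cvg_near_cst; apply: filterS sl => t ->.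
by rewrite subrr modulus0.
Qed.

Lemma klim_sum n (s : nat -> T -> K) (l : nat -> K) :
  (forall i, (i < n)%N -> klim (s i) (l i)) ->
  klim (fun t => \sum_(i < n) s i t) (\sum_(i < n) l i).
Proof.
elim: n => [_|n ih h].
  by rewrite big_ord0; apply: klim_near_cst; apply: nearW => t; rewrite big_ord0.
rewrite big_ord_recr /= [X in klim X _](_ : _ = fun t => \sum_(i < n) s i t + s n t).
  by apply: klimD; [apply: ih => i ni; apply: h; exact: ltnW|exact: h].
by apply/funext => t; rewrite big_ord_recr.
Qed.

End scalar_ultralimits.

(* Otherwise, normalised points where the estimate fails would have an ultralimit
   in [G], contradicting convergence at that limit. *)
Lemma uniform_seminorm_approx (R : realType) (k : scalar_kind)
    (X : normedModType (scalars R k)) (T : Type) (U : set_system T)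
    (q : T -> X -> R) (q0 : X -> R) (C : R) (G : set X) (eps : R) :
  UltraFilter U -> linear_subspace G -> finite_dimensional G -> 0 < eps -> 0 <= C ->
  (forall t x y, `|q t x - q t y| <= C * rnorm (x - y)) ->
  (forall x y, `|q0 x - q0 y| <= C * rnorm (x - y)) ->
  (forall t r x, 0 <= r -> q t (of_real k r *: x) = r * q t x) ->
  (forall r x, 0 <= r -> q0 (of_real k r *: x) = r * q0 x) ->
  (forall x, q t x @[t --> U] --> q0 x) ->
  exists t, forall x, G x -> `|q t x - q0 x| <= eps * rnorm x.
Proof.
move=> UF linG fdG eps0 C0 qC q0C qZ q0Z qcv.
have [n [g [indg _ spang]]] := finite_dimensional_basis linG fdG.
have [B [B0 gB]] := independent_coef_bound indg.
apply: contrapT => /forallNP nt.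
have bad t : exists c : nat -> scalars R k, (forall i, (i < n)%N -> modulus (c i) <= B) /\
    eps <= `|q t (\sum_(i < n) c i *: g i) - q0 (\sum_(i < n) c i *: g i)|.
  have /existsNP[x /not_implyP[Gx /negP]] := nt t; rewrite -ltNge => xbig.
  have [c xE] := spang x Gx.
  have x0 : 0 < rnorm x.
    rewrite lt_def rnorm_ge0 andbT; apply/eqP => /rnorm_eq0 x0.
    have := qZ t 0 0 (lexx 0); have := q0Z 0 0 (lexx 0).
    rewrite scaler0 !mul0r => q00 qt0.
    by move: xbig; rewrite x0 q00 qt0 subrr normr0 rnorm0 mulr0 ltxx.
  have ix0 : 0 <= (rnorm x)^-1 by rewrite invr_ge0 ltW.
  exists (fun i => of_real k (rnorm x)^-1 * c i); split=> [i ni|].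
    rewrite modulusM modulus_of_real ger0_norm // mulrC ler_pdivrMr // xE.
    exact: gB.
  under eq_bigr => i _ do rewrite -scalerA.
  rewrite -scaler_sumr -xE qZ // q0Z // -mulrBr normrM ger0_norm // mulrC.
  by rewrite ler_pdivlMr // ltW.
have [c cP] := choice bad.
have lim_ex i : exists l, (i < n)%N -> klim U (c^~ i) l.
  have [ni|ni] := ltnP i n; last by exists 0.
  have [|l cl] := @ultra_bounded_modulus R k T U UF (c^~ i) B; last by exists l.
  by apply: nearW => t; have [+ _] := cP t; apply.
have [l cl] := choice lim_ex.
pose x := \sum_(i < n) l i *: g i.
have cv : `|q t x - q0 x| + 2 * C * \sum_(i < n) modulus (c t i - l i) * rnorm (g i)
    @[t --> U] --> (0 : R).
  apply: cvg0D; first by apply/norm_cvg0P/subr_cvg0.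
  rewrite [X in X @ U --> _](_ : _ = fun t => (\sum_(i < n) modulus (c t i - l i) * rnorm (g i)) * (2 * C)).
    apply: cvg0Mr.
    apply: (@cvg_sum0 _ _ U _ n (fun i t => modulus (c t i - l i) * rnorm (g i))) => i ni.
    apply: cvg0Mr; exact: cl.
  by apply/funext => t; rewrite mulrC.
have : eps <= 0.
  apply: (cvgr_to_ge cv); apply: nearW => t; have [_ ct] := cP t.
  apply: le_trans ct _; set y := \sum_(i < n) _ *: _.
  have xy : rnorm (x - y) <= \sum_(i < n) modulus (c t i - l i) * rnorm (g i).
    rewrite rnormB /x /y -sumrB; apply: le_trans (rnorm_sum _ _ _) _.
    by apply: ler_sum => i _; rewrite -scalerBl rnormZm.
  have h1 := qC t x y; have h2 := q0C x y.
  have h3 : C * rnorm (x - y) <= C * \sum_(i < n) modulus (c t i - l i) * rnorm (g i).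
    by rewrite ler_wpM2l.
  (* The defect at the moving point [y] is the defect at the fixed point [x] up to two Lipschitz
     errors. *)
  have -> : q t y - q0 y = (q t x - q0 x) - (q t x - q t y) + (q0 x - q0 y) by ring.
  apply: le_trans (ler_normD _ _) _; rewrite -mulrA mulr_natl mulr2n addrA lerD //.
    by apply: le_trans (ler_normB _ _) _; rewrite lerD // (le_trans h1).
  exact: le_trans h3.
by rewrite leNgt eps0.
Qed.

Lemma modulus_blin_le (R : realType) (k : scalar_kind)
    (E : normedModType (scalars R k)) (phi : dual_space E) x :
  opnorm phi <= 1 -> modulus (phi x) <= rnorm x.
Proof.
move=> p1; apply: le_trans (rnorm_blin phi x) _.
by rewrite ler_piMl ?rnorm_ge0.
Qed.

Section limit_space.
Variables (R : realType) (k : scalar_kind) (E : normedModType (scalars R k)).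
Local Notation K := (scalars R k).
Variables (U : set_system nat) (eps : R) (w : nat -> nat -> E) (f : nat -> dual_space E).
Hypothesis UF : UltraFilter U.
Hypothesis Ufree : forall n, U [set m | (n <= m)%N].
Hypothesis eps0 : 0 < eps.
Hypothesis w1 : forall n i, rnorm (w n i) <= 1.
Hypothesis w_basic : forall n (a : nat -> K) m m', (m <= m')%N -> (m' <= n)%N ->
  (1 - n.+1%:R^-1) * rnorm (\sum_(i < m) a i *: w n i) <= rnorm (\sum_(i < m') a i *: w n i).
Hypothesis f1 : forall n, opnorm (f n) <= 1.
Hypothesis fw : forall n i, (i < n)%N -> eps <= modulus (f n (w n i)).

Let S n m (a : nat -> K) : E := \sum_(i < m) a i *: w n i.

Let SD n m a b : S n m (fun i => a i + b i) = S n m a + S n m b.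
Proof. by rewrite /S -big_split; apply: eq_bigr => i _; rewrite scalerDl. Qed.

Let SZ n m c a : S n m (fun i => c * a i) = c *: S n m a.
Proof. by rewrite /S scaler_sumr; apply: eq_bigr => i _; rewrite scalerA. Qed.

Let S_le n m a : rnorm (S n m a) <= \sum_(i < m) modulus (a i).
Proof.
apply: le_trans (rnorm_sum _ _ _) _; apply: ler_sum => i _.
by rewrite rnormZm ler_piMr ?modulus_ge0.
Qed.

Let p m (a : nat -> K) : R := lim (rnorm (S n m a) @[n --> U]).

Let pP m a : rnorm (S n m a) @[n --> U] --> p m a.
Proof.
have [|l Sl] := @ultra_bounded_cvg R nat U UF (fun n => rnorm (S n m a))
  (\sum_(i < m) modulus (a i)).
  by apply: nearW => n; rewrite ger0_norm ?rnorm_ge0.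
by rewrite /p (cvg_lim _ Sl).
Qed.

Let pD m a b : p m (fun i => a i + b i) <= p m a + p m b.
Proof.
apply: (cvg_ler (@pP m _) (cvgD (@pP m a) (@pP m b))); apply: nearW => n.
by rewrite /= SD ler_rnormD.
Qed.

Let pZ m c a : p m (fun i => c * a i) = modulus c * p m a.
Proof.
have h : modulus c * rnorm (S n m a) @[n --> U] --> modulus c * p m a.
  exact: cvgMcst (@pP m a).
apply/eqP; rewrite eq_le; apply/andP; split.
  by apply: (cvg_ler (@pP m _) h); apply: nearW => n /=; rewrite SZ rnormZm.
by apply: (cvg_ler h (@pP m _)); apply: nearW => n /=; rewrite SZ rnormZm.
Qed.

(** The constants [1 - 1 / (n + 1)] tend to 1: an almost monotone basis becomes monotone in the
    limit. *)
Let p_mono m m' a : (m <= m')%N -> p m a <= p m' a.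
Proof.
move=> mm'.
have h : (1 - n.+1%:R^-1) * rnorm (S n m a) @[n --> U] --> (1 - 0) * p m a.
  apply: cvgM (@pP m a); apply: cvgB; first exact: cvg_cst.
  have := @cvg_harmonic R; apply: cvg_trans; apply: cvg_app.
  by move=> A [N _ NA]; apply: filterS (Ufree N) => n; apply: NA.
rewrite subr0 mul1r in h; apply: (cvg_ler h (@pP m' a)).
by apply: filterS (Ufree m') => n; apply: w_basic.
Qed.

Let eps_le_w n i : (i < n)%N -> eps <= rnorm (w n i).
Proof. by move=> ni; apply: le_trans (fw ni) _; exact: modulus_blin_le. Qed.

(** [a i *: w n i] is the difference of two consecutive partial sums, and [f n] keeps the norm of
    [w n i] above [eps]. *)
Let p_coord m i a : (i < m)%N -> modulus (a i) <= 2 / eps * p m a.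
Proof.
move=> im; rewrite mulrAC ler_pdivlMr //.
have h : rnorm (S n i.+1 a) + rnorm (S n i a) @[n --> U] --> p i.+1 a + p i a.
  by apply: cvgD.
apply: (@le_trans _ _ (p i.+1 a + p i a)); last first.
  by rewrite mulr_natl mulr2n lerD ?p_mono // ltnW.
apply: (cvgr_to_ge h); apply: filterS (Ufree i.+1) => n /= ni.
apply: (@le_trans _ _ (rnorm (a i *: w n i))).
  by rewrite rnormZm ler_wpM2l ?modulus_ge0 ?eps_le_w.
rewrite (_ : a i *: w n i = S n i.+1 a - S n i a) ?ler_rnormB //.
by rewrite /S big_ord_recr /= [RHS]addrC addKr.
Qed.

Let p_le m a : p m a <= \sum_(i < m) modulus (a i).
Proof. by apply: (cvgr_to_le (@pP m a)); apply: nearW => n; exact: S_le. Qed.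

Let coef_ge0 : 0 <= 2 / eps.
Proof. by rewrite divr_ge0 // ltW. Qed.

Definition limit_seq_norms : seq_norms R k :=
  SeqNorms pD pZ p_mono coef_ge0 p_coord p_le.

Let X : completeNormedModType K := bseq limit_seq_norms.

Let p_norm m (a : X) : p m a <= rnorm a.
Proof. by rewrite rnorm_bseq; exact: (@sn_le_norm R k limit_seq_norms m a). Qed.

Let coord_norm (a : X) i : modulus (a i) <= 2 / eps * rnorm a.
Proof. by rewrite rnorm_bseq; exact: (@bseq_coord R k limit_seq_norms a i). Qed.

(** Two approximations on [G], each costing [d / 2]: the norm of [X] is replaced by [p m] for some
    [m], and [p m] by the norm of the sum [S n m] in [E] for some [n]. The map is [S n m]. *)
Lemma limit_space_representable : finitely_representable X E.
Proof.
move=> G d linG fdG d0; have d2 : 0 < d / 2 by rewrite divr_gt0.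
have C1 : (0 : R) <= 1 by [].
have [|||||m mP] := @uniform_seminorm_approx R k X nat U (fun m (x : X) => p m x)
    (@rnorm R k X) 1 G (d / 2) UF linG fdG d2 C1.
- move=> m x y; rewrite mul1r.
  have aux (u v : X) : p m u - p m v <= rnorm (u - v).
    rewrite lerBlDr; apply: le_trans (lerD (p_norm m (u - v)) (lexx (p m v))).
    apply: le_trans (pD _ _ _); rewrite le_eqVlt; apply/orP; left; apply/eqP.
    by congr (p m); apply/funext => i; rewrite bseqB subrK.
  by rewrite ler_norml aux andbT lerNl opprB rnormB aux.
- by move=> x y; rewrite mul1r rnorm_dist.
- move=> m r x r0; rewrite -[RHS](_ : modulus (of_real k r) * p m x = _).
    by rewrite -pZ.
  by rewrite modulus_of_real ger0_norm.
- by move=> r x r0; rewrite rnormZm modulus_of_real ger0_norm.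
- move=> x; rewrite rnorm_bseq; apply/cvgrPdist_lt => e e0.
  have [_ [N _ <-] Ns] := sup_adherent e0 (bseq_has_sup x).
  apply: filterS (Ufree N) => n Nn.
  have h1 : p n x <= bseq_norm x by exact: (@sn_le_norm R k limit_seq_norms n x).
  have h2 : p N x <= p n x by exact: p_mono.
  rewrite ger0_norm ?subr_ge0 // ltrBlDl -ltrBlDr.
  exact: lt_le_trans Ns h2.
have Cm0 : 0 <= \sum_(i < m) (2 / eps) by apply: sumr_ge0 => i _; rewrite divr_ge0 // ltW.
have T_le n (x : X) : rnorm (S n m x) <= (\sum_(i < m) (2 / eps)) * rnorm x.
  by apply: le_trans (S_le _ _ _) _; rewrite mulr_suml; apply: ler_sum.
have SB n (x y : X) : S n m (x - y) = S n m x - S n m y.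
  by rewrite /S -sumrB; apply: eq_bigr => i _; rewrite -scalerBl.
have [|||||n nP] := @uniform_seminorm_approx R k X nat U (fun n (x : X) => rnorm (S n m x))
    (fun x : X => p m x) _ G (d / 2) UF linG fdG d2 Cm0.
- by move=> n x y; apply: le_trans (rnorm_dist _ _) _; rewrite -SB T_le.
- move=> x y.
  have h : rnorm (S n m x) - rnorm (S n m y) @[n --> U] --> p m x - p m y by apply: cvgB.
  apply: (cvgr_to_le (cvg_norm h)); apply: nearW => n.
  by apply: le_trans (rnorm_dist _ _) _; rewrite -SB T_le.
- move=> n r x r0; rewrite -[X in X = _]/(rnorm (S n m (fun i => of_real k r * x i))).
  by rewrite SZ rnormZm modulus_of_real ger0_norm.
- move=> r x r0; rewrite -[RHS](_ : modulus (of_real k r) * p m x = _).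
    by rewrite -pZ.
  by rewrite modulus_of_real ger0_norm.
- by move=> x; exact: pP.
exists (fun x : X => S n m x); split=> [a x y Gx Gy|x Gx].
  rewrite -[LHS]/(S n m (fun i => a * x i + y i)) SD.
  by rewrite SZ.
have := mP x Gx; have := nP x Gx; rewrite !ler_norml => /andP[h1 h2] /andP[h3 h4].
rewrite mulrBl mulrDl mul1r.
have dE : d * rnorm x = d / 2 * rnorm x + d / 2 * rnorm x by rewrite -mulrDl -splitr.
by rewrite dE; apply/andP; split; lra.
Qed.

Let delta (i : nat) : nat -> K^o := fun j => (j == i)%:R.

Let delta_sum m i (g : nat -> K) : (i < m)%N -> \sum_(j < m) delta i j * g j = g i.
Proof.
move=> im; rewrite (bigD1 (Ordinal im)) //= /delta eqxx mul1r big1 ?addr0 // => j ji.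
by rewrite (negbTE (_ : j != i :> nat)) ?mul0r.
Qed.

Let p_delta m i : p m (delta i) <= 1.
Proof.
have [im|mi] := ltnP i m; last first.
  apply: le_trans (p_le _ _) _; rewrite big1 // => j _.
  by rewrite /delta ltn_eqF ?modulus0 // (leq_trans (ltn_ord j)).
apply: (cvgr_to_le (@pP m _)); apply: nearW => n.
rewrite /S (bigD1 (Ordinal im)) //= /delta eqxx scale1r big1 ?addr0 // => j ji.
by rewrite (negbTE (_ : j != i :> nat)) ?scale0r.
Qed.

Let delta_in i : delta i \in bounded_seqs limit_seq_norms.
Proof. by rewrite inE /=; exists 1 => m; exact: p_delta. Qed.

Let unit_vec i : X := BSeq (delta_in i).

Let unit_vec_norm i : rnorm (unit_vec i) <= 1.
Proof. by rewrite rnorm_bseq; apply: bseq_norm_le => m; exact: p_delta. Qed.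

(* The ultralimit of the unit vectors, as a functional on the dual of [X], kills all
   coordinate functionals but not the limit of the functionals [f n]. *)
Lemma limit_space_not_reflexive : ~ Defs.reflexive X.
Proof.
move=> refl.
have theta_ex i : exists l, klim U (fun n => f n (w n i)) l.
  apply: (@ultra_bounded_modulus R k nat U UF _ 1); apply: nearW => n.
  exact: le_trans (modulus_blin_le _ (f1 n)) (w1 n i).
have [theta thetaP] := choice theta_ex.
have theta_ge i : eps <= modulus (theta i).
  apply: (cvgr_to_ge (klim_modulus (thetaP i))); apply: filterS (Ufree i.+1) => n.
  exact: fw.
pose s m (a : X) : K := \sum_(i < m) a i * theta i.
have s_le m a : modulus (s m a) <= rnorm a.
  apply: le_trans (p_norm m a).
  have h : klim U (fun n => \sum_(i < m) a i * f n (w n i)) (s m a).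
    apply: (@klim_sum R k nat U _ m (fun i n => a i * f n (w n i))
      (fun i => a i * theta i)) => i _.
    exact: klimZ.
  apply: (cvg_ler (klim_modulus h) (@pP m a)); apply: nearW => n.
  rewrite (_ : \sum_(i < m) _ = f n (S n m a)) ?modulus_blin_le //.
  by rewrite /S linear_sum; apply: eq_bigr => i _; rewrite linearZ.
have phi_ex (a : X) : exists l, klim U (fun m => s m a) l.
  by apply: (@ultra_bounded_modulus R k nat U UF _ (rnorm a)); apply: nearW => m.
have [phi phiP] := choice phi_ex.
have phi_lin : linear (phi : X -> K^o).
  move=> c a b; apply: (klim_unique (phiP _)).
  rewrite [X in klim _ X](_ : _ = fun m => c * s m a + s m b).
    by apply: klimD => //; exact: klimZ.
  apply/funext => m; rewrite /s mulr_sumr -big_split; apply: eq_bigr => i _ /=.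
  by rewrite mulrDl mulrA.
have phi_le (a : X) : modulus (phi a) <= 1 * rnorm a.
  rewrite mul1r; apply: (cvgr_to_le (klim_modulus (phiP a))).
  by apply: nearW => m; exact: s_le.
have [phi' [phiE _]] := @blin_of_bound R k X K^o phi 1 phi_lin ler01 phi_le.
have Phi_ex (g : dual_space X) : exists l, klim U (fun i => g (unit_vec i)) l.
  apply: (@ultra_bounded_modulus R k nat U UF _ (opnorm g)); apply: nearW => i.
  apply: le_trans (rnorm_blin g _) _.
  by rewrite ler_piMr ?opnorm_ge0 ?unit_vec_norm.
have [Phi PhiP] := choice Phi_ex.
have Phi_lin : linear (Phi : dual_space X -> K^o).
  move=> c g h; apply: (klim_unique (PhiP _)).
  exact: klimD (klimZ c (PhiP g)) (PhiP h).
have Phi_le (g : dual_space X) : modulus (Phi g) <= 1 * rnorm g.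
  rewrite mul1r rnorm_opnorm; apply: (cvgr_to_le (klim_modulus (PhiP g))).
  apply: nearW => i; apply: le_trans (rnorm_blin g _) _.
  by rewrite ler_piMr ?opnorm_ge0 ?unit_vec_norm.
have [Phi' [PhiE _]] := @blin_of_bound R k (dual_space X) K^o Phi 1 Phi_lin ler01 Phi_le.
have [x xP] := refl Phi'.
have x0 i : x i = 0.
  have coord_lin : linear ((fun a : X => a i) : X -> K^o) by [].
  have coord_le (a : X) : modulus (a i) <= 2 / eps * rnorm a by exact: coord_norm.
  have [ci [ciE _]] := @blin_of_bound R k X K^o (fun a => a i) _ coord_lin coef_ge0 coord_le.
  rewrite -ciE -xP PhiE; apply: (klim_unique (PhiP ci)); apply: klim_near_cst.
  apply: filterS (Ufree i.+1) => j ij; rewrite ciE /= /delta.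
  by rewrite ltn_eqF.
have xe : x = 0 by apply: bseq_eq => i; rewrite x0.
have Phi0 : Phi phi' = 0 by rewrite -PhiE xP xe linear0.
have h : modulus (phi' (unit_vec i)) @[i --> U] --> (0 : R).
  by rewrite -(modulus0 R k) -Phi0; exact: klim_modulus (PhiP phi').
have : eps <= 0.
  apply: (cvgr_to_ge h); apply: nearW => i; rewrite phiE.
  rewrite (_ : phi _ = theta i) ?theta_ge //.
  apply: (klim_unique (phiP _)); apply: klim_near_cst.
  by apply: filterS (Ufree i.+1) => m im; rewrite /s -[RHS](delta_sum theta im).
by rewrite leNgt eps0.
Qed.

End limit_space.

(** The same [M] governs the length and the basis defect, so that counterexamples for all [M] are
    the successive stages of a single limit space. *)
Theorem superreflexive_no_spread (R : realType) (k : scalar_kind)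
    (E : completeNormedModType (scalars R k)) (eps : R) :
  superreflexive E -> 0 < eps -> exists M : nat,
  forall (w : nat -> E) (f : dual_space E), (forall i, rnorm (w i) <= 1) ->
    (forall (a : nat -> scalars R k) m m', (m <= m')%N -> (m' <= M)%N ->
      (1 - M.+1%:R^-1) * rnorm (\sum_(i < m) a i *: w i) <=
        rnorm (\sum_(i < m') a i *: w i)) ->
    opnorm f <= 1 -> exists2 i, (i < M)%N & modulus (f (w i)) < eps.
Proof.
move=> srE eps0; apply: contrapT => /forallNP nM.
have bad M : exists wf : (nat -> E) * dual_space E,
    [/\ forall i, rnorm (wf.1 i) <= 1,
      forall (a : nat -> scalars R k) m m', (m <= m')%N -> (m' <= M)%N ->
        (1 - M.+1%:R^-1) * rnorm (\sum_(i < m) a i *: wf.1 i) <=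
          rnorm (\sum_(i < m') a i *: wf.1 i),
      opnorm wf.2 <= 1 & forall i, (i < M)%N -> eps <= modulus (wf.2 (wf.1 i))].
  have /existsNP[w /existsNP[f]] := nM M.
  move=> /not_implyP[w1 /not_implyP[wb /not_implyP[f1 nf]]].
  exists (w, f); split=> // i iM; rewrite leNgt; apply/negP => fwi.
  by apply: nf; exists i.
have [wf wfP] := choice bad.
have [U [UF Ufree]] := free_ultrafilter.
have w1 n i : rnorm ((wf n).1 i) <= 1 by have [] := wfP n.
have wb n := let: And4 _ h _ _ := wfP n in h.
have f1 n : opnorm (wf n).2 <= 1 by have [] := wfP n.
have fw n := let: And4 _ _ _ h := wfP n in h.
apply: (@limit_space_not_reflexive R k E U eps (fun n => (wf n).1) (fun n => (wf n).2)
  UF Ufree eps0 w1 wb f1 fw).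
by apply: srE; exact: limit_space_representable.
Qed.

(** * Almost biorthogonal systems *)

Section dual_families.
Variables (R : realType) (k : scalar_kind) (E : normedModType (scalars R k)).
Local Notation K := (scalars R k).

(** If [r] functionals spanned the dual, they would send [r + 1] independent vectors to dependent
    vectors of [K^r]; yet a vector killed by all of them is killed by its norming functional, hence
    is 0. *)
Lemma infinite_dimensional_dual : infinite_dimensional [set: E] ->
  infinite_dimensional [set: dual_space E].
Proof.
move=> infE [r [psi [_ span]]].
have linT : linear_subspace [set: E] by [].
have [v [ind _]] := infinite_dimensional_independent r.+1 linT infE.
pose u j : 'rV[K]_r := \row_i psi i (v j).
apply: (@dependent_of_span K _ r
  (fun i => if insub i is Some l then delta_mx 0 l else 0) u) => [j _|d dE].
  exists (fun i => if insub i is Some l then u j 0 l else 0).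
  by under eq_bigr => i _ do rewrite valK; rewrite -row_sum_delta.
apply: ind; pose x := \sum_(j < r.+1) d j *: v j; apply: (rnorm_eq0 (x := x)).
have psi0 i : psi i x = 0.
  have /rowP/(_ i) := dE; rewrite summxE !mxE => <-.
  by rewrite /x linear_sum; apply: eq_bigr => j _; rewrite linearZ !mxE.
have [phi [_ phix]] := norming_functional x.
have [c phiE] := span phi I.
apply/eqP; rewrite eq_le rnorm_ge0 andbT (le_trans phix) // phiE.
have -> : (\sum_(i < r) c i *: psi i : dual_space E) x = \sum_(i < r) c i * psi i x.
  elim/big_ind2 : _ => [|a a' b b' <- <-|i _]; by [].
by rewrite big1 ?modulus0 // => i _; rewrite psi0 mulr0.
Qed.

(** The upper 2-estimate dualises: evaluating at [z] the combination whose coefficients are the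
    conjugates of the [phi i z] gives the bound on squares, with constant [2 ^ 2]. The norm [1 / 4]
    is approached but perhaps not attained on the unit ball, which leaves [1 / 8]. *)
Lemma dual_Dvoretzky_Rogers n : infinite_dimensional [set: E] ->
  exists (phi : nat -> dual_space E) (x : nat -> E),
    [/\ forall i, (i < n)%N -> rnorm (x i) <= 1,
      forall i, (i < n)%N -> 8^-1 <= modulus (phi i (x i)) &
      forall z, \sum_(i < n) modulus (phi i z) ^+ 2 <= 4 * rnorm z ^+ 2].
Proof.
move=> infE.
have [phi [phi_ge phi_le]] := Dvoretzky_Rogers n (infinite_dimensional_dual infE).
have x_ex i : exists z : E, (i < n)%N -> rnorm z <= 1 /\ 8^-1 <= modulus (phi i z).
  have [ni|ni] := ltnP i n; last by exists 0.
  have [|_ [z /= z1 <-] zs] := @sup_adherent _ _ 8^-1 _ (opnorm_has_sup (phi i)).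
    by [].
  exists z => _; split=> //; move: zs (phi_ge _ ni).
  by rewrite rnorm_opnorm -/(opnorm _) rnorm_modulus; lra.
have [x xP] := choice x_ex.
exists phi, x; split=> [i /xP[]//|i /xP[]//|z].
(* The conjugate of [phi i z], written without conjugation; as [0^-1 = 0], it vanishes together with
   [phi i z]. *)
pose c i : K := of_real k (modulus (phi i z) ^+ 2) / phi i z.
pose s := \sum_(i < n) modulus (phi i z) ^+ 2.
have s0 : 0 <= s by apply: sumr_ge0 => i _; rewrite sqr_ge0.
have cE i : c i * phi i z = of_real k (modulus (phi i z) ^+ 2).
  have [z0|z0] := eqVneq (phi i z) 0; last by rewrite /c mulfVK.
  by rewrite z0 mulr0 modulus0 expr0n of_real0.
have cm i : modulus (c i) = modulus (phi i z).
  rewrite /c modulusM modulus_of_real modulusV ger0_norm ?sqr_ge0 //.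
  have [->|z0] := eqVneq (phi i z) 0; first by rewrite modulus0 invr0 mulr0.
  by rewrite expr2 mulfK // modulus_eq0.
have := rnorm_blin (\sum_(i < n) c i *: phi i : dual_space E) z.
have -> : (\sum_(i < n) c i *: phi i : dual_space E) z = \sum_(i < n) c i * phi i z.
  elim/big_ind2 : _ => [|a a' b b' <- <-|i _]; by [].
under eq_bigr => i _ do rewrite cE.
rewrite -(big_morph _ (@of_realD R k) (of_real0 R k)) rnorm_modulus modulus_of_real.
rewrite ger0_norm // -/s => sle.
have cs : \sum_(i < n) modulus (c i) ^+ 2 = s by apply: eq_bigr => i _; rewrite cm.
have := phi_le c; rewrite rnorm_opnorm cs => ole.
have {}sle : s <= 2 * Num.sqrt s * rnorm z.
  by apply: le_trans sle _; rewrite ler_wpM2r ?rnorm_ge0.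
have [s00|sn0] := eqVneq s 0; first by rewrite s00 mulr_ge0 ?sqr_ge0.
have sq0 : 0 < Num.sqrt s by rewrite sqrtr_gt0 lt_def sn0.
have h : Num.sqrt s <= 2 * rnorm z.
  rewrite -(ler_pM2l sq0) -expr2 sqr_sqrtr //; apply: le_trans sle _.
  by rewrite mulrA [_ * 2]mulrC.
rewrite -(sqr_sqrtr s0) (_ : 4 * _ = (2 * rnorm z) ^+ 2); last by ring.
by rewrite ler_pXn2r ?nnegrE ?sqrtr_ge0 // mulr_ge0 ?rnorm_ge0.
Qed.

End dual_families.

Section Mazur_step.
Variables (R : realType) (k : scalar_kind).
Local Notation K := (scalars R k).

(** Without a finite net there would be an infinite bounded sequence with gaps larger than [tau],
    and its ultralimit would bring two terms closer than that. [rd] rounds a scalar to the net and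
    is arbitrary outside the ball. *)
Lemma scalar_net (B tau : R) : 0 < tau ->
  exists (q : nat) (g : 'I_q -> K) (rd : K -> 'I_q),
    forall t : K, modulus t <= B -> modulus (t - g (rd t)) <= tau.
Proof.
move=> tau0; have [l lP] : exists l : seq K, forall t : K, modulus t <= B ->
    exists2 s, s \in l & modulus (t - s) <= tau.
  apply: contrapT => /forallNP nl.
  have far (l : seq K) : exists t : K, modulus t <= B /\
      forall s, s \in l -> tau < modulus (t - s).
    have /existsNP[t /not_implyP[tB nt]] := nl l; exists t; split=> // s sl.
    by rewrite ltNge; apply/negP => ts; apply: nt; exists s.
  have [g gP] := choice far.
  pose L := fix L n := if n is m.+1 then g (L m) :: L m else [::].
  have gL m n : (m < n)%N -> g (L m) \in L n.
    elim: n => // n ih; rewrite ltnS leq_eqVlt inE => /orP[/eqP->|/ih->].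
      by rewrite eqxx.
    by rewrite orbT.
  have [U [UF Ufree]] := free_ultrafilter.
  have [|a /cvgrPdist_lt/(_ (tau / 2))] :=
      @ultra_bounded_modulus R k nat U UF (fun n => g (L n)) B.
    by apply: nearW => n; have [] := gP (L n).
  rewrite divr_gt0 // => /(_ isT) Ua.
  have [m am] := filter_ex Ua.
  have [n [an /= mn]] := filter_ex (filterI Ua (Ufree m.+1)).
  move: am an; rewrite !sub0r !normrN !ger0_norm ?modulus_ge0 // => am an.
  have [_ /(_ _ (gL _ _ mn))] := gP (L n).
  have := modulusD (g (L n) - a) (a - g (L m)).
  rewrite addrA subrK -(modulusN (a - _)) opprB; lra.
have [l0|l0] := eqVneq l [::].
  exists 1%N, (fun=> 0), (fun=> ord0) => t /lP[s]; by rewrite l0.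
exists (size l), (fun i => nth 0 l i).
have ls : (0 < size l)%N by case: (l) l0.
have rd_ex (t : K) : exists i : 'I_(size l), modulus t <= B -> modulus (t - nth 0 l i) <= tau.
  have [tB|tB] := pselect (modulus t <= B); last by exists (Ordinal ls).
  have [s sl ts] := lP t tB.
  have il : (index s l < size l)%N by rewrite index_mem.
  by exists (Ordinal il) => _ /=; rewrite nth_index.
by have [rd rdP] := choice rd_ex; exists rd.
Qed.

(* The index set [T] is chosen before [w]: the [psi t] norm the combinations of [w]
   with coefficients in a fixed net. This uniformity allows the pigeonhole argument
   of [select_pair]. *)
Lemma Mazur_step (E : normedModType K) n (B rho : R) : 0 < rho ->
  exists (T : finType) (kappa : R), 0 < kappa /\
  forall w : nat -> E, (forall i, rnorm (w i) <= 1) ->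
    (forall (c : nat -> K) i, (i < n)%N ->
      modulus (c i) <= B * rnorm (\sum_(j < n) c j *: w j)) ->
    exists psi : T -> dual_space E, (forall t, opnorm (psi t) <= 1) /\
      forall x, 64^-1 <= rnorm x -> (forall t, modulus (psi t x) <= kappa) ->
      forall (c : nat -> K) (a : K),
        (1 - rho) * rnorm (\sum_(j < n) c j *: w j) <=
          rnorm (\sum_(j < n) c j *: w j + a *: x).
Proof.
move=> rho0; pose tau := rho / (4 * n.+1%:R).
have tau0 : 0 < tau by rewrite divr_gt0 // mulr_gt0.
have ntau : n%:R * tau <= rho / 4.
  rewrite /tau mulrA ler_pdivrMr ?mulr_gt0 //.
  rewrite (_ : rho / 4 * _ = n.+1%:R * rho); last by field.
  by rewrite ler_wpM2r ?(ltW rho0) // ler_nat.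
have [q [g [rd rdP]]] := scalar_net B tau0.
(* The rounding error [rho / 4] is paid twice, and the term in [x], whose coefficient is at most
   128, costs [128 * (rho / 256) = rho / 2]. *)
exists {ffun 'I_n -> 'I_q}, (rho / 256); split; first by rewrite divr_gt0.
move=> w w1 wB.
pose u (t : {ffun 'I_n -> 'I_q}) : E := \sum_(i < n) g (t i) *: w i.
have [psi psiP] := choice (fun t => norming_functional (u t)).
exists psi; split=> [t|x x64 xk c a]; first by have [] := psiP t.
set y := \sum_(j < n) _.
have [y0|y0] := eqVneq y 0; first by rewrite y0 rnorm0 mulr0 rnorm_ge0.
have ny : 0 < rnorm y by rewrite rnorm_gt0.
pose c' i := of_real k (rnorm y)^-1 * c i.
pose y' := of_real k (rnorm y)^-1 *: y; pose a' := of_real k (rnorm y)^-1 * a.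
have y'E : y' = \sum_(j < n) c' j *: w j.
  by rewrite /y' /y scaler_sumr; apply: eq_bigr => i _; rewrite scalerA.
have iy0 : 0 <= (rnorm y)^-1 by rewrite invr_ge0 ltW.
have y'1 : rnorm y' = 1 by rewrite rnormZm modulus_of_real ger0_norm // mulVf // gt_eqF.
suff h : 1 - rho <= rnorm (y' + a' *: x).
  rewrite mulrC -ler_pdivlMl //; apply: le_trans h _.
  by rewrite /a' -scalerA -scalerDr rnormZm modulus_of_real ger0_norm.
(* A long multiple of [x] is harmless by the triangle inequality; otherwise the lower bound on
   [rnorm x] makes the coefficient at most [2 * 64]. *)
have [big|small] := leP 2 (modulus a' * rnorm x).
  have := lerB_rnorm (a' *: x) (- y'); rewrite opprK [a' *: x + _]addrC rnormN y'1 rnormZm; lra.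
have a128 : modulus a' <= 128.
  have : modulus a' * 64^-1 <= modulus a' * rnorm x by rewrite ler_wpM2l ?modulus_ge0.
  lra.
pose t : {ffun 'I_n -> 'I_q} := [ffun i : 'I_n => rd (c' i)].
have yu : rnorm (y' - u t) <= n%:R * tau.
  rewrite y'E /u -sumrB; apply: le_trans (rnorm_sum _ _ _) _.
  rewrite mulr_natl -[X in _ *+ X]card_ord -sumr_const; apply: ler_sum => i _.
  rewrite -scalerBl rnormZm ffunE; apply: le_trans (ler_piMr (modulus_ge0 _) (w1 i)) _.
  by apply: rdP; have := wB c' i (ltn_ord i); rewrite -y'E y'1 mulr1.
have [p1 pu] := psiP t.
have h1 := modulus_blin_le (y' + a' *: x) p1; have h2 := modulus_blin_le (y' - u t) p1.
have h3 := lerB_rnormD (u t) (y' - u t); have h4 := ler_rnormD (y' - u t) (u t).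
rewrite subrK y'1 in h4.
have h5 : modulus (psi t (u t)) <= modulus (psi t (y' + a' *: x)) +
    modulus (psi t (y' - u t)) + modulus a' * modulus (psi t x).
  rewrite -[X in modulus (psi t X) <= _](_ : y' + a' *: x - (y' - u t) - a' *: x = _).
    rewrite linearB linearB /= -modulusM -!rnorm_modulus.
    apply: le_trans (ler_rnormB _ _) _; rewrite lerD ?ler_rnormB //.
    by rewrite linearZ.
  by rewrite opprB addrAC addrK addrC subrK.
have h6 : modulus a' * modulus (psi t x) <= 128 * (rho / 256).
  by rewrite ler_pM ?modulus_ge0.
lra.
Qed.

End Mazur_step.

Lemma count_pigeonhole (T : Type) (C : finType) (cell : T -> C) (l : seq T) m :
  (#|C| * m < size l)%N -> exists x, (m < count (fun c => cell c == x) l)%N.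
Proof.
move=> lm; apply: contrapT => /forallNP h.
have : (size l <= #|C| * m)%N.
  have -> : size l = (\sum_x count (fun c => cell c == x) l)%N.
    elim: (l) => [|c l' ih] /=; first by rewrite big1.
    rewrite big_split /= -ih (bigD1 (cell c)) //= eqxx big1 // => x /negbTE.
    by rewrite eq_sym => ->.
  rewrite -sum_nat_const; apply: leq_sum => x _.
  by rewrite leqNgt; apply/negP; exact: h.
by rewrite leqNgt lm.
Qed.

(** Markov's inequality for the counting measure on [l]. *)
Lemma count_mul_le_sum (R : realDomainType) (T : Type) (h : T -> R) (theta : R) (l : seq T) :
  (forall c, 0 <= h c) -> 0 <= theta ->
  (count (fun c => theta < h c) l)%:R * theta <= \sum_(c <- l) h c.
Proof.
move=> h0 theta0; elim: l => [|c l ih]; first by rewrite big_nil mul0r.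
rewrite big_cons /= natrD mulrDl lerD //.
by case: ltP => [/ltW|_]; rewrite ?mul1r // mul0r.
Qed.

Section selection.
Variables (R : realType) (k : scalar_kind) (E : normedModType (scalars R k)).
Local Notation K := (scalars R k).
Variables (N : nat) (rho eta : R).
Hypotheses (rho0 : 0 < rho) (rho1 : rho <= 1) (Nrho : N%:R * rho <= 2^-1) (eta0 : 0 < eta).

(* [l] lists the pairs (functional, vector) still available after [n] choices. *)
Record selection n (g : nat -> dual_space E) (w : nat -> E)
    (l : seq (dual_space E * E)) : Prop := Selection {
  sel_norm : forall i, rnorm (w i) <= 1;
  sel_diag : forall i, (i < n)%N -> 32^-1 <= modulus (g i (w i));
  sel_off : forall i j, (i < n)%N -> (j < n)%N -> i <> j -> modulus (g i (w j)) <= eta;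
  sel_rest : forall j c, (j < n)%N -> c \in l -> modulus (c.1 (w j)) <= eta;
  sel_sq : forall z, \sum_(i < n) modulus (g i z) ^+ 2 +
    \sum_(c <- l) modulus (c.1 z) ^+ 2 <= 4 * rnorm z ^+ 2;
  sel_avail : forall c, c \in l -> rnorm c.2 <= 1 /\ 8^-1 <= modulus (c.1 c.2);
  sel_basic : forall m (a : nat -> K), (m < n)%N ->
    (1 - rho) * rnorm (\sum_(i < m) a i *: w i) <= rnorm (\sum_(i < m.+1) a i *: w i)
}.

(** Each further vector loses a factor [1 - rho], and [(1 - rho) ^ d >= 1 - d * rho]. *)
Lemma sel_prefix n g w l (a : nat -> K) m m' : selection n g w l -> (n <= N)%N ->
  (m <= m')%N -> (m' <= n)%N ->
  (1 - N%:R * rho) * rnorm (\sum_(i < m) a i *: w i) <= rnorm (\sum_(i < m') a i *: w i).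
Proof.
move=> sel nN mm' m'n.
have step d : (m + d <= n)%N ->
    (1 - d%:R * rho) * rnorm (\sum_(i < m) a i *: w i) <= rnorm (\sum_(i < m + d) a i *: w i).
  elim: d => [|d ih] dn; first by rewrite mul0r subr0 mul1r addn0.
  rewrite addnS in dn *; apply: le_trans (sel_basic sel a dn).
  have h0 := rnorm_ge0 (\sum_(i < m) a i *: w i).
  have {}ih := ih (ltnW dn).
  have h1 : (1 - rho) * ((1 - d%:R * rho) * rnorm (\sum_(i < m) a i *: w i)) <=
      (1 - rho) * rnorm (\sum_(i < m + d) a i *: w i).
    by rewrite ler_wpM2l // subr_ge0.
  apply: le_trans h1; rewrite mulrA ler_wpM2r // -natr1.
  have : 0 <= d%:R * rho * rho by rewrite !mulr_ge0 // ltW.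
  by rewrite mulrDl mul1r; nra.
have := step (m' - m)%N; rewrite subnKC // => /(_ m'n); apply: le_trans.
rewrite ler_wpM2r ?rnorm_ge0 // lerD2l lerN2 ler_wpM2r ?(ltW rho0) // ler_nat.
by rewrite (leq_trans (leq_subr _ _)) // (leq_trans m'n).
Qed.

Lemma sel_le2 n g w l i z : selection n g w l -> (i < n)%N ->
  modulus (g i z) <= 2 * rnorm z.
Proof.
move=> sel ni; rewrite -(@ler_pXn2r _ 2) ?nnegrE ?modulus_ge0 ?mulr_ge0 ?rnorm_ge0 //.
have h := sel_sq sel z; rewrite (bigD1 (Ordinal ni)) //= in h.
apply: (@le_trans _ _ (4 * rnorm z ^+ 2)); last by rewrite exprMn -natrX.
apply: le_trans h; rewrite -addrA lerDl addr_ge0 // sumr_ge0 // => j _; exact: sqr_ge0.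
Qed.

Lemma avail_le2 n g w l c z : selection n g w l -> c \in l ->
  modulus (c.1 z) <= 2 * rnorm z.
Proof.
move=> sel cl; rewrite -(@ler_pXn2r _ 2) ?nnegrE ?modulus_ge0 ?mulr_ge0 ?rnorm_ge0 //.
have h := sel_sq sel z; rewrite (perm_big _ (perm_to_rem cl)) big_cons /= in h.
apply: (@le_trans _ _ (4 * rnorm z ^+ 2)); last by rewrite exprMn -natrX.
apply: le_trans h; rewrite addrCA lerDl addr_ge0 // sumr_ge0 // => j _; exact: sqr_ge0.
Qed.

(** [256 = 64 * (2 + 2)]: [w i] has norm at least [1 / 64], and [a i *: w i] is the difference of
    two partial sums, each of norm at most twice that of the whole sum. This is the constant [B] fed
    to [Mazur_step]. *)
Lemma sel_coef n g w l (a : nat -> K) i : selection n g w l -> (n <= N)%N -> (i < n)%N ->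
  modulus (a i) <= 256 * rnorm (\sum_(j < n) a j *: w j).
Proof.
move=> sel nN ni.
have w64 : 64^-1 <= rnorm (w i).
  by have := sel_le2 (w i) sel ni; have := sel_diag sel ni; lra.
have h1 := sel_prefix a sel nN (ltnW ni) (leqnn n).
have h2 := sel_prefix a sel nN ni (leqnn n).
set s := rnorm (\sum_(j < n) _) in h1 h2 *.
have half z : 2^-1 * rnorm (z : E) <= (1 - N%:R * rho) * rnorm z.
  by rewrite ler_wpM2r ?rnorm_ge0 // lerBrDr -lerBrDl; apply: le_trans Nrho _; lra.
have := half (\sum_(j < i) a j *: w j); have := half (\sum_(j < i.+1) a j *: w j).
have aw : modulus (a i) * rnorm (w i) <=
    rnorm (\sum_(j < i.+1) a j *: w j) + rnorm (\sum_(j < i) a j *: w j).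
  rewrite -rnormZm (_ : a i *: w i = \sum_(j < i.+1) a j *: w j - \sum_(j < i) a j *: w j).
    exact: ler_rnormB.
  by rewrite big_ord_recr /= [RHS]addrC addKr.
have : modulus (a i) * 64^-1 <= modulus (a i) * rnorm (w i).
  by rewrite ler_wpM2l ?modulus_ge0.
lra.
Qed.

(* Half the difference of two available vectors in the same cell is almost annihilated
   by all [psi t] and [g i]. At a given vector of the unit ball at most [4 * 16 ^ 2 = 1024]
   available functionals exceed [1 / 16], whence the number [1026]. *)
Lemma select_pair n g w l (T : finType) (psi : T -> dual_space E) (q : nat)
    (gam : 'I_q -> K) (rd : K -> 'I_q) (kappa : R) : 0 < kappa ->
  selection n g w l -> (forall t, opnorm (psi t) <= 1) ->
  (forall t : K, modulus t <= 2 -> modulus (t - gam (rd t)) <= kappa) ->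
  (#|{ffun T + 'I_n -> 'I_q}| * 1026 < size l)%N ->
  exists c x, [/\ c \in l, rnorm x <= 1, 32^-1 <= modulus (c.1 x),
    forall t, modulus (psi t x) <= kappa & forall i, (i < n)%N -> modulus (g i x) <= kappa].
Proof.
move=> kappa0 sel psi1 rdP /(count_pigeonhole (fun c : dual_space E * E =>
  [ffun s : T + 'I_n => rd (match s with inl t => psi t c.2 | inr i => g i c.2 end)]))[C].
rewrite -size_filter; set l' := (X in (_ < size X)%N).
have l'l c : c \in l' -> c \in l by rewrite mem_filter => /andP[].
case l'E : l' => [//|d l2] /=; rewrite ltnS => l2size.
have dl : d \in l by apply: l'l; rewrite l'E mem_head.
have [d1 _] := sel_avail sel dl.
have [c cl2 cd] : exists2 c, c \in l2 & modulus (c.1 d.2) ^+ 2 <= 256^-1.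
  apply: contrapT => nc.
  have all_big c : c \in l2 -> 256^-1 < modulus (c.1 d.2) ^+ 2.
    by move=> cl2; rewrite ltNge; apply/negP => cs; apply: nc; exists c.
  have h1 : (size l2)%:R * 256^-1 <= \sum_(c <- l2) modulus (c.1 d.2) ^+ 2.
    have := @count_mul_le_sum R _ (fun c : dual_space E * E => modulus (c.1 d.2) ^+ 2)
      256^-1 l2 (fun c => sqr_ge0 _).
    have -> : count (fun c : dual_space E * E => 256^-1 < modulus (c.1 d.2) ^+ 2) l2 = size l2.
      by apply/eqP; rewrite -all_count; apply/allP => c /all_big.
    by apply; rewrite invr_ge0.
  have h2 : \sum_(c <- l2) modulus (c.1 d.2) ^+ 2 <= \sum_(c <- l) modulus (c.1 d.2) ^+ 2.
    apply: (@le_trans _ _ (\sum_(c <- l') modulus (c.1 d.2) ^+ 2)).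
      by rewrite l'E big_cons lerDr sqr_ge0.
    rewrite big_filter big_mkcond /=; apply: ler_sum => e _.
    by case: ifP => // _; exact: sqr_ge0.
  have h3 := sel_sq sel d.2.
  have h4 : 0 <= \sum_(i < n) modulus (g i d.2) ^+ 2.
    by apply: sumr_ge0 => i _; exact: sqr_ge0.
  have h5 : rnorm d.2 ^+ 2 <= 1 by rewrite exprn_ile1 ?rnorm_ge0.
  have h6 : 1026%:R <= (size l2)%:R :> R by rewrite ler_nat.
  lra.
have cl' : c \in l' by rewrite l'E inE cl2 orbT.
have cl := l'l _ cl'.
have [c1 c8] := sel_avail sel cl.
have cd16 : modulus (c.1 d.2) <= 16^-1.
  rewrite -(@ler_pXn2r _ 2) ?nnegrE ?modulus_ge0 ?invr_ge0 //.
  by rewrite exprVn -natrX.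
(* The factor [1 / 2] keeps the vector in the unit ball, and [(1 / 8 - 1 / 16) / 2 = 1 / 32]. *)
exists c, (of_real k 2^-1 *: (c.2 - d.2)).
have half (phi : dual_space E) : phi (of_real k 2^-1 *: (c.2 - d.2)) =
    of_real k 2^-1 * (phi c.2 - phi d.2) by rewrite linearZ linearB.
have cells (s : T + 'I_n) : rd (match s with inl t => psi t c.2 | inr i => g i c.2 end) =
    rd (match s with inl t => psi t d.2 | inr i => g i d.2 end).
  move: cl'; rewrite mem_filter => /andP[/eqP/ffunP/(_ s) + _].
  have : d \in l' by rewrite l'E mem_head.
  by rewrite mem_filter => /andP[/eqP/ffunP/(_ s) + _]; rewrite !ffunE => -> ->.
have close a b : modulus a <= 2 -> modulus b <= 2 -> rd a = rd b ->
    modulus (of_real k 2^-1 * (a - b)) <= kappa.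
  move=> a2 b2 ab; rewrite modulusM modulus_of_real ger0_norm ?invr_ge0 //.
  have := rdP a a2; have := rdP b b2; rewrite ab.
  have := modulusD (a - gam (rd b)) (gam (rd b) - b).
  by rewrite addrA subrK -(modulusN (gam _ - b)) opprB; lra.
split=> //.
- rewrite rnormZm modulus_of_real ger0_norm ?invr_ge0 //.
  by have := ler_rnormB c.2 d.2; lra.
- rewrite half modulusM modulus_of_real ger0_norm ?invr_ge0 //.
  have := lerB_rnorm (c.1 c.2 : K^o) (c.1 d.2); rewrite !rnorm_modulus; lra.
- move=> t; rewrite half; apply: close; last exact: (cells (inl t)).
    by have := modulus_blin_le c.2 (psi1 t); lra.
  by have := modulus_blin_le d.2 (psi1 t); lra.
- move=> i ni; rewrite half; apply: close; last exact: (cells (inr (Ordinal ni))).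
    by have := sel_le2 c.2 sel ni; lra.
  by have := sel_le2 d.2 sel ni; lra.
Qed.

(** The supply [m'] is fixed before the selection is given. It covers the pigeonhole, the pair that
    is used and the pairs that must be discarded, with [m] left over. *)
Lemma select_step n m : (n < N)%N -> exists m', forall g w l,
  selection n g w l -> (m' <= size l)%N ->
  exists g' w' l', selection n.+1 g' w' l' /\ (m <= size l')%N.
Proof.
move=> nN; have [T [kappa [kappa0 TP]]] := Mazur_step E n 256 rho0.
(* One precision serves both the norming functionals, which need [kappa], and the earlier [g i],
   which need [eta]. *)
have ke0 : 0 < Num.min kappa eta by rewrite lt_min kappa0.
have [q [gam [rd rdP]]] := scalar_net k 2 ke0.
(* By [sel_sq], at most [4 / eta ^ 2] available functionals exceed [eta] at a vector of the unit
   ball; their pairs are dropped to restore [sel_rest]. *)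
have [Q Q4] : exists Q : nat, 4 / eta ^+ 2 <= Q%:R.
  by exists (Num.bound (4 / eta ^+ 2)); apply/ltW/archi_boundP; rewrite divr_ge0 ?sqr_ge0.
exists (#|{ffun T + 'I_n -> 'I_q}| * 1026 + (m + Q)).+2 => g w l sel lsize.
have [psi [psi1 psiP]] := TP w (sel_norm sel) (fun a i => sel_coef a sel (ltnW nN)).
have [|c [x [cl x1 cx psix gx]]] := select_pair ke0 sel psi1 rdP.
  by apply: leq_trans lsize; rewrite ltnS leqW // leq_addr.
have x64 : 64^-1 <= rnorm x by have := avail_le2 x sel cl; lra.
pose bad (e : dual_space E * E) := eta ^+ 2 < modulus (e.1 x) ^+ 2.
pose l' := [seq e <- rem c l | ~~ bad e].
pose g' i := if i == n then c.1 else g i; pose w' i := if i == n then x else w i.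
have g'n i : (i < n)%N -> g' i = g i by move=> ni; rewrite /g' ltn_eqF.
have w'n i : (i < n)%N -> w' i = w i by move=> ni; rewrite /w' ltn_eqF.
have sumE m' (a : nat -> K) : (m' <= n)%N ->
    \sum_(i < m') a i *: w' i = \sum_(i < m') a i *: w i.
  by move=> m'n; apply: eq_bigr => i _; rewrite w'n // (leq_trans (ltn_ord i)).
have l'l e : e \in l' -> e \in l by rewrite mem_filter => /andP[_] /mem_rem.
have sq_split z : \sum_(i < n.+1) modulus (g' i z) ^+ 2 + \sum_(e <- rem c l) modulus (e.1 z) ^+ 2
    = \sum_(i < n) modulus (g i z) ^+ 2 + \sum_(e <- l) modulus (e.1 z) ^+ 2.
  rewrite big_ord_recr /= (perm_big _ (perm_to_rem cl)) big_cons /= addrA.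
  congr (_ + _ + _); last by rewrite /g' eqxx.
  by apply: eq_bigr => i _; rewrite g'n.
exists g', w', l'; split.
  split.
  - by move=> i; rewrite /w'; case: ifP => // _; exact: sel_norm sel i.
  - move=> i; rewrite ltnS leq_eqVlt => /orP[/eqP->|ni]; first by rewrite /g' /w' eqxx.
    by rewrite g'n // w'n // (sel_diag sel).
  - move=> i j; rewrite ltnS leq_eqVlt => /orP[/eqP->|ni];
      rewrite ltnS leq_eqVlt => /orP[/eqP->|nj] ij.
    + by case: ij.
    + by rewrite w'n // /g' eqxx (sel_rest sel nj cl).
    + rewrite g'n // /w' eqxx; apply: le_trans (gx i ni) _.
      by rewrite ge_min lexx orbT.
    + by rewrite g'n // w'n // (sel_off sel).
  - move=> j e; rewrite ltnS leq_eqVlt => /orP[/eqP->|nj] el'; last first.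
      by rewrite w'n // (sel_rest sel nj (l'l _ el')).
    move: el'; rewrite mem_filter /bad -leNgt /w' eqxx => /andP[+ _].
    by rewrite ler_pXn2r ?nnegrE ?modulus_ge0 // ltW.
  - move=> z; apply: le_trans (sel_sq sel z); rewrite -sq_split lerD2l.
    rewrite big_filter big_mkcond /=; apply: ler_sum => e _.
    by case: ifP => // _; exact: sqr_ge0.
  - by move=> e /l'l; exact: sel_avail sel e.
  - move=> m' a; rewrite ltnS leq_eqVlt => /orP[/eqP->|m'n]; last first.
      by rewrite !sumE ?(ltnW m'n) // (sel_basic sel).
    rewrite big_ord_recr /= !sumE // /w' eqxx; apply: psiP => //.
    by move=> t; apply: le_trans (psix t) _; rewrite ge_min lexx.
have : (count bad (rem c l) <= Q)%N.
  rewrite -(ler_nat R); apply: le_trans Q4; rewrite ler_pdivlMr ?exprn_gt0 //.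
  apply: le_trans (count_mul_le_sum _ _ _) _; first by move=> e; exact: sqr_ge0.
    by rewrite sqr_ge0.
  have h1 := sel_sq sel x; rewrite -sq_split in h1.
  have h2 : 0 <= \sum_(i < n.+1) modulus (g' i x) ^+ 2.
    by apply: sumr_ge0 => i _; exact: sqr_ge0.
  have h3 : rnorm x ^+ 2 <= 1 by rewrite exprn_ile1 ?rnorm_ge0.
  lra.
have := count_predC bad (rem c l); rewrite size_rem // size_filter => cE cQ.
move: lsize cE; set u := (_ * _)%N; case: (size l) => // s /= lsize cE.
rewrite -[count _ _]/(count (predC bad) (rem c l)).
rewrite -(leq_add2l (count bad (rem c l))) cE; apply: leq_trans (leq_add cQ (leqnn m)) _.
by rewrite ltnS in lsize; apply: leq_trans (ltnW lsize); rewrite addnC leq_addl.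
Qed.

(** Composing the supplies of [select_step] backwards gives the number of initial pairs; only then
    is the dual Dvoretzky-Rogers lemma invoked, its pairs forming a selection of length 0. *)
Lemma almost_biorthogonal_system : infinite_dimensional [set: E] ->
  exists (g : nat -> dual_space E) (w : nat -> E),
    [/\ forall i, rnorm (w i) <= 1,
      forall i, (i < N)%N -> 32^-1 <= modulus (g i (w i)),
      forall i j, (i < N)%N -> (j < N)%N -> i <> j -> modulus (g i (w j)) <= eta,
      forall z, \sum_(i < N) modulus (g i z) ^+ 2 <= 4 * rnorm z ^+ 2 &
      forall (a : nat -> K) m m', (m <= m')%N -> (m' <= N)%N ->
        (1 - N%:R * rho) * rnorm (\sum_(i < m) a i *: w i) <=
          rnorm (\sum_(i < m') a i *: w i)].
Proof.
move=> infE.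
have sel_ex n : (n <= N)%N -> forall m, exists m', forall l : seq (dual_space E * E),
    selection 0 (fun=> 0) (fun=> 0) l -> (m' <= size l)%N ->
    exists g w l', selection n g w l' /\ (m <= size l')%N.
  elim: n => [_ m|n ih nN m].
    by exists m => l sel lm; exists (fun=> 0), (fun=> 0), l.
  have [m1 m1P] := select_step m nN; have [m2 m2P] := ih (ltnW nN) m1.
  exists m2 => l sel lm; have [g [w [l' [sel' l'm]]]] := m2P l sel lm.
  exact: m1P sel' l'm.
have [m mP] := sel_ex N (leqnn N) 0%N.
have [phi [x [x1 px psq]]] := dual_Dvoretzky_Rogers m infE.
pose l := [seq (phi (val i), x (val i)) | i : 'I_m].
have sel : selection 0 (fun=> 0) (fun=> 0) l.
  split=> //.
  - by move=> i; rewrite rnorm0.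
  - move=> z; rewrite big_ord0 add0r /l big_map enumT /=.
    exact: psq.
  - by move=> c /mapP[i _ ->] /=; split; [exact: x1|exact: px].
have [|g [w [l' [sel' _]]]] := mP l sel; first by rewrite size_map size_enum_ord.
exists g, w; split.
- exact: sel_norm sel'.
- exact: sel_diag sel'.
- exact: sel_off sel'.
- move=> z; apply: le_trans (sel_sq sel' z); rewrite lerDl.
  by apply: sumr_ge0 => c _; exact: sqr_ge0.
- move=> a m0 m' mm' m'N; exact: (sel_prefix a sel' (leqnn N) mm' m'N).
Qed.

End selection.

(** * Operators with a large summing ratio *)

(* [b] spreads [a] over the indices satisfying [P], which turns a combination of
   the subsequence into one of [w]. *)
Lemma basic_subsequence (R : realType) (k : scalar_kind) (E : normedModType (scalars R k))
    (w : nat -> E) (N : nat) (theta : R) (P : pred nat) :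
  theta <= 1 ->
  (forall (a : nat -> scalars R k) m m', (m <= m')%N -> (m' <= N)%N ->
    theta * rnorm (\sum_(i < m) a i *: w i) <= rnorm (\sum_(i < m') a i *: w i)) ->
  let s := [seq i <- iota 0 N | P i] in
  forall (a : nat -> scalars R k) m m', (m <= m')%N -> (m' <= size s)%N ->
    theta * rnorm (\sum_(i < m) a i *: w (nth 0%N s i)) <=
      rnorm (\sum_(i < m') a i *: w (nth 0%N s i)).
Proof.
move=> th1 wb s a m m' mm' m's.
pose c t := count P (iota 0 t).
have cS t : c t.+1 = (c t + P t)%N by rewrite /c -addn1 iotaD count_cat /= addn0.
have cN : c N = size s by rewrite /s size_filter.
pose b l := if P l then a (c l) else 0.
have bE t : (t <= N)%N ->
    \sum_(l < t) b l *: w l = \sum_(j < c t) a j *: w (nth 0%N s j).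
  elim: t => [_|t ih tN]; first by rewrite !big_ord0.
  rewrite big_ord_recr /= ih ?(ltnW tN) // cS /b; case: ifP => Pt; last first.
    by rewrite scale0r addr0 addn0.
  rewrite addn1 big_ord_recr /=; congr (_ + _ *: w _).
  have -> : s = [seq i <- iota 0 t | P i] ++ t :: [seq i <- iota t.+1 (N - t.+1) | P i].
    rewrite /s -{1}(subnKC tN) -addn1 -addnA iotaD add1n filter_cat /= Pt.
    by rewrite addn1.
  by rewrite nth_cat size_filter -/(c t) ltnn subnn.
have ex_t j : (j <= c N)%N -> exists2 t, (t <= N)%N & c t = j.
  elim: (N) => [|n ih]; first by rewrite leqn0 => /eqP->; exists 0%N.
  rewrite cS; have [jc _|jc] := leqP j (c n); first by have [t tn <-] := ih jc; exists t; rewrite // leqW.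
  move=> jle; exists n.+1 => //; apply/eqP; rewrite eqn_leq cS jle andbT.
  by apply: leq_trans jc; rewrite -addn1 leq_add2l leq_b1.
move: mm'; rewrite leq_eqVlt => /orP[/eqP<-|mm'].
  by rewrite ler_piMl ?rnorm_ge0.
have [t' t'N t'm] := ex_t m' (eq_ind_r (leq m') m's cN).
have [t tN tm] : exists2 t, (t <= N)%N & c t = m.
  by apply: ex_t; rewrite cN (leq_trans (ltnW mm')).
rewrite -tm -t'm -!bE //; apply: wb => //.
rewrite leqNgt; apply/negP => t't; move: mm'; rewrite -tm -t'm ltnNge.
by rewrite /c -(subnKC (ltnW t't)) iotaD count_cat leq_addr.
Qed.

Section key_operators.
Variables (R : realType) (k : scalar_kind) (p : R).
Local Notation K := (scalars R k).
Variables (E F : completeNormedModType K).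
Hypotheses (p1 : 1 <= p) (srE : superreflexive E).
Hypotheses (infE : infinite_dimensional [set: E]) (infF : infinite_dimensional [set: F]).

Let p0 : 0 <= p. Proof. exact: le_trans p1. Qed.

Lemma powR_le_ge0 (a b : R) : 0 <= a -> a <= b -> a `^ p <= b `^ p.
Proof. by move=> a0 ab; apply: ge0_ler_powR; rewrite // nnegrE // (le_trans a0). Qed.

(** The indices where [f] is at least [eps] form a subsequence, again almost monotone, hence of
    length at most [M]. Each contributes at most 1, every other index at most [eps ^ p]. *)
Lemma few_large_values (eps : R) : 0 < eps -> exists M : nat,
  forall (N : nat) (w : nat -> E) (f : dual_space E), (forall i, rnorm (w i) <= 1) ->
    (forall (a : nat -> K) m m', (m <= m')%N -> (m' <= N)%N ->
      (1 - M.+1%:R^-1) * rnorm (\sum_(i < m) a i *: w i) <= rnorm (\sum_(i < m') a i *: w i)) ->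
    opnorm f <= 1 ->
    \sum_(i < N) modulus (f (w i)) `^ p <= M%:R + N%:R * eps `^ p.
Proof.
move=> eps0; have [M MP] := superreflexive_no_spread srE eps0.
exists M => N w f w1 wb f1; pose P i := eps <= modulus (f (w i)).
have few : (count P (iota 0 N) <= M)%N.
  rewrite leqNgt; apply/negP => big.
  have th1 : 1 - M.+1%:R^-1 <= 1 :> R by rewrite gerBl invr_ge0.
  have sb := basic_subsequence (P := P) th1 wb.
  set s := [seq _ <- _ | _] in sb; have Ms : (M < size s)%N by rewrite size_filter.
  have [||//|i iM fi] := MP (fun i => w (nth 0%N s i)) f.
  - by [].
  - by move=> a m m' mm' m'M; apply: sb => //; exact: leq_trans m'M (ltnW Ms).
  - have : nth 0%N s i \in s by rewrite mem_nth // (ltn_trans iM).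
    by rewrite mem_filter => /andP[]; rewrite /P leNgt fi.
apply: (@le_trans _ _ (\sum_(i < N) ((P i)%:R + eps `^ p))).
  apply: ler_sum => i _; have [Pi|] := boolP (P i).
    apply: le_trans (_ : _ <= 1) _; last by rewrite lerDl powR_ge0.
    have -> : 1 = 1 `^ p :> R by rewrite powR1.
    apply: powR_le_ge0; first exact: modulus_ge0.
    by apply: le_trans (modulus_blin_le _ f1) _.
  rewrite /P -ltNge => /ltW fe; rewrite add0r.
  by apply: powR_le_ge0 => //; exact: modulus_ge0.
rewrite big_split /= sumr_const card_ord mulr_natl lerD2r -natr_sum ler_nat.
apply: leq_trans few; rewrite -sum1_count [X in (_ <= X)%N]big_mkcond /=.
by rewrite -(big_mkord xpredT (fun i => nat_of_bool (P i))) /index_iota subn0.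
Qed.

Lemma finite_rank_operator N (g : nat -> dual_space E) (y : nat -> F) (C : R) :
  0 <= C -> (forall z, rnorm (\sum_(i < N) g i z *: y i) <= C * rnorm z) ->
  exists u : blin E F, (forall z, u z = \sum_(i < N) g i z *: y i) /\ opnorm u <= C.
Proof.
move=> C0 uC; have ulin : linear (fun z => \sum_(i < N) g i z *: y i).
  move=> a x z; rewrite scaler_sumr -big_split; apply: eq_bigr => i _ /=.
  by rewrite linearD linearZ scalerDl scalerA.
by have [u [uE u1]] := blin_of_bound ulin C0 uC; exists u.
Qed.

Lemma large_summing_ratio (r : R) : exists (u : blin E F) (N : nat) (w : nat -> E) (W : R),
  [/\ exists n (g : nat -> dual_space E) (y : nat -> F), forall z, u z = \sum_(i < n) g i z *: y i,
    opnorm u <= 1, 0 < W,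
    forall f : dual_space E, opnorm f <= 1 -> \sum_(i < N) modulus (f (w i)) `^ p <= W &
    r * W <= \sum_(i < N) rnorm (u (w i)) `^ p].
Proof.
(* A diagonal term has norm at least [1 / 32 * 1 / 4 * 1 / 4 = 1 / 512], one quarter coming from
   [y i] and one from the normalisation of [u]; half of this absorbs the other terms. *)
have [delta delta0 deltaE] : exists2 d : R, 0 < d & d = 1024^-1.
  by exists (1024^-1); [rewrite invr_gt0 ltr0n|reflexivity].
(* The factor 2 pays for absorbing [M] into [N * eps ^ p]; the summand 1 keeps [r'] positive. *)
pose r' := 2 * (`|r| + 1).
have r'0 : 0 < r' by rewrite mulr_gt0 // ltr_wpDl.
pose eps := delta * r' `^ (- p^-1).
have eps0 : 0 < eps by rewrite mulr_gt0 // powR_gt0.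
have epsp : eps `^ p = delta `^ p / r'.
  rewrite powRM ?powR_ge0 ?(ltW delta0) // -powRrM mulNr mulVf ?powR_inv1 ?(ltW r'0) //.
  by rewrite gt_eqF // (lt_le_trans _ p1).
have ep0 : 0 < eps `^ p by rewrite powR_gt0.
have [M MP] := few_large_values eps0.
have [N N0 MN] : exists2 N : nat, (0 < N)%N & M%:R <= N%:R * eps `^ p.
  exists (Num.bound (M%:R / eps `^ p)).+1 => //.
  rewrite -ler_pdivrMr // ltW // -natr1 ltr_wpDr //.
  by apply: archi_boundP; rewrite divr_ge0 // ltW.
(* [N * rho = 1 / (M + 2)] is below [1 / 2], as the selection demands, and below the defect
   [1 / (M + 1)] allowed by [few_large_values]. *)
pose rho : R := (N%:R * M.+2%:R)^-1; pose eta : R := delta / N.+1%:R.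
have NR : 0 < N%:R :> R by rewrite ltr0n.
have rho0 : 0 < rho by rewrite invr_gt0 mulr_gt0.
have NrhoE : N%:R * rho = M.+2%:R^-1 by rewrite /rho invfM mulrA mulfV ?mul1r // gt_eqF.
have Nrho : N%:R * rho <= 2^-1.
  by rewrite NrhoE lef_pV2 ?posrE // ler_nat.
have rho1 : rho <= 1.
  rewrite /rho invf_le1 ?mulr_gt0 // -natrM ler1n muln_gt0 N0 //.
have eta0 : 0 < eta by rewrite divr_gt0.
have [g [w [w1 gw goff gsq wb]]] := almost_biorthogonal_system rho0 rho1 Nrho eta0 infE.
have [y [y_ge y_le]] := Dvoretzky_Rogers N infF.
have u_le z : rnorm (\sum_(i < N) g i z *: y i) <= 4 * rnorm z.
  apply: le_trans (y_le (fun i => g i z)) _.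
  rewrite (_ : 4 = 2 * 2 :> R); last by rewrite -natrM.
  rewrite -mulrA ler_pM2l //.
  rewrite -[X in _ <= X]ger0_norm ?mulr_ge0 ?rnorm_ge0 // -sqrtr_sqr ler_wsqrtr //.
  by rewrite exprMn -natrX.
have u_le1 z : rnorm (\sum_(i < N) g i z *: (of_real k 4^-1 *: y i)) <= 1 * rnorm z.
  under eq_bigr => i _ do rewrite scalerA mulrC -scalerA.
  rewrite -scaler_sumr rnormZm modulus_of_real ger0_norm ?invr_ge0 // mul1r.
  by rewrite ler_pdivrMl // u_le.
have [u [uE u1]] := finite_rank_operator (y := fun i => of_real k 4^-1 *: y i) ler01 u_le1.
have y2 i : (i < N)%N -> rnorm (y i) <= 2.
  move=> iN; have := y_le (fun j => (j == i)%:R).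
  rewrite (bigD1 (Ordinal iN)) //= eqxx scale1r big1 ?addr0; last first.
    by move=> j ji; rewrite (negbTE (_ : j != i :> nat)) ?scale0r.
  rewrite (bigD1 (Ordinal iN)) //= eqxx modulus1 expr1n big1 ?addr0 ?sqrtr1 ?mulr1 //.
  by move=> j ji; rewrite (negbTE (_ : j != i :> nat)) ?modulus0 ?expr0n.
have uw i : (i < N)%N -> delta <= rnorm (u (w i)).
  move=> iN; rewrite uE (bigD1 (Ordinal iN)) //=.
  have h1 : 32^-1 * 4^-1 * 4^-1 <= rnorm (g i (w i) *: (of_real k 4^-1 *: y i)).
    rewrite !rnormZm modulus_of_real ger0_norm ?invr_ge0 // mulrA.
    by rewrite !ler_pM ?mulr_ge0 ?invr_ge0 ?gw ?y_ge ?lexx.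
  have h2 : rnorm (\sum_(j < N | j != Ordinal iN) g j (w i) *: (of_real k 4^-1 *: y j)) <= delta.
    apply: le_trans (rnorm_sum _ _ _) _.
    apply: (@le_trans _ _ (\sum_(j < N) eta / 2)).
      rewrite big_mkcond /=; apply: ler_sum => j _; case: ifP => [ji|_]; last first.
        by rewrite divr_ge0 // ltW.
      rewrite !rnormZm modulus_of_real ger0_norm ?invr_ge0 //.
      apply: ler_pM; rewrite ?modulus_ge0 ?mulr_ge0 ?rnorm_ge0 ?invr_ge0 //.
        by apply: goff => // jE; move/eqP: ji; apply; exact/val_inj.
      by have := y2 j (ltn_ord j); lra.
    rewrite sumr_const card_ord -[_ *+ N]mulr_natl /eta.
    have NN : N%:R * N.+1%:R^-1 <= 1 :> R by rewrite ler_pdivrMr // mul1r ler_nat.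
    have -> : N%:R * (delta / N.+1%:R / 2) = N%:R * N.+1%:R^-1 * (delta / 2) by ring.
    apply: le_trans (ler_wpM2r _ NN) _; first by rewrite divr_ge0 // ltW.
    lra.
  have := lerB_rnormD (g i (w i) *: (of_real k 4^-1 *: y i))
    (\sum_(j < N | j != Ordinal iN) g j (w i) *: (of_real k 4^-1 *: y j)).
  rewrite deltaE; lra.
exists u, N, w, (2 * (N%:R * eps `^ p)); split.
- by exists N, g, (fun i => of_real k 4^-1 *: y i).
- by [].
- by rewrite !mulr_gt0.
- move=> f f1; apply: le_trans (MP N w f w1 _ f1) _; last first.
    by rewrite [X in _ <= X]mulrDl mul1r lerD2r.
  move=> a m m' mm' m'N; apply: le_trans (wb a m m' mm' m'N).
  rewrite ler_wpM2r ?rnorm_ge0 // lerD2l lerN2 NrhoE lef_pV2 ?posrE // ler_nat //.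
- apply: (@le_trans _ _ (N%:R * delta `^ p)).
    rewrite epsp.
    have -> : r * (2 * (N%:R * (delta `^ p / r'))) = N%:R * delta `^ p * (2 * r / r') by ring.
    rewrite ler_piMr ?mulr_ge0 ?powR_ge0 // ler_pdivrMr // mul1r /r'.
    by have := ler_norm r; lra.
  rewrite mulr_natl -[X in _ *+ X]card_ord -sumr_const; apply: ler_sum => i _.
  by apply: powR_le_ge0; rewrite ?(ltW delta0) // uw.
Qed.

End key_operators.

(** * The gliding hump *)

Section double_series.
Variable R : realType.

(** [beta] is chosen before [a], because one enumeration has to serve for the operator and for every
    functional. *)
Lemma nneseries_pairing : exists beta : nat -> nat * nat,
  forall a : nat -> nat -> R, (forall j i, 0 <= a j i) ->
    (\sum_(n <oo) (a (beta n).1 (beta n).2)%:E =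
     \sum_(j <oo) \sum_(i <oo) (a j i)%:E)%E.
Proof.
have /card_esym/ppcard_eqP[f] := card_nat2.
exists f => a a0.
rewrite nneseries_esumT; last by move=> n; rewrite lee_fin.
rewrite nneseries_esumT; last first.
  by move=> j; apply: nneseries_ge0 => i _ _; rewrite lee_fin.
have inner j : (\sum_(i <oo) (a j i)%:E = \esum_(i in [set: nat]) (a j i)%:E)%E.
  by rewrite nneseries_esumT // => i; rewrite lee_fin.
rewrite (eq_esum (fun j _ => inner j)).
rewrite esum_esum; last by move=> j i _ _; rewrite lee_fin.
rewrite (_ : _ `*`` _ = [set: nat * nat]); last by apply/seteqP; split.
by rewrite (reindex_esum [set: nat] _ f) //; exact: bij.
Qed.

Lemma nneseries_le (a : nat -> R) (C : R) : (forall i, 0 <= a i) ->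
  (forall n, \sum_(i < n) a i <= C) -> (\sum_(i <oo) (a i)%:E <= C%:E)%E.
Proof.
move=> a0 aC; apply: lime_le; first by apply: is_cvg_nneseries => i _ _; rewrite lee_fin.
by apply: nearW => n; rewrite sumEFin lee_fin big_mkord.
Qed.

Lemma nneseries_ge (a : nat -> R) n : (forall i, 0 <= a i) ->
  ((\sum_(i < n) a i)%:E <= \sum_(i <oo) (a i)%:E)%E.
Proof.
move=> a0; have := @nneseries_lim_ge R (fun i => (a i)%:E) xpredT 0 n.
by rewrite sumEFin big_mkord; apply => i _ _; rewrite lee_fin.
Qed.

End double_series.

(** * Total boundedness and compact operators *)

Section real_metric.
Variables (R : realType) (k : scalar_kind).
Local Notation K := (scalars R k).

Lemma ltr_rnorm (V : normedModType K) (x : V) (e : R) :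
  (`|x| < of_real k e) = (rnorm x < e).
Proof. by rewrite -rnormE !lt_def ler_of_real (inj_eq (@of_real_inj R k)). Qed.

Lemma ler_rnorm (V : normedModType K) (x : V) (e : R) :
  (`|x| <= of_real k e) = (rnorm x <= e).
Proof. by rewrite -rnormE ler_of_real. Qed.

Lemma of_real_gt0 (e : R) : (0 < of_real k e) = (0 < e).
Proof. by rewrite -(of_real0 R k) !lt_def ler_of_real (inj_eq (@of_real_inj R k)). Qed.

Lemma pos_scalarE (e : K) : 0 < e -> e = of_real k (modulus e) /\ 0 < modulus e.
Proof. by move=> e0; rewrite modulusE modulus_gt0 gtr0_norm // gt_eqF. Qed.

Lemma cauchy_rnorm_cvg (V : completeNormedModType K) (F : set_system V) :
  ProperFilter F -> (forall e : R, 0 < e -> exists x, F [set y | rnorm (x - y) < e]) ->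
  exists l : V, F --> l.
Proof.
move=> PF cF; have : cauchy F.
  apply: cauchy_exP => e /pos_scalarE[eE e0]; have [x Fx] := cF _ e0.
  exists x; apply: filterS Fx => y; rewrite -ball_normE /= => xy.
  by rewrite [X in _ < X]eE ltr_rnorm.
by move/cauchy_cvgP/cvg_ex.
Qed.

Lemma cvg_rnorm_lt (V : normedModType K) (F : set_system V) (l : V) (e : R) :
  Filter F -> F --> l -> 0 < e -> F [set y | rnorm (l - y) < e].
Proof.
move=> FF /fcvgrPdist_lt/(_ (of_real k e)); rewrite of_real_gt0 => h /h.
by apply: filterS => y; rewrite ltr_rnorm.
Qed.

Lemma rapid_cauchy_limit (V : completeNormedModType K) (s : nat -> V) (e : nat -> R) :
  (forall m n, (m <= n)%N -> rnorm (s n - s m) <= e m) ->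
  (forall d, 0 < d -> exists m, e m < d) ->
  exists z, forall m, rnorm (z - s m) <= e m.
Proof.
move=> se e0; have [|z sz] := @cauchy_rnorm_cvg V (s @ \oo) _.
  move=> d /e0[m em]; exists (s m); exists m => // n /= mn.
  by rewrite rnormB; apply: le_lt_trans (se _ _ mn) em.
exists z => m; apply/ler_addgt0Pr => d d0.
have [N _ Nd] := cvg_rnorm_lt _ sz d0.
have := Nd (maxn m N) (leq_maxr _ _) => /= h.
have := ler_rnormD (z - s (maxn m N)) (s (maxn m N) - s m).
rewrite addrA subrK => /le_trans; apply; rewrite addrC lerD ?(ltW h) //.
exact: se (leq_maxl _ _).
Qed.

Definition totally_bounded_on_ball (E F : normedModType K) (h : E -> F) : Prop :=
  forall e : R, 0 < e -> exists l : seq F, forall x, rnorm x <= 1 ->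
    exists2 z, z \in l & rnorm (h x - z) <= e.

Lemma tbD (E F : normedModType K) (f g : E -> F) :
  totally_bounded_on_ball f -> totally_bounded_on_ball g ->
  totally_bounded_on_ball (fun x => f x + g x).
Proof.
move=> ftb gtb e e0; have e2 : 0 < e / 2 by rewrite divr_gt0.
have [lf lfP] := ftb _ e2; have [lg lgP] := gtb _ e2.
exists [seq a + b | a <- lf, b <- lg] => x x1.
have [a al xa] := lfP x x1; have [b bl xb] := lgP x x1.
exists (a + b); first exact: allpairs_f.
by rewrite opprD addrACA (le_trans (ler_rnormD _ _)) // (splitr e) lerD.
Qed.

Lemma tbZ (E F : normedModType K) (f : E -> F) (c : K) :
  totally_bounded_on_ball f -> totally_bounded_on_ball (fun x => c *: f x).
Proof.
move=> ftb e e0; have c1 : 0 < modulus c + 1 by rewrite ltr_wpDl ?modulus_ge0.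
have [l lP] := ftb (e / (modulus c + 1)) (divr_gt0 e0 c1).
exists [seq c *: z | z <- l] => x /lP[z zl xz]; exists (c *: z); first exact: map_f.
rewrite -scalerBr rnormZm; apply: le_trans (ler_wpM2l (modulus_ge0 _) xz) _.
by rewrite mulrA ler_pdivrMr // mulrC ler_pM2l // lerDl.
Qed.

Lemma tb_sum (E F : normedModType K) (f : nat -> E -> F) n :
  (forall i, totally_bounded_on_ball (f i)) ->
  totally_bounded_on_ball (fun x => \sum_(i < n) f i x).
Proof.
move=> ftb; elim: n => [|n ih].
  move=> e e0; exists [:: 0] => x _; exists 0; first by rewrite inE.
  by rewrite big_ord0 subr0 rnorm0 ltW.
rewrite (_ : (fun x => _) = (fun x => \sum_(i < n) f i x + f n x)); first exact: tbD.
by apply/funext => x; rewrite big_ord_recr.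
Qed.

Lemma tb_rank_one (E F : normedModType K) (g : dual_space E) (y : F) :
  totally_bounded_on_ball (fun x => g x *: y).
Proof.
move=> e e0; have y1 : 0 < rnorm y + 1 by rewrite ltr_wpDl ?rnorm_ge0.
have [q [gam [rd rdP]]] := scalar_net k (opnorm g) (divr_gt0 e0 y1).
exists [seq gam i *: y | i : 'I_q] => x x1.
exists (gam (rd (g x)) *: y); first by apply: map_f; rewrite mem_enum.
have xg : modulus (g x) <= opnorm g by exact: ler_opnorm.
rewrite -scalerBl rnormZm.
apply: le_trans (ler_wpM2r (rnorm_ge0 _) (rdP _ xg)) _.
by rewrite mulrAC ler_pdivrMr // ler_pM2l // lerDl.
Qed.

Lemma ultra_finite_cover (T : Type) (G : set_system T) (I : eqType) (A : I -> set T) (l : seq I) :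
  UltraFilter G -> G [set y | exists2 z, z \in l & A z y] -> exists z, G (A z).
Proof.
move=> UG; elim: l => [|z l ih] Gl.
  by have [y [z]] := filter_ex Gl; rewrite in_nil.
have [Az|nAz] := in_ultra_setVsetC (A z) UG; first by exists z.
apply: ih; apply: filterS (filterI Gl nAz) => y [[t tl At] nAy].
by exists t => //; move: tl; rewrite inE => /orP[/eqP tz|//]; case: nAy; rewrite -tz.
Qed.

(** An ultrafilter on the closure of the image contains one of finitely many small balls, at every
    scale; it is therefore Cauchy, and [F] is complete. *)
Lemma compact_operator_of_tb (E : normedModType K) (F : completeNormedModType K)
    (u : blin E F) : totally_bounded_on_ball u -> compact_operators E F u.
Proof.
move=> utb; rewrite /compact_operators /= precompactE compact_ultra => G UG GA.
have [|l Gl] := @cauchy_rnorm_cvg F G _.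
  move=> e e0; have e3 : 0 < e / 3 by rewrite divr_gt0.
  have [zs zsP] := utb _ e3.
  apply: (@ultra_finite_cover F G _ (fun z => [set y | rnorm (z - y) < e]) zs UG).
  apply: filterS GA => y cy.
  have /cy[_ [[x /= x1 <-] xy]] : nbhs y [set t | rnorm (y - t) < e / 3].
    by apply: cvg_rnorm_lt => //; exact: cvg_id.
  have [|z zl xz] := zsP x.
    by rewrite -(ler_rnorm x 1) of_real1.
  exists z => //=; have := ler_rnormD (z - u x) (u x - y).
  rewrite addrA subrK (rnormB z) (rnormB (u x) y) => /le_lt_trans; apply.
  move: xy xz => /= xy xz; lra.
exists l; split; last exact: Gl.
apply: (@closed_closure F); move=> B /Gl GB.
by have [y [yA yB]] := filter_ex (filterI GA GB); exists y.
Qed.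

End real_metric.

(** * Humps and their summing bounds *)

Section gliding_hump.
Variables (R : realType) (k : scalar_kind) (p : R).
Local Notation K := (scalars R k).
Variables (E F : completeNormedModType K).
Hypotheses (p1 : 1 <= p).

Let pgt0 : 0 < p. Proof. exact: lt_le_trans p1. Qed.

Lemma powRD_le (a b : R) : 0 <= a -> 0 <= b -> (a + b) `^ p <= 2 `^ p * (a `^ p + b `^ p).
Proof.
wlog ab : a b / a <= b => [h a0 b0|a0 b0].
  have [ab|/ltW ba] := leP a b; first exact: h.
  by rewrite addrC [X in _ * X]addrC; exact: h.
apply: (@le_trans _ _ ((2 * b) `^ p)).
  by apply: powR_le_ge0; rewrite ?addr_ge0 // mulr_natl mulr2n lerD2r.
by rewrite powRM // ler_wpM2l ?powR_ge0 // lerDr powR_ge0.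
Qed.

(** A finite family of weak [l_p] norm at most 1; this quantitative form allows blocks to be glued
    with prescribed weights. *)
Definition weakly_p_unit N (x : nat -> E) : Prop :=
  forall f : dual_space E, opnorm f <= 1 -> \sum_(i < N) modulus (f (x i)) `^ p <= 1.

Lemma weakly_p_unit_bound N x (f : dual_space E) (C : R) : weakly_p_unit N x ->
  0 < C -> opnorm f <= C -> \sum_(i < N) modulus (f (x i)) `^ p <= C `^ p.
Proof.
move=> wx C0 fC; pose h : dual_space E := of_real k C^-1 *: f.
have iC : 0 <= C^-1 by rewrite invr_ge0 ltW.
have h1 : opnorm h <= 1.
  rewrite -rnorm_opnorm rnormZm rnorm_opnorm modulus_of_real ger0_norm //.
  by rewrite ler_pdivrMl // mulr1.
have fE z : modulus (f z) `^ p = C `^ p * modulus (h z) `^ p.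
  rewrite -powRM ?modulus_ge0 ?(ltW C0) //.
  rewrite (_ : h z = of_real k C^-1 * f z) // modulusM modulus_of_real ger0_norm //.
  by rewrite mulrA mulfV ?mul1r // gt_eqF.
under eq_bigr => i _ do rewrite fE.
by rewrite -mulr_sumr ler_piMr ?powR_ge0 // wx.
Qed.

Lemma weakly_p_unit_norm N x i : weakly_p_unit N x -> (i < N)%N -> rnorm (x i) <= 1.
Proof.
move=> wx iN; have [f [f1 fx]] := norming_functional (x i); apply: le_trans fx _.
have := wx f f1; rewrite (bigD1 (Ordinal iN)) //= => h.
have {}h : modulus (f (x i)) `^ p <= 1.
  by apply: le_trans h; rewrite lerDl sumr_ge0 // => j _; exact: powR_ge0.
rewrite leNgt; apply/negP => big; move: h; rewrite leNgt => /negP; apply.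
by rewrite (lt_le_trans big) // le1r_powR // ltW.
Qed.

(** [D] bounds the [p]-th power of the [p]-summing norm. [u] is a bare function, so that finite
    combinations need not be repackaged as operators. *)
Definition p_summing_bound (u : E -> F) (D : R) : Prop := forall N x,
  weakly_p_unit N x -> \sum_(i < N) rnorm (u (x i)) `^ p <= D.

Lemma p_summing_bound_ge0 u D : p_summing_bound u D -> 0 <= D.
Proof.
by move=> /(_ 0%N (fun=> 0)); rewrite big_ord0; apply => f _; rewrite big_ord0 ler01.
Qed.

Lemma p_summing_bound_rank_one (g : dual_space E) (y : F) :
  exists D, p_summing_bound (fun z => g z *: y) D.
Proof.
have G0 : 0 < opnorm g + 1 by rewrite ltr_wpDl ?opnorm_ge0.
exists ((opnorm g + 1) `^ p * rnorm y `^ p) => N x wx.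
under eq_bigr => i _ do rewrite rnormZm powRM ?modulus_ge0 ?rnorm_ge0 //.
rewrite -mulr_suml ler_wpM2r ?powR_ge0 //.
by apply: weakly_p_unit_bound => //; rewrite lerDl.
Qed.

Lemma p_summing_boundD u1 u2 D1 D2 : p_summing_bound u1 D1 -> p_summing_bound u2 D2 ->
  p_summing_bound (fun z => u1 z + u2 z) (2 `^ p * (D1 + D2)).
Proof.
move=> h1 h2 N x wx.
apply: (@le_trans _ _ (2 `^ p * (\sum_(i < N) rnorm (u1 (x i)) `^ p +
    \sum_(i < N) rnorm (u2 (x i)) `^ p))).
  rewrite -big_split mulr_sumr; apply: ler_sum => i _ /=.
  apply: le_trans (powRD_le (rnorm_ge0 _) (rnorm_ge0 _)).
  by apply: powR_le_ge0; rewrite ?rnorm_ge0 ?ler_rnormD.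
by rewrite ler_wpM2l ?powR_ge0 // lerD ?h1 ?h2.
Qed.

Lemma p_summing_bound_finite_rank n (g : nat -> dual_space E) (y : nat -> F) :
  exists D, p_summing_bound (fun z => \sum_(i < n) g i z *: y i) D.
Proof.
elim: n => [|n [D hD]].
  exists 0 => N x _; rewrite big1 // => i _.
  by rewrite big_ord0 rnorm0 powR0 // gt_eqF.
have [D' hD'] := p_summing_bound_rank_one (g n) (y n).
exists (2 `^ p * (D + D')) => N x wx.
under eq_bigr => i _ do rewrite big_ord_recr /=.
exact: (p_summing_boundD hD hD').
Qed.

Record hump := Hump {
  hump_op : blin E F;
  hump_size : nat;
  hump_vec : nat -> E;
  hump_bound : R
}.

(** [r] bounds the [p]-th power of the summing norm from below, [hump_bound] from above; the upper
    bound enters the requirements on all later humps. *)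
Definition is_hump (r : R) (h : hump) : Prop :=
  [/\ totally_bounded_on_ball (hump_op h), opnorm (hump_op h) <= 1,
    weakly_p_unit (hump_size h) (hump_vec h),
    p_summing_bound (hump_op h) (hump_bound h) &
    r <= \sum_(i < hump_size h) rnorm (hump_op h (hump_vec h i)) `^ p].

Hypotheses (srE : superreflexive E).
Hypotheses (infE : infinite_dimensional [set: E]) (infF : infinite_dimensional [set: F]).

Lemma exists_hump r : exists h, is_hump r h.
Proof.
have [u [N [w [W [[n [g [y uE]]] u1 W0 wW rW]]]]] :=
  large_summing_ratio p1 srE infE infF r.
have [D uD] := p_summing_bound_finite_rank n g y.
have uE' : (u : E -> F) = fun z => \sum_(i < n) g i z *: y i by exact/funext.
pose s := W `^ (- p^-1); have s0 : 0 <= s by exact: powR_ge0.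
have sp : s `^ p = W^-1.
  by rewrite -powRrM mulNr mulVf ?gt_eqF // powR_inv1 // ltW.
exists (Hump u N (fun i => of_real k s *: w i) D); split=> //=.
- by rewrite uE'; apply: (tb_sum (f := fun i z => g i z *: y i)) => i; exact: tb_rank_one.
- move=> f f1 /=.
  under eq_bigr => i _ do rewrite linearZ modulusM modulus_of_real ger0_norm // powRM ?modulus_ge0 //.
  by rewrite -mulr_sumr sp ler_pdivrMl // mulr1 wW.
- by rewrite uE'.
- under eq_bigr => i _ do
    rewrite linearZ rnormZm modulus_of_real ger0_norm // powRM ?rnorm_ge0 //.
  by rewrite -mulr_sumr sp ler_pdivlMl // mulrC.
Qed.

(* [c j] is the weight of the [j]-th hump and [D j] bounds the summing norm of any
   combination of the earlier ones. *)
Lemma exists_humps : exists (h : nat -> hump) (c D : nat -> R),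
  [/\ c 0%N = 1, forall j, 0 < c j,
    forall j, c j.+1 * (2 * (hump_size (h j)).+1%:R) = c j,
    forall j (t : nat -> K) (L : R), (forall i, modulus (t i) <= L) ->
      p_summing_bound (fun x => \sum_(i < j) (t i * of_real k (c i)) *: hump_op (h i) x)
        (L `^ p * D j) &
    forall j, is_hump (4 `^ p * (D j + 1) * (2 ^+ j * j%:R) / c j `^ p) (h j)].
Proof.
have [pick pickP] := choice exists_hump.
(* [c j ^ p] undoes the weight of the hump, [2 ^ j] the weight its vectors receive later, and [j]
   makes the result diverge; [4 ^ p] and [D j + 1] absorb the triangle inequalities and the earlier
   humps. *)
pose req j (s : R * R) := 4 `^ p * (s.2 + 1) * (2 ^+ j * j%:R) / s.1 `^ p.
(* The factor 2 makes the tails of the weights geometric; the size of the hump makes the later humps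
   negligible when summed over its vectors. *)
pose step j (s : R * R) : R * R :=
  let h := pick (req j s) in
  (s.1 / (2 * (hump_size h).+1%:R), 2 `^ p * (s.2 + s.1 `^ p * hump_bound h)).
pose st := fix st j := if j is i.+1 then step i (st i) else (1, 0).
pose h j := pick (req j (st j)).
have c0 j : 0 < (st j).1.
  by elim: j => [|j ih] /=; rewrite ?ltr01 // divr_gt0 // mulr_gt0.
exists h, (fun j => (st j).1), (fun j => (st j).2); split=> //.
- by move=> j /=; rewrite divfK // gt_eqF // mulr_gt0.
- move=> j t L tL; have L0 : 0 <= L by exact: le_trans (modulus_ge0 _) (tL 0%N).
  elim: j => [|j ih] N x wx.
    rewrite mulr0 big1 // => i _.
    by rewrite big_ord0 rnorm0 powR0 // gt_eqF.
  under eq_bigr => i _ do rewrite big_ord_recr /=.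
  have hj : p_summing_bound (fun x => (t j * of_real k (st j).1) *: hump_op (h j) x)
      (L `^ p * ((st j).1 `^ p * hump_bound (h j))).
    move=> N' x' wx'; have [_ _ _ hb _] := pickP (req j (st j)).
    rewrite mulrA -powRM // ?(ltW (c0 j)) //.
    apply: (@le_trans _ _ ((L * (st j).1) `^ p *
        \sum_(i < N') rnorm (hump_op (h j) (x' i)) `^ p)).
      rewrite mulr_sumr; apply: ler_sum => i _.
      rewrite -powRM ?mulr_ge0 ?rnorm_ge0 ?(ltW (c0 j)) //.
      apply: powR_le_ge0; rewrite ?rnorm_ge0 // rnormZm modulusM modulus_of_real.
      by rewrite gtr0_norm // ler_wpM2r ?rnorm_ge0 // ler_wpM2r // ltW.
    by rewrite ler_wpM2l ?powR_ge0 // hb.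
  by apply: le_trans (p_summing_boundD ih hj wx) _; rewrite -mulrDr mulrCA.
Qed.

End gliding_hump.

(** * Diagonal combinations of humps *)

Section diagonal_operators.
Variables (R : realType) (k : scalar_kind) (p : R).
Local Notation K := (scalars R k).
Variables (E F : completeNormedModType K).
Hypotheses (p1 : 1 <= p).
Variables (h : nat -> hump E F) (c D : nat -> R).
Hypothesis c00 : c 0%N = 1.
Hypothesis c_gt0 : forall j, 0 < c j.
Hypothesis c_rec : forall j, c j.+1 * (2 * (hump_size (h j)).+1%:R) = c j.
Hypothesis D_bound : forall j (t : nat -> K) (L : R), (forall i, modulus (t i) <= L) ->
  p_summing_bound p (fun x => \sum_(i < j) (t i * of_real k (c i)) *: hump_op (h i) x)
    (L `^ p * D j).
Hypothesis hP : forall j, is_hump p (4 `^ p * (D j + 1) * (2 ^+ j * j%:R) / c j `^ p) (h j).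

Let v j : blin E F := hump_op (h j).

Let pgt0 : 0 < p. Proof. exact: lt_le_trans p1. Qed.

Let c_half j : 2 * c j.+1 <= c j.
Proof.
rewrite -(c_rec j) mulrA [_ * 2]mulrC ler_peMr ?mulr_ge0 ?(ltW (c_gt0 _)) //.
by rewrite ler1n.
Qed.

Let c_small d : 0 < d -> exists m, c m < d.
Proof.
move=> d0; have cS m : c m * m.+1%:R <= 1.
  elim: m => [|m ih]; first by rewrite c00 mulr1.
  apply: le_trans ih; have := c_half m; have := c_gt0 m.+1 => cm ch.
  have h1 : c m.+1 * m.+2%:R <= c m.+1 * (2 * m.+1%:R).
    by rewrite ler_pM2l // -natrM ler_nat mul2n -addnn addSn addnS ltnS ltnS leq_addr.
  by apply: le_trans h1 _; rewrite mulrA [_ * 2]mulrC ler_wpM2r.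
exists (Num.bound d^-1); set m := Num.bound _.
have dm : d^-1 < m.+1%:R.
  by apply: lt_le_trans (archi_boundP _) _; rewrite ?invr_ge0 ?(ltW d0) // ler_nat leqnSn.
have m0 : 0 < m.+1%:R :> R by [].
rewrite -(ltr_pM2r m0); apply: le_lt_trans (cS m) _.
by rewrite mulrC -ltr_pdivrMr // mul1r.
Qed.

Let c_le1 j : c j <= 1.
Proof.
elim: j => [|j ih]; first by rewrite c00.
apply: le_trans ih; apply: le_trans (c_half j); rewrite mulr_natl mulr2n lerDl.
exact: ltW.
Qed.

Let zero_of_small (V : normedModType K) (z : V) C :
  (forall m, rnorm z <= C * c m) -> z = 0.
Proof.
move=> zc; apply: rnorm_eq0; apply/eqP; rewrite eq_le rnorm_ge0 andbT.
apply/ler_addgt0Pr => d d0; rewrite add0r; have C1 : 0 < `|C| + 1 by rewrite ltr_wpDl.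
have [m cm] := c_small (divr_gt0 d0 C1); apply: le_trans (zc m) _.
apply: (@le_trans _ _ ((`|C| + 1) * c m)).
  rewrite ler_wpM2r ?(ltW (c_gt0 m)) //.
  by apply: le_trans (ler_norm C) _; rewrite lerDl.
by rewrite mulrC -ler_pdivlMr // ltW.
Qed.

Let c_tail m n : (m <= n)%N -> \sum_(m <= i < n) c i <= 2 * c m.
Proof.
move=> mn; rewrite -(subnKC mn); elim: (n - m)%N => [|d ih].
  by rewrite addn0 big_geq // mulr_ge0 // ltW.
(* The extra term [2 * c (m + e)] makes the estimate inductive. *)
suff st e : \sum_(m <= i < m + e) c i + 2 * c (m + e)%N <= 2 * c m.
  by apply: le_trans (st d.+1); rewrite lerDl mulr_ge0 // ltW.
elim: e => [|e ihe]; first by rewrite addn0 big_geq // add0r.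
rewrite addnS big_nat_recr ?leq_addr //=; apply: le_trans ihe.
rewrite -addrA lerD2l [X in _ <= X]mulr_natl mulr2n lerD2l.
exact: c_half.
Qed.

Definition diag_sum (t : nat -> K) m (x : E) : F :=
  \sum_(i < m) (t i * of_real k (c i)) *: v i x.

(** [u] is the sum of the series of the [t i * c i * v i], encoded by its rate of convergence: this
    is stable under linear combinations, determines [u], and is the bound the hump estimate
    needs. *)
Definition is_diag_op (t : nat -> K) (u : blin E F) : Prop :=
  exists A, 0 <= A /\ forall x m, rnorm (u x - diag_sum t m x) <= A * c m * rnorm x.

Let v_le j x : rnorm (v j x) <= rnorm x.
Proof.
have [_ v1 _ _ _] := hP j; apply: le_trans (rnorm_blin _ _) _.
by rewrite ler_piMl ?rnorm_ge0.
Qed.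

Lemma diag_sum_linear t m : linear (diag_sum t m).
Proof.
move=> a x y; rewrite /diag_sum scaler_sumr -big_split; apply: eq_bigr => i _ /=.
by rewrite linearD linearZ scalerDr !scalerA [a * _]mulrC.
Qed.

Lemma diag_op_exists t L : (forall i, modulus (t i) <= L) -> exists u, is_diag_op t u.
Proof.
move=> tL; have L0 : 0 <= L by exact: le_trans (modulus_ge0 _) (tL 0%N).
have lim_ex x : exists z, forall m, rnorm (z - diag_sum t m x) <= 2 * L * rnorm x * c m.
  apply: rapid_cauchy_limit => [m n mn|d d0].
    rewrite /diag_sum -!(big_mkord xpredT (fun i => (t i * of_real k (c i)) *: v i x)).
    rewrite (big_cat_nat (leq0n m) mn) /= [X in X - _]addrC addrK.
    apply: le_trans (rnorm_sum _ _ _) _.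
    apply: (@le_trans _ _ (\sum_(m <= i < n) c i * (L * rnorm x))).
      apply: ler_sum => i _; rewrite rnormZm modulusM modulus_of_real gtr0_norm //.
      rewrite mulrA [c i * L]mulrC ler_pM ?mulr_ge0 ?modulus_ge0 ?rnorm_ge0 ?(ltW (c_gt0 i)) ?v_le //.
      by rewrite ler_wpM2r // ltW.
    rewrite -mulr_suml mulrC -mulrA [2 * L * _]mulrAC -mulrA mulrCA mulrC -!mulrA.
    apply: le_trans (ler_wpM2r _ (c_tail mn)) _; first by rewrite mulr_ge0 ?rnorm_ge0.
    by rewrite le_eqVlt; apply/orP; left; apply/eqP; ring.
  have C1 : 0 < 2 * L * rnorm x + 1 by rewrite ltr_wpDl // !mulr_ge0 ?rnorm_ge0.
  have [m cm] := c_small (divr_gt0 d0 C1); exists m.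
  rewrite ltr_pdivlMr // in cm; apply: le_lt_trans cm.
  by rewrite mulrC ler_pM2l // lerDl.
have [f fP] := choice lim_ex.
have flin : linear f.
  move=> a x y; apply/eqP; rewrite -subr_eq0; apply/eqP.
  apply: (@zero_of_small _ _ (2 * L * rnorm (a *: x + y) +
    (modulus a * (2 * L * rnorm x) + 2 * L * rnorm y))) => m.
  have -> : f (a *: x + y) - (a *: f x + f y) =
      (f (a *: x + y) - diag_sum t m (a *: x + y)) -
      (a *: (f x - diag_sum t m x) + (f y - diag_sum t m y)).
    by rewrite diag_sum_linear scalerBr [in RHS]addrACA -opprD [in RHS]opprB addrA subrK.
  apply: le_trans (ler_rnormB _ _) _; rewrite mulrDl lerD ?fP //.
  apply: le_trans (ler_rnormD _ _) _; rewrite mulrDl lerD ?fP // rnormZm -mulrA.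
  by rewrite ler_wpM2l ?modulus_ge0 // fP.
have fb x : rnorm (f x) <= 2 * L * rnorm x.
  by have := fP x 0%N; rewrite /diag_sum big_ord0 subr0 c00 mulr1.
have [u [uf _]] := blin_of_bound flin (mulr_ge0 (ler0n _ 2) L0) fb.
exists u, (2 * L); split; first by rewrite mulr_ge0.
by move=> x m; rewrite uf mulrAC.
Qed.

Lemma is_diag_op_linear a t t' u u' : is_diag_op t u -> is_diag_op t' u' ->
  is_diag_op (fun i => a * t i + t' i) (a *: u + u').
Proof.
move=> [A [A0 uA]] [A' [A'0 uA']]; exists (modulus a * A + A'); split.
  by rewrite addr_ge0 // mulr_ge0 ?modulus_ge0.
move=> x m.
have -> : (a *: u + u') x - diag_sum (fun i => a * t i + t' i) m x =
    a *: (u x - diag_sum t m x) + (u' x - diag_sum t' m x).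
  rewrite scalerBr addrACA -opprD; congr (_ - _).
  rewrite /diag_sum scaler_sumr -big_split; apply: eq_bigr => i _ /=.
  by rewrite scalerA -scalerDl mulrDl mulrA.
apply: le_trans (ler_rnormD _ _) _; rewrite !mulrDl lerD //.
by rewrite rnormZm -!mulrA ler_wpM2l ?modulus_ge0 // mulrA.
Qed.

Lemma is_diag_op0 t u : (forall i, t i = 0) -> is_diag_op t u -> u = 0.
Proof.
move=> t0 [A [A0 uA]]; apply: blin_eqP => x.
apply: (@zero_of_small _ _ (A * rnorm x)) => m; rewrite mulrAC.
have := uA x m; rewrite /diag_sum big1 ?subr0 // => i _.
by rewrite t0 mul0r scale0r.
Qed.

Lemma is_diag_op_zero : is_diag_op (fun=> 0) 0.
Proof.
exists 0; split=> // x m; rewrite !mul0r /diag_sum big1 ?subr0; last first.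
  by move=> i _; rewrite mul0r scale0r.
by rewrite (_ : (0 : blin E F) x = 0) // rnorm0.
Qed.

(** The partial sums are totally bounded and converge at the rate [A * c m], uniformly on the unit
    ball. *)
Lemma is_diag_op_compact t u : is_diag_op t u -> compact_operators E F u.
Proof.
move=> [A [A0 uA]]; apply: compact_operator_of_tb => e e0.
have e2 : 0 < e / 2 by rewrite divr_gt0.
have A1 : 0 < A + 1 by rewrite ltr_wpDl.
have [m cm] := c_small (divr_gt0 e2 A1); rewrite ltr_pdivlMr // in cm.
have [|l lP] := (tb_sum (f := fun i x => (t i * of_real k (c i)) *: v i x) m _) _ e2.
  by move=> i; apply: tbZ; have [] := hP i.
exists l => x x1; have [z zl xz] := lP x x1; exists z => //.
have um : rnorm (u x - diag_sum t m x) <= e / 2.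
  apply: le_trans (uA x m) _; apply: le_trans (ltW cm).
  apply: (@le_trans _ _ (A * c m)).
    by rewrite ler_piMr // mulr_ge0 // ltW.
  by rewrite mulrC ler_pM2l // lerDl.
have := ler_rnormD (u x - diag_sum t m x) (diag_sum t m x - z).
by rewrite addrA subrK => /le_trans; apply; rewrite (splitr e) lerD.
Qed.

(** The [j]-th term is [u] minus the earlier terms minus the tail from [j + 1] on. The earlier terms
    cost [L ^ p * D j], the tail [A ^ p], and the prescribed ratio of the hump outweighs both. *)
Let hump_estimate t (u : blin E F) L A a j : (forall i, modulus (t i) <= L) -> 0 <= A -> 0 <= a ->
  (forall x m, rnorm (u x - diag_sum t m x) <= A * c m * rnorm x) -> a <= modulus (t j) ->
  a `^ p * (2 ^+ j * j%:R) - (L + A) `^ p <=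
    \sum_(i < hump_size (h j)) rnorm (u (hump_vec (h j) i)) `^ p.
Proof.
move=> tL A0 a0 uA atj; have L0 : 0 <= L by exact: le_trans (modulus_ge0 _) (tL 0%N).
have [_ _ wX _ ratio] := hP j.
set N := hump_size (h j) in wX ratio *; set X := hump_vec (h j) in wX ratio *.
set B := \sum_(i < N) rnorm (u (X i)) `^ p.
have B0 : 0 <= B by apply: sumr_ge0 => i _; exact: powR_ge0.
set LA := (L + A) `^ p.
have D1 : 0 <= L `^ p * D j := p_summing_bound_ge0 (D_bound j tL).
have Dj0 : 0 <= D j.
  by have := p_summing_bound_ge0 (D_bound (L := 1) j (t := fun=> 0) (fun i => _));
    rewrite powR1 mul1r; apply; rewrite modulus0.
(* The recursion for [c] provides the factor [1 / (N + 1)], and [p >= 1] lets its [p]-th power be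
   replaced by itself; the [N] vectors together then cost at most [A ^ p]. *)
have tail_le (i : 'I_N) : rnorm (u (X i) - diag_sum t j.+1 (X i)) `^ p <= A `^ p * N.+1%:R^-1.
  have Xi1 := weakly_p_unit_norm p1 wX (ltn_ord i).
  have N1 : 0 < N.+1%:R^-1 :> R by rewrite invr_gt0.
  apply: (@le_trans _ _ ((A * N.+1%:R^-1) `^ p)).
    apply: powR_le_ge0; rewrite ?rnorm_ge0 //; apply: le_trans (uA _ _) _.
    rewrite -mulrA ler_wpM2l //; apply: (@le_trans _ _ (c j.+1)).
      by rewrite ler_piMr // ltW.
    rewrite -(ler_pM2r (_ : 0 < 2 * N.+1%:R)) ?mulr_gt0 // c_rec.
    rewrite mulrCA mulVf // mulr1; apply: le_trans (c_le1 j) _; by rewrite ler1n.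
  rewrite powRM ?(ltW N1) // ler_wpM2l ?powR_ge0 //.
  by rewrite ge1r_powR // N1 invf_le1 // ler1n.
have sumS : \sum_(i < N) rnorm (diag_sum t j (X i)) `^ p <= LA * D j.
  apply: le_trans (D_bound j tL wX) _; rewrite ler_wpM2r // /LA.
  by apply: powR_le_ge0; rewrite ?lerDl.
have sumT : \sum_(i < N) rnorm (u (X i) - diag_sum t j.+1 (X i)) `^ p <= LA.
  apply: (@le_trans _ _ (\sum_(i < N) A `^ p * N.+1%:R^-1)); first exact: ler_sum.
  rewrite sumr_const card_ord -[_ *+ N]mulr_natl mulrCA.
  apply: (@le_trans _ _ (A `^ p)).
    by rewrite ler_piMr ?powR_ge0 // ler_pdivrMr // mul1r ler_nat.
  by apply: powR_le_ge0; rewrite ?lerDr.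
have four : 4 `^ p = 2 `^ p * 2 `^ p :> R by rewrite -powRM // -natrM.
have term (i : 'I_N) : a `^ p * (c j `^ p * rnorm (v j (X i)) `^ p) <=
    2 `^ p * rnorm (u (X i)) `^ p + 4 `^ p * (rnorm (diag_sum t j (X i)) `^ p +
      rnorm (u (X i) - diag_sum t j.+1 (X i)) `^ p).
  rewrite -[X in X <= _](_ : (a * (c j * rnorm (v j (X i)))) `^ p = _); last first.
    by rewrite !powRM ?mulr_ge0 ?rnorm_ge0 ?(ltW (c_gt0 j)).
  apply: (@le_trans _ _ (rnorm (u (X i) - (diag_sum t j (X i) +
      (u (X i) - diag_sum t j.+1 (X i)))) `^ p)).
    apply: powR_le_ge0; rewrite ?mulr_ge0 ?rnorm_ge0 ?(ltW (c_gt0 j)) //.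
    have -> : u (X i) - (diag_sum t j (X i) + (u (X i) - diag_sum t j.+1 (X i))) =
        (t j * of_real k (c j)) *: v j (X i).
      rewrite /diag_sum big_ord_recr /= opprD opprB.
      by rewrite !addrA subrK addrAC subrr add0r.
    rewrite rnormZm modulusM modulus_of_real gtr0_norm // mulrA.
    by rewrite ler_wpM2r ?rnorm_ge0 // ler_wpM2r // ltW.
  apply: le_trans (powR_le_ge0 p1 (rnorm_ge0 _) (ler_rnormB _ _)) _.
  apply: le_trans (powRD_le p1 (rnorm_ge0 _) (rnorm_ge0 _)) _.
  rewrite mulrDr lerD2l four -mulrA ler_wpM2l ?powR_ge0 //.
  apply: le_trans (powR_le_ge0 p1 (rnorm_ge0 _) (ler_rnormD _ _)) _.
  by apply: powRD_le; rewrite ?rnorm_ge0.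
have total : a `^ p * (c j `^ p * \sum_(i < N) rnorm (v j (X i)) `^ p) <=
    2 `^ p * B + 4 `^ p * (LA * D j + LA).
  rewrite mulr_sumr mulr_sumr; apply: le_trans (ler_sum _ (fun i _ => term i)) _.
  rewrite big_split -!mulr_sumr big_split /= lerD2l ler_wpM2l ?powR_ge0 //.
  exact: lerD.
have cjp : 0 < c j `^ p by rewrite powR_gt0.
rewrite ler_pdivrMr // in ratio.
have four0 : 0 < 4 `^ p :> R by rewrite powR_gt0.
have total2 : 4 `^ p * ((D j + 1) * (a `^ p * (2 ^+ j * j%:R) - LA)) <= 4 `^ p * B.
  have h1 : a `^ p * (4 `^ p * (D j + 1) * (2 ^+ j * j%:R)) <=
      2 `^ p * B + 4 `^ p * (LA * D j + LA).
    by apply: le_trans total; rewrite ler_wpM2l ?powR_ge0 // [X in _ <= X]mulrC.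
  have h2 : 2 `^ p * B <= 4 `^ p * B.
    by rewrite ler_wpM2r //; apply: powR_le_ge0 => //; rewrite ler_nat.
  have -> : 4 `^ p * ((D j + 1) * (a `^ p * (2 ^+ j * j%:R) - LA)) =
      a `^ p * (4 `^ p * (D j + 1) * (2 ^+ j * j%:R)) - 4 `^ p * (LA * D j + LA) by ring.
  by rewrite lerBlDr (le_trans h1) // lerD2r.
rewrite ler_pM2l // in total2.
have [neg|pos] := leP (a `^ p * (2 ^+ j * j%:R) - LA) 0; first exact: le_trans neg B0.
apply: le_trans total2; rewrite ler_peMl ?(ltW pos) //.
by rewrite lerDr.
Qed.

Let sum_if_le (b : nat -> R) n L : (forall i, 0 <= b i) ->
  \sum_(i < n) (if (i < L)%N then b i else 0) <= \sum_(i < L) b i.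
Proof.
move=> b0; rewrite (big_ord_widen _ (fun i => if (i < L)%N then b i else 0) (leq_maxl n L)).
rewrite (big_ord_widen _ b (leq_maxr n L)) [X in _ <= X]big_mkcond [X in X <= _]big_mkcond /=.
by apply: ler_sum => i _; case: ifP => _ //; case: ifP.
Qed.

(** The weights [2 ^ (- j / p)] make the blocks jointly weakly [p]-summable; padding by 0 turns each
    block into an infinite row, as the pairing requires. *)
Let scaled_vec (q : nat * nat) : E :=
  if (q.2 < hump_size (h q.1))%N then
    of_real k ((2^-1 ^+ q.1) `^ p^-1) *: hump_vec (h q.1) q.2
  else 0.

Let powR_scaled_vec (V : normedModType K) (f : blin E V) q :
  rnorm (f (scaled_vec q)) `^ p = if (q.2 < hump_size (h q.1))%N then
    2^-1 ^+ q.1 * rnorm (f (hump_vec (h q.1) q.2)) `^ p else 0.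
Proof.
rewrite /scaled_vec; case: ifP => _; last by rewrite linear0 rnorm0 powR0 // gt_eqF.
rewrite linearZ /= rnormZm modulus_of_real ger0_norm ?powR_ge0 //.
rewrite powRM ?powR_ge0 ?rnorm_ge0 // -powRrM mulVf ?gt_eqF // powRr1 //.
Qed.

Let geometric_le2 n : \sum_(j < n) (2^-1 : R) ^+ j <= 2.
Proof.
suff -> : \sum_(j < n) (2^-1 : R) ^+ j = 2 - 2 * 2^-1 ^+ n.
  by rewrite gerBl mulr_ge0 // exprn_ge0 // invr_ge0.
elim: n => [|n ih]; first by rewrite big_ord0 expr0 mulr1 subrr.
by rewrite big_ord_recr /= ih exprS mulrA mulfV // mul1r mulr_natl mulr2n opprD addrA addrNK.
Qed.

(** On the concatenated weighted blocks, block [j] contributes at least [a ^ p * j] minus a constant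
    whenever [t j] has modulus at least [a], and such [j] are arbitrarily large. *)
Lemma is_diag_op_not_summing t u L a : (forall i, modulus (t i) <= L) -> 0 < a ->
  (forall J, exists2 j, (J <= j)%N & a <= modulus (t j)) -> is_diag_op t u ->
  ~ absolutely_summing_operators E F p u.
Proof.
move=> tL a0 ta [A [A0 uA]] usum; have [beta betaP] := nneseries_pairing R.
have half0 j : 0 <= (2^-1 : R) ^+ j by rewrite exprn_ge0 // invr_ge0.
pose x n := scaled_vec (beta n).
have xE (V : normedModType K) (f : blin E V) :
    (\sum_(n <oo) (rnorm (f (x n)) `^ p)%:E = \sum_(j <oo) \sum_(i <oo)
      (if (i < hump_size (h j))%N then
        2^-1 ^+ j * rnorm (f (hump_vec (h j) i)) `^ p else 0)%:E)%E.
  rewrite -(betaP (fun j i => if (i < hump_size (h j))%N then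
    2^-1 ^+ j * rnorm (f (hump_vec (h j) i)) `^ p else 0)); last first.
    by move=> j i; case: ifP => // _; rewrite mulr_ge0 ?powR_ge0.
  by congr (limn _); apply/funext => n; apply: eq_bigr => i _; rewrite powR_scaled_vec.
have wx : weakly_summable p x.
  move=> f; rewrite xE; pose C := opnorm f + 1.
  have C0 : 0 < C by rewrite ltr_wpDl ?opnorm_ge0.
  apply: (@le_lt_trans _ _ (2 * C `^ p)%:E); last exact: ltry.
  apply: (@le_trans _ _ (\sum_(j <oo) (2^-1 ^+ j * C `^ p)%:E)%E).
    apply: lee_nneseries => [j _ _|j _].
      by apply: nneseries_ge0 => i _ _; rewrite lee_fin; case: ifP => // _; rewrite mulr_ge0 ?powR_ge0.
    apply: nneseries_le => [i|n]; first by case: ifP => // _; rewrite mulr_ge0 ?powR_ge0.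
    apply: le_trans (sum_if_le (b := fun i => 2^-1 ^+ j * rnorm (f (hump_vec (h j) i)) `^ p) _ _ _) _.
      by move=> i; rewrite mulr_ge0 ?powR_ge0.
    rewrite -mulr_sumr ler_wpM2l //; have [_ _ wX _ _] := hP j.
    by apply: weakly_p_unit_bound => //; rewrite lerDl.
  apply: nneseries_le => [j|n]; first by rewrite mulr_ge0 ?powR_ge0.
  by rewrite -mulr_suml ler_wpM2r ?powR_ge0 ?geometric_le2.
have := usum x wx; rewrite xE => fin.
have block j : ((2^-1 ^+ j * \sum_(i < hump_size (h j)) rnorm (u (hump_vec (h j) i)) `^ p)%:E <=
    \sum_(j <oo) \sum_(i <oo) (if (i < hump_size (h j))%N then
      2^-1 ^+ j * rnorm (u (hump_vec (h j) i)) `^ p else 0)%:E)%E.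
  have term0 j' i : (0 <= (if (i < hump_size (h j'))%N then
      2^-1 ^+ j' * rnorm (u (hump_vec (h j') i)) `^ p else 0)%:E)%E.
    by rewrite lee_fin; case: ifP => // _; rewrite mulr_ge0 ?powR_ge0.
  have h1 := @nneseries_lim_ge R (fun j => \sum_(i <oo) (if (i < hump_size (h j))%N then
      2^-1 ^+ j * rnorm (u (hump_vec (h j) i)) `^ p else 0)%:E)%E xpredT 0 j.+1.
  apply: le_trans (h1 _); last by move=> j' _ _; apply: nneseries_ge0 => i _ _.
  rewrite big_nat_recr //=; apply: le_trans (leeDr _ _); last first.
    by apply: sume_ge0 => j' _; apply: nneseries_ge0 => i _ _.
  have h2 := @nneseries_ge R (fun i => if (i < hump_size (h j))%N then
      2^-1 ^+ j * rnorm (u (hump_vec (h j) i)) `^ p else 0) (hump_size (h j)).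
  apply: le_trans (h2 _); last by move=> i; rewrite -lee_fin.
  rewrite lee_fin mulr_sumr; apply: ler_sum => i _; by rewrite ltn_ord.
move: fin block; set T := (\sum_(j <oo) _)%E => fin block.
have Tfin : T \is a fin_num.
  rewrite ge0_fin_numE //; apply: nneseries_ge0 => j _ _; apply: nneseries_ge0 => i _ _.
  by rewrite lee_fin; case: ifP => // _; rewrite mulr_ge0 ?powR_ge0.
pose r := fine T; have rT : T = r%:E by rewrite fineK.
have ap : 0 < a `^ p by rewrite powR_gt0.
(* From this index on, a single block exceeds the finite total [r]. *)
have [j Jj atj] := ta (Num.bound ((`|r| + (L + A) `^ p) / a `^ p)).
have jbig : `|r| + (L + A) `^ p < a `^ p * j%:R.
  rewrite mulrC -ltr_pdivrMr //; apply: lt_le_trans (archi_boundP _) _.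
    by rewrite divr_ge0 ?addr_ge0 ?powR_ge0.
  by rewrite ler_nat.
have := block j; rewrite rT lee_fin => blj.
have est := hump_estimate tL A0 (ltW a0) uA atj.
have h2 : 2^-1 ^+ j * (a `^ p * (2 ^+ j * j%:R) - (L + A) `^ p) <= r.
  by apply: le_trans blj; rewrite ler_wpM2l.
have h3 : 2^-1 ^+ j * (a `^ p * (2 ^+ j * j%:R) - (L + A) `^ p) =
    a `^ p * j%:R - 2^-1 ^+ j * (L + A) `^ p.
  by rewrite mulrBr mulrCA [2^-1 ^+ j * (2 ^+ j * _)]mulrA -exprMn mulVf // expr1n mul1r.
have h4 : 2^-1 ^+ j * (L + A) `^ p <= (L + A) `^ p.
  by rewrite ler_piMl ?powR_ge0 // exprn_ile1 ?invr_ge0 // invf_le1 // ler1n.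
have := ler_norm r; lra.
Qed.

End diagonal_operators.

(** * The infinite-dimensional space of operators *)

Lemma infinite_fibers k J : exists2 j, (J <= j)%N & logn 2 j.+1 = k.
Proof.
(* An odd multiple of [2 ^ k], shifted by one because the valuation is that of [j + 1]. *)
exists (2 ^ k * J.*2.+1).-1.
  rewrite -ltnS prednK ?muln_gt0 ?expn_gt0 //.
  apply: leq_trans (leq_pmull _ (expn_gt0 2 k)).
  by rewrite ltnS -addnn leq_addr.
rewrite prednK ?muln_gt0 ?expn_gt0 // lognM ?expn_gt0 // pfactorK //.
by rewrite logn_coprime ?addn0 // prime_coprime // dvdn2 /= odd_double.
Qed.

Theorem theorem2p1 (R : realType) (k : scalar_kind) (p : R)
    (E F : completeNormedModType (scalars R k)) :
  1 <= p ->
  superreflexive E ->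
  infinite_dimensional [set: E] ->
  infinite_dimensional [set: F] ->
  (exists (S : set E) (e : nat -> E),
     [/\ complemented S, infinite_dimensional S & unconditional_basis S e])
  \/ (exists f : nat -> F, unconditional_basic_sequence f) ->
  lineable (compact_operators E F `\` absolutely_summing_operators E F p) /\
  lineable ([set: blin E F] `\` absolutely_summing_operators E F p).
Proof.
move=> p1 srE infE infF _.
have [h [c [D [c0 cpos crec Db hP]]]] := exists_humps p1 srE infE infF.
pose tau j := logn 2 j.+1.
(* Finite support makes [lam \o tau] bounded, while a nonzero value of [lam] still recurs along an
   infinite fibre of [tau]. *)
pose finsupp (lam : nat -> scalars R k) := exists n, forall i, (n <= i)%N -> lam i = 0.
pose S : set (blin E F) :=
  [set u | exists lam, finsupp lam /\ is_diag_op h c (lam \o tau) u].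
have bounded lam : finsupp lam -> exists L, forall i, modulus (lam (tau i)) <= L.
  move=> [n lamn]; exists (\sum_(i < n) modulus (lam i)) => i.
  have [tn|tn] := ltnP (tau i) n; last first.
    by rewrite lamn // modulus0 sumr_ge0 // => j _; exact: modulus_ge0.
  by rewrite (bigD1 (Ordinal tn)) //= lerDl sumr_ge0 // => j _; exact: modulus_ge0.
have not_summing lam u j : finsupp lam -> lam j != 0 ->
    is_diag_op h c (lam \o tau) u -> ~ absolutely_summing_operators E F p u.
  move=> /bounded[L tL] lamj; have mj : 0 < modulus (lam j) by rewrite modulus_gt0.
  apply: (is_diag_op_not_summing p1 c0 cpos crec Db hP tL mj) => J.
  by have [i Ji ij] := infinite_fibers j J; exists i => //=; rewrite /tau ij.
have linS : linear_subspace S.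
  split.
    exists (fun=> 0); split; first by exists 0%N.
    exact: is_diag_op_zero.
  move=> a u u' [lam [[n lamn] ulam]] [lam' [[n' lamn'] ulam']].
  exists (fun i => a * lam i + lam' i); split; last exact: is_diag_op_linear.
  exists (maxn n n') => i; rewrite geq_max => /andP[ni n'i].
  by rewrite lamn // lamn' // mulr0 addr0.
have infS : infinite_dimensional S.
  apply: infinite_dimensional_of_independent => m.
  have u_ex j : exists u, is_diag_op h c ((fun i => (i == j)%:R) \o tau) u.
    apply: (diag_op_exists c0 cpos crec hP (L := 1)) => i /=.
    by case: eqP => _; rewrite ?modulus1 ?modulus0.
  have [u uP] := choice u_ex; exists u; split; last first.
    move=> j; exists (fun i => (i == j)%:R); split=> //.
    by exists j.+1 => i ji; rewrite gtn_eqF.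
  (* A vanishing combination with [d i != 0] would be a diagonal operator for the extension of [d]
     by 0, hence not summing, whereas the zero operator is summing. *)
  move=> d d0 i im; apply: contrapT => /eqP di.
  pose lam l := if (l < m)%N then d l else 0.
  have sumP n : is_diag_op h c ((fun l => if (l < n)%N then d l else 0) \o tau)
      (\sum_(i < n) d i *: u i).
    elim: n => [|n ih].
      rewrite big_ord0; exact: is_diag_op_zero.
    rewrite big_ord_recr /= addrC.
    have := is_diag_op_linear (d n) (uP n) ih; congr (is_diag_op h c _ _).
    apply/funext => l /=; rewrite ltnS [(_ <= n)%N in RHS]leq_eqVlt.
    case: eqP => [->|_]; first by rewrite ltnn mulr1 addr0.
    by rewrite mulr0 add0r.
  have lamfs : finsupp lam by exists m => l ml; rewrite /lam ltnNge ml.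
  have lami : lam i != 0 by rewrite /lam im.
  apply: (not_summing lam _ i lamfs lami (sumP m)); rewrite d0 => x _.
  apply: (@le_lt_trans _ _ 0%:E); last exact: ltry.
  apply: nneseries_le => [j|n]; first exact: powR_ge0.
  rewrite big1 // => j _.
  by rewrite (_ : (0 : blin E F) (x j) = 0) // rnorm0 powR0 // gt_eqF // (lt_le_trans _ p1).
have sub u : S u -> u = 0 \/ compact_operators E F u /\ ~ absolutely_summing_operators E F p u.
  move=> [lam [fs ulam]].
  have [lam0|/existsNP[j /eqP lamj]] := pselect (forall i, lam i = 0).
    left; apply: (is_diag_op0 c0 cpos crec _ ulam) => i; exact: lam0.
  right; split; last exact: not_summing lamj ulam.
  exact: (is_diag_op_compact c0 cpos crec hP ulam).
by split; exists S; split=> // u /sub[->|[uc us]]; [right|left|right|left].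
Qed.
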